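(* Let $D$ be an integral domain and $\star$ a semistar operation on $D$ with $\widetilde{\star}\text{-}\dim(D)<\infty$. The following are equivalent: (1) every $(\star,d_T)$-linked overring $T$ of $D$ is a stably strong S-domain; (2) every $(\star,d_T)$-linked overring $T$ of $D$ is a strong S-domain; (3) every $(\star,d_T)$-linked overring $T$ of $D$ is a Jaffard domain; (4) every $(\star,d_T)$-linked overring $T$ of $D$ is a quasi-Prüfer domain; (5) $D$ is a $\widetilde{\star}$-quasi-Prüfer domain.
   Context: $D$ is an integral domain with quotient field $K$; $f(D)$ denotes nonzero finitely generated fractional ideals, $\overline{\mathcal F}(D)$ nonzero $D$-submodules of $K$. A semistar operation $\star$ on $D$ is a map $\overline{\mathcal F}(D)\to\overline{\mathcal F}(D)$ with $(xE)^\star=xE^\star$ ($0\neq x\in K$), $E\subseteq F\Rightarrow E^\star\subseteq F^\star$, $E\subseteq E^\star=(E^\star)^\star$. $E^{\star_f}:=\bigcup\{F^\star:F\in f(D),F\subseteq E\}$. A nonzero ideal $I$ is a quasi-$\star$-ideal if $I^\star\cap D=I$; quasi-$\star$-primes/quasi-$\star$-maximal ideals are the prime ones / maximal proper ones; sets $\operatorname{QSpec}^\star(D)$, $\operatorname{QMax}^\star(D)$. $E^{\widetilde\star}:=\bigcap\{ED_M:M\in\operatorname{QMax}^{\star_f}(D)\}$ ($=K$ if empty); $\widetilde\star$-$\dim(D)=\sup\{\operatorname{ht}P: P\in\operatorname{QSpec}^{\widetilde\star}(D)\}$ (0 if empty). An overring $T$ of $D$ ($D\subseteq T\subseteq K$)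 with a semistar operation $\star'$ on $T$ is $(\star,\star')$-linked to $D$ if for every nonzero finitely generated ideal $F$ of $D$, $F^\star=D^\star$ implies $(FT)^{\star'}=T^{\star'}$; $d_T$ is the identity operation on $T$. $D$ is $\star$-quasi-Prüfer if whenever $Q$ is a prime of $D[X]$ with $Q\subseteq P[X]$ for some $P\in\operatorname{QSpec}^\star(D)$, then $Q=(Q\cap D)[X]$; a quasi-Prüfer domain is the case $\star=d_D$ (equivalently, its integral closure is Prüfer). A domain $R$ is a strong S-domain if for every pair of primes $P_1\subsetneq P_2$ with nothing strictly between, $P_1[X]\subsetneq P_2[X]$ have nothing strictly between in $R[X]$; $R$ is stably strong S if $R[X_1,\dots,X_n]$ is a strong S-domain for all $n\ge0$. $R$ is a Jaffard domain if $\dim R=\dim_v R<\infty$, where $\dim_v R$ is the supremum of dimensions of valuation overrings of $R$. *)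

(* Defs.v *)
From HB Require Import structures.
From mathcomp Require Import all_boot all_order all_algebra.
Set Implicit Arguments. Unset Strict Implicit. Unset Printing Implicit Defensive.
Import GRing.Theory.
Local Open Scope ring_scope.

Definition set (T : Type) := T -> Prop.
Definition subset (T : Type) (A B : set T) := forall x, A x -> B x.
Definition set_eq (T : Type) (A B : set T) := subset A B /\ subset B A.
Definition ssubset (T : Type) (A B : set T) := subset A B /\ exists x, B x /\ ~ A x.

Section Rings.
Variable B : comNzRingType.

Definition subring (S : set B) :=
  S 0 /\ S 1 /\ (forall x y, S x -> S y -> S (x - y)) /\
  (forall x y, S x -> S y -> S (x * y)).

Definition ideal_in (S I : set B) :=
  subset I S /\ I 0 /\ (forall x y, I x -> I y -> I (x - y)) /\
  (forall a x, S a -> I x -> I (a * x)).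

Definition prime_in (S P : set B) :=
  ideal_in S P /\ ~ P 1 /\
  (forall a b, S a -> S b -> P (a * b) -> P a \/ P b).

Definition chain_in (S : set B) (c : nat -> set B) (n : nat) :=
  (forall i, (i <= n)%N -> prime_in S (c i)) /\
  (forall i, (i < n)%N -> ssubset (c i) (c i.+1)).

Definition krull_dim_eq (S : set B) (n : nat) :=
  (exists c, chain_in S c n) /\ ~ (exists c, chain_in S c n.+1).

Definition coefs_in (A : set B) : set {poly B} := fun p => forall i, A p`_i.

End Rings.

Definition strong_S (B : comNzRingType) (S : set B) :=
  forall P1 P2, prime_in S P1 -> prime_in S P2 -> ssubset P1 P2 ->
    (~ exists P, prime_in S P /\ ssubset P1 P /\ ssubset P P2) ->
    ~ exists Q, prime_in (coefs_in S) Q /\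
        ssubset (coefs_in P1) Q /\ ssubset Q (coefs_in P2).

Fixpoint mpoly (B : comNzRingType) (n : nat) : comNzRingType :=
  match n with 0 => B | n'.+1 => {poly (mpoly B n')} end.

Fixpoint mcoefs (B : comNzRingType) (n : nat) (S : set B) : set (mpoly B n) :=
  match n as m return set (mpoly B m) with
  | 0 => S
  | n'.+1 => @coefs_in (mpoly B n') (@mcoefs B n' S)
  end.

Definition stably_strong_S (B : comNzRingType) (S : set B) :=
  forall n, strong_S (@mcoefs B n S).

Section Field.
Variable K : fieldType.

Definition domain_with_qf (D : set K) :=
  subring D /\ forall x : K, exists a b, D a /\ D b /\ b != 0 /\ x = a / b.

Definition overring (D T : set K) := subring T /\ subset D T.

Definition Fbar (D E : set K) :=
  E 0 /\ (forall x y, E x -> E y -> E (x + y)) /\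
  (forall a x, D a -> E x -> E (a * x)) /\ (exists x, E x /\ x != 0).

Definition scale (x : K) (E : set K) : set K := fun y => exists e, E e /\ y = x * e.

Definition semistar (D : set K) (st : set K -> set K) :=
  (forall E, Fbar D E -> Fbar D (st E)) /\
  (forall x E, x != 0 -> Fbar D E -> set_eq (st (scale x E)) (scale x (st E))) /\
  (forall E F, Fbar D E -> Fbar D F -> subset E F -> subset (st E) (st F)) /\
  (forall E, Fbar D E -> subset E (st E) /\ set_eq (st (st E)) (st E)).

Definition gen (D : set K) (s : seq K) : set K :=
  fun y => exists c : seq K, size c = size s /\ (forall a, a \in c -> D a) /\
    y = \sum_(i < size s) c`_i * s`_i.

Definition fgfrac (D F : set K) :=
  exists s : seq K, set_eq F (gen D s) /\ exists x, F x /\ x != 0.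

Definition star_f (D : set K) (st : set K -> set K) (E : set K) : set K :=
  fun y => exists F, fgfrac D F /\ subset F E /\ st F y.

Definition quasi_ideal (D : set K) (st : set K -> set K) (I : set K) :=
  ideal_in D I /\ (exists x, I x /\ x != 0) /\
  set_eq (fun y => st I y /\ D y) I.

Definition qmax (D : set K) (st : set K -> set K) (M : set K) :=
  quasi_ideal D st M /\ ~ M 1 /\
  forall I, quasi_ideal D st I -> ~ I 1 -> subset M I -> subset I M.

Definition qprime (D : set K) (st : set K -> set K) (P : set K) :=
  quasi_ideal D st P /\ prime_in D P.

Definition ext_loc (D M E : set K) : set K :=
  fun y => exists s : seq (K * K * K),
    (forall t, t \in s -> E t.1.1 /\ D t.1.2 /\ D t.2 /\ ~ M t.2) /\
    y = \sum_(t <- s) t.1.1 * (t.1.2 / t.2).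

Definition star_tilde (D : set K) (st : set K -> set K) (E : set K) : set K :=
  fun y => forall M, qmax D (star_f D st) M -> ext_loc D M E y.

Definition tilde_dim_finite (D : set K) (st : set K -> set K) :=
  exists n : nat, forall P, qprime D (star_tilde D st) P ->
    ~ exists c, chain_in D c n.+1 /\ set_eq (c n.+1) P.

Definition ext (T F : set K) : set K :=
  fun y => exists s : seq (K * K),
    (forall t, t \in s -> F t.1 /\ T t.2) /\ y = \sum_(t <- s) t.1 * t.2.

Definition linked (D : set K) (st : set K -> set K) (T : set K) :=
  forall s : seq K, subset (gen D s) D -> (exists x, gen D s x /\ x != 0) ->
    set_eq (st (gen D s)) (st D) -> set_eq (ext T (gen D s)) T.

Definition star_quasi_prufer (D : set K) (st : set K -> set K) :=
  forall Q P, prime_in (coefs_in D) Q -> qprime D st P ->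
    subset Q (coefs_in P) -> set_eq Q (coefs_in (fun a => Q a%:P)).

Definition quasi_prufer (D : set K) := star_quasi_prufer D id.

Definition valuation_overring (T V : set K) :=
  overring T V /\ forall x, x != 0 -> V x \/ V x^-1.

Definition jaffard (T : set K) :=
  exists n : nat, krull_dim_eq T n /\
    (forall V, valuation_overring T V -> ~ exists c, chain_in V c n.+1) /\
    (exists V, valuation_overring T V /\ exists c, chain_in V c n).
End Field.

(* Main.v *)
(** Condition (5) says that, for every quasi-prime [P] of the tilde operation, each [u] in [K]
    is a root of some polynomial over [D] with a coefficient outside [P].  If this fails for [u]
    at [P], there is a valuation ring [V] of [K] containing [D] and [u] in which the residue of
    [u] is transcendental over the residue field of [P].  The pullback [R] of the local ring
    [D_P] along [V] is linked.  Valuation rings inside [V] with [u] in their maximal ideal have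
    longer chains of primes than [R], so [R] is not Jaffard; and for [P] minimal among such
    primes and [V] suitably localized, the kernel of evaluation at [u] modulo the prime of
    [V] just below the maximal one shows that [R] is not a strong S-domain.

    Conversely, (5) passes to linked overrings [T] and bounds their chains of primes, also in
    valuation overrings, by contraction to [D].  For the strong S property, primes
    [P1 < Q < P2[Y]] of [S[Y]] with [S = T[X_1, ..., X_n]] and [Q] over [P1] turn, after
    dividing by [P1], into a ring [A] of finite type over an image of [T] and a prime [P] of [A]
    such that an element [y] algebraic over [A] satisfies no equation outside [P].  Some
    valuation ring centered on [P] then makes the residue of [y] transcendental.  As the
    residues of [T] stay algebraic, this leaves room for a prime strictly between [0] and [P]:
    it avoids a suitable algebraically closed subfield, and is found by going down from a
    principal prime in an intersection of valuation rings. *)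

From mathcomp Require classical_sets boolp.
From Stdlib Require Import Classical ClassicalEpsilon.
From HB Require Import structures.
From mathcomp Require Import all_boot all_order all_algebra.
From mathcomp Require Import ring.
Require Import Defs.
Set Implicit Arguments. Unset Strict Implicit. Unset Printing Implicit Defensive.
Import GRing.Theory.
Local Open Scope ring_scope.

(** Nothing is Noetherian here, so the prime strictly between [0] and [P] cannot come from a
    dimension formula or the principal ideal theorem; a count of transcendence degrees replaces
    them. The relative algebraic closure of the image of [T], with an element of [P] adjoined if
    that image meets [P] in [0] only, has residues algebraic over the image. Adjoining the
    residually transcendental generators of [A] to this field and to the subring alike keeps this
    property, and ends with a field [E] and a subring over whose residues all generators are
    algebraic. The residue of [y] is not, so [E] is proper and enlarges to a closed [K] of relative
    transcendence degree one. There the generators are caught by one element [r] of positive value: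
    their equations over [K(z)], with coefficients split into linear factors, involve only monomials
    in one element, up to units. With [V1] the trace of the valuation ring on [K], the ring [V1[r]]
    is normal and [r] generates a prime meeting [V1] in [0], which going down moves below the center
    of the valuation. The resulting prime of [A] meets [K] in [0], while [P] contains a nonzero
    element of [E]. *)

Lemma choice_fun (X Y : Type) (P : X -> Y -> Prop) :
  (forall x, exists y, P x y) -> exists f, forall x, P x (f x).
Proof. by move=> /boolp.choice [f Pf]; exists f. Qed.

Lemma zorn_above (T : Type) (F : set (set T)) (A0 : set T) : F A0 ->
  (forall C : set (set T), (exists X, C X) -> subset C F ->
     (forall X Y, C X -> C Y -> subset X Y \/ subset Y X) ->
     F (fun x => exists2 X, C X & X x)) ->
  exists M, [/\ F M, subset A0 M & forall B, F B -> subset M B -> subset B M].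
Proof.
move=> FA0 FU.
have setE (X Y : set T) : subset X Y -> subset Y X -> X = Y.
  by move=> XY YX; apply: boolp.funext => x; apply: boolp.propext; split; [apply: XY|apply: YX].
(* Zorn's lemma for unions also asks for the empty chain; joining [A0] to every set turns that case
   into [F A0]. *)
pose P (X : set T) := F (fun x => A0 x \/ X x).
have [C CP Ctot|M0 [FM0 M0max]] := @classical_sets.Zorn_bigcup T P.
  case: (classic (exists X, C X)) => [[X0 CX0]|C0]; last first.
    rewrite /P; suff -> : (fun x => A0 x \/ classical_sets.bigcup C id x) = A0 by [].
    apply: setE => x; last by left.
    by case=> // -[X CX _]; case: C0; exists X.
  pose C' (Y : set T) := exists2 X, C X & Y = (fun x => A0 x \/ X x).
  have := FU C'; rewrite /P.
  suff -> : (fun x => exists2 X, C' X & X x) =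
            (fun x => A0 x \/ classical_sets.bigcup C id x).
    apply.
    - by exists (fun x => A0 x \/ X0 x), X0.
    - by move=> _ [X CX ->]; apply: CP.
    - move=> _ _ [X CX ->] [Y CY ->].
      by case: (Ctot X Y CX CY) => h; [left|right] => x [?|?]; [left|right; apply: h|left|right; apply: h].
  apply: setE => x.
    by case=> _ [X CX ->] [?|?]; [left|right; exists X].
  case=> [A0x|[X CX Xx]]; first by exists (fun x => A0 x \/ X0 x); [exists X0|left].
  by exists (fun x => A0 x \/ X x); [exists X|right].
exists (fun x => A0 x \/ M0 x); split=> //; first by move=> x; left.
move=> B FB MB x Bx; apply: NNPP => nMx.
apply: (M0max B).
  split; first by move=> y My; apply: MB; right.
  by move=> BM; apply: nMx; right; apply: BM.
rewrite /P; suff -> : (fun x => A0 x \/ B x) = B by [].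
by apply: setE => y; [case=> // ?; apply: MB; left|right].
Qed.

(** * Subrings, ideals and primes as subsets of a ring *)

Section Subsets.
Variable B : comNzRingType.
Implicit Types S I P : set B.

Definition addgrp I := I 0 /\ (forall x y, I x -> I y -> I (x - y)).

Lemma addgrpN I x : addgrp I -> I x -> I (- x).
Proof. by move=> [I0 IB] Ix; rewrite -sub0r; apply: IB. Qed.

Lemma addgrpD I x y : addgrp I -> I x -> I y -> I (x + y).
Proof.
by move=> gI Ix Iy; rewrite -[y]opprK; case: (gI) => _; apply => //; apply: addgrpN.
Qed.

Lemma addgrp_sum I (T : Type) (r : seq T) (c : pred T) (F : T -> B) :
  addgrp I -> (forall i, c i -> I (F i)) -> I (\sum_(i <- r | c i) F i).
Proof.
move=> gI IF; apply: (big_ind I) => //; first by case: gI.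
by move=> x y; apply: addgrpD.
Qed.

Lemma addgrp_sum_seq I (T : eqType) (r : seq T) (F : T -> B) :
  addgrp I -> (forall i, i \in r -> I (F i)) -> I (\sum_(i <- r) F i).
Proof.
move=> gI IF; rewrite big_seq_cond.
by apply: addgrp_sum => // i /andP [ir _]; apply: IF.
Qed.

Lemma subring_addgrp S : subring S -> addgrp S.
Proof. by case=> S0 [_ [SB _]]. Qed.

Lemma ideal_addgrp S I : ideal_in S I -> addgrp I.
Proof. by case=> _ [I0 [IB _]]. Qed.

Lemma subringM S x y : subring S -> S x -> S y -> S (x * y).
Proof. by case=> _ [_ [_]]; apply. Qed.

Lemma subringD S x y : subring S -> S x -> S y -> S (x + y).
Proof. by move=> /subring_addgrp; apply: addgrpD. Qed.

Lemma subringN S x : subring S -> S x -> S (- x).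
Proof. by move=> /subring_addgrp; apply: addgrpN. Qed.

Lemma subringB S x y : subring S -> S x -> S y -> S (x - y).
Proof. by case=> _ [_ [+ _]]; apply. Qed.

Lemma subring1 S : subring S -> S 1.
Proof. by case=> _ []. Qed.

Lemma subring0 S : subring S -> S 0.
Proof. by case. Qed.

Lemma subringX S x n : subring S -> S x -> S (x ^+ n).
Proof.
move=> sS Sx; elim: n => [|n IHn]; first by rewrite expr0; apply: subring1.
by rewrite exprS; apply: subringM.
Qed.

Lemma idealM S I a x : ideal_in S I -> S a -> I x -> I (a * x).
Proof. by case=> _ [_ [_]]; apply. Qed.

Lemma idealMr S I a x : ideal_in S I -> S a -> I x -> I (x * a).
Proof. by rewrite mulrC; apply: idealM. Qed.

Lemma ideal0 S I : ideal_in S I -> I 0.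
Proof. by case=> _ []. Qed.

Lemma idealS S I x : ideal_in S I -> I x -> S x.
Proof. by case=> + _; apply. Qed.

Lemma idealD S I x y : ideal_in S I -> I x -> I y -> I (x + y).
Proof. by move=> /ideal_addgrp; apply: addgrpD. Qed.

Lemma idealN S I x : ideal_in S I -> I x -> I (- x).
Proof. by move=> /ideal_addgrp; apply: addgrpN. Qed.

Lemma idealB S I x y : ideal_in S I -> I x -> I y -> I (x - y).
Proof. by case=> _ [_ [+ _]]; apply. Qed.

Lemma prime_mul S P a b : prime_in S P -> S a -> S b -> P (a * b) -> P a \/ P b.
Proof. by case=> _ [_]; apply. Qed.

Lemma prime_exp S P a n : subring S -> prime_in S P -> S a -> P (a ^+ n) -> P a.
Proof.
move=> sS pP Sa; elim: n => [|n IHn].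
  by rewrite expr0; case: pP => _ [].
by rewrite exprS => /(prime_mul pP Sa (subringX n sS Sa)) [].
Qed.

Lemma prime_contract S T P : subring S -> subset S T -> prime_in T P ->
  prime_in S (fun x => S x /\ P x).
Proof.
move=> sS ST pP; have iP := pP.1; split.
  split; first by move=> x [].
  split; first by split; [apply: subring0|apply: (ideal0 iP)].
  split=> [x y [Sx Px] [Sy Py]|x y Sx [Sy Py]].
    by split; [apply: subringB|apply: (idealB iP)].
  by split; [apply: subringM|apply: (idealM iP) => //; apply: ST].
split; first by case=> _; case: pP => _ [].
move=> a b Sa Sb [_ /(prime_mul pP (ST _ Sa) (ST _ Sb))].
by case=> ?; [left|right].
Qed.

End Subsets.

(** * Polynomials with coefficients in a subset *)

Section Coefficients.
Variable B : comNzRingType.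
Implicit Types (S I P : set B) (p q f g : {poly B}).

Lemma coefs_addgrp I : addgrp I -> addgrp (coefs_in I).
Proof.
case=> I0 IB; split=> [i|p q Ip Iq i]; first by rewrite coef0.
by rewrite coefB; apply: IB.
Qed.

Lemma coefs_mul (S I J : set B) p q : addgrp J ->
  (forall x y, S x -> I y -> J (x * y)) ->
  coefs_in S p -> coefs_in I q -> coefs_in J (p * q).
Proof.
move=> gJ SIJ Sp Iq i; rewrite coefM.
by apply: addgrp_sum => // j _; apply: SIJ.
Qed.

Lemma coefs_C I a : I 0 -> I a -> coefs_in I a%:P.
Proof. by move=> I0 Ia i; rewrite coefC; case: eqP. Qed.

Lemma coefs_subring S : subring S -> subring (coefs_in S).
Proof.
move=> sS; have gS := subring_addgrp sS; split; first by case: (coefs_addgrp gS).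
split; first by apply: coefs_C; [apply: subring0|apply: subring1].
split; first by case: (coefs_addgrp gS).
by move=> x y; apply: coefs_mul => // a b; apply: subringM.
Qed.

Lemma coefs_X S : subring S -> coefs_in S 'X.
Proof.
by move=> sS i; rewrite coefX; case: eqP => _; [apply: subring1|apply: subring0].
Qed.

Lemma coefs_ideal S I : ideal_in S I -> ideal_in (coefs_in S) (coefs_in I).
Proof.
move=> iI; split; first by move=> p Ip i; apply: (idealS iI).
have gI := ideal_addgrp iI.
split; first by case: (coefs_addgrp gI).
split; first by case: (coefs_addgrp gI).
by move=> x y; apply: coefs_mul => // a b; apply: idealM.
Qed.

Lemma coefs_poly I n (E : nat -> B) : I 0 -> (forall i, (i < n)%N -> I (E i)) ->
  coefs_in I (\poly_(i < n) E i).
Proof. by move=> I0 IE i; rewrite coef_poly; case: ifP => // /IE. Qed.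

Lemma coefs_horner S I p x : ideal_in S I -> subring S -> S x -> coefs_in I p -> I p.[x].
Proof.
move=> iI sS Sx Ip; rewrite horner_coef.
apply: addgrp_sum => [|i _]; first exact: ideal_addgrp iI.
by apply: (idealMr iI) => //; apply: subringX.
Qed.

Lemma ideal_self S : subring S -> ideal_in S S.
Proof.
move=> sS; split=> //; split; first exact: subring0.
split; first by move=> x y; apply: subringB.
by move=> a x; apply: subringM.
Qed.

Lemma coefs_horner_ring S p x : subring S -> S x -> coefs_in S p -> S p.[x].
Proof. by move=> sS; apply: coefs_horner => //; apply: ideal_self. Qed.

(* Compares the lowest coefficients of [p] and [q] outside [P]. *)
Lemma coefs_prime S P : subring S -> prime_in S P ->
  prime_in (coefs_in S) (coefs_in P).
Proof.
move=> sS pP; have iP := pP.1; split; first exact: coefs_ideal.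
split; first by move=> /(_ 0%N); rewrite coefC eqxx; case: pP => _ [].
move=> p q Sp Sq Ppq; apply: NNPP => /not_or_and [np nq].
have low f : ~ coefs_in P f -> exists i, ~ P f`_i /\ forall j, (j < i)%N -> P f`_j.
  move=> nf; have [i0 ni0] : exists i, ~ P f`_i by apply: not_all_ex_not.
  have ex : exists i, boolp.asbool (~ P f`_i) by exists i0; apply/boolp.asboolP.
  have [i /boolp.asboolP ni min] := ex_minnP ex.
  exists i; split=> // j ji; apply: NNPP => nj.
  by have := min j (introT (boolp.asboolP _) nj); rewrite leqNgt ji.
have [i [npi pi]] := low _ np; have [j [nqj qj]] := low _ nq.
suff /(prime_mul pP (Sp i) (Sq j)) [] : P (p`_i * q`_j) by [].
have := Ppq (i + j)%N; rewrite coefM.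
have li : (i < (i + j).+1)%N by rewrite ltnS leq_addr.
rewrite (bigD1 (Ordinal li)) //= addKn => Psum.
rewrite -[X in P X](addrK (\sum_(k < (i + j).+1 | k != Ordinal li) p`_k * q`_(i + j - k))).
apply: (idealB iP Psum); apply: addgrp_sum; first exact: ideal_addgrp iP.
move=> k ki; case: (ltngtP k i) => [lt|gt|eq].
- by apply: (idealMr iP) => //; apply: pi.
- apply: (idealM iP) => //; apply: qj.
  rewrite ltn_subLR; last by rewrite -ltnS.
  by rewrite ltn_add2r.
- by case/eqP: ki; apply: val_inj.
Qed.

End Coefficients.

(** * Valuation rings and Chevalley's extension theorem *)

Section Valuations.
Variable L : fieldType.
Implicit Types (A J R S P U V W : set L) (f g p : {poly L}).

Definition val_ring V := subring V /\ forall x, x != 0 -> V x \/ V x^-1.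

(* As [0^-1 = 0] lies in every ring, [0] needs its own disjunct. *)
Definition maxid V : set L := fun x => x = 0 \/ ~ V x^-1.

Definition adj A (t : L) : set L := fun y => exists2 f, coefs_in A f & y = f.[t].

Lemma maxidS V x : val_ring V -> maxid V x -> V x.
Proof.
case=> sV vV [->|nVx]; first exact: subring0.
have [->|x0] := eqVneq x 0; first exact: subring0.
by case: (vV x x0).
Qed.

Lemma not_maxid V x : ~ maxid V x -> V x^-1.
Proof. by move=> nm; apply: NNPP => nV; apply: nm; right. Qed.

Lemma not_maxid0 V x : ~ maxid V x -> x != 0.
Proof. by move=> nm; apply/eqP => x0; apply: nm; left. Qed.

Lemma maxid1 V : subring V -> ~ maxid V 1.
Proof.
move=> sV [/eqP|]; first by rewrite oner_eq0.
by rewrite invr1; case; apply: subring1.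
Qed.

Lemma unit_not_maxid V x : x != 0 -> V x^-1 -> ~ maxid V x.
Proof. by move=> /eqP x0 Vx []. Qed.

Lemma maxidVN V x : maxid V x -> V x^-1 -> x = 0.
Proof. by case. Qed.

Lemma notin_val V x : val_ring V -> ~ V x -> x != 0 /\ maxid V x^-1.
Proof.
move=> vV nV; split; last by right; rewrite invrK.
by apply/eqP => x0; apply: nV; rewrite x0; apply: subring0 vV.1.
Qed.

Lemma maxid_ideal V : val_ring V -> ideal_in V (maxid V).
Proof.
move=> vV; have [sV vVP] := vV.
have mM a x : V a -> maxid V x -> maxid V (a * x).
  move=> Va mx; have [->|a0] := eqVneq a 0; first by left; rewrite mul0r.
  case: mx => [->|nx]; first by left; rewrite mulr0.
  have [->|x0] := eqVneq x 0; first by left; rewrite mulr0.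
  right=> Vax; apply: nx.
  suff -> : x^-1 = a * (a * x)^-1 by apply: subringM.
  by rewrite invfM mulrA mulfV ?mul1r.
have mD x y : maxid V x -> maxid V y -> V (x / y) -> y != 0 -> maxid V (x - y).
  move=> mx my Vxy y0; rewrite (_ : x - y = (x / y - 1) * y); last by field.
  by apply: mM => //; apply: subringB => //; apply: subring1.
split; first by move=> x; apply: maxidS.
split; first by left.
split=> // x y mx my.
have [y0|y0] := eqVneq y 0; first by rewrite y0 subr0.
have [x0|x0] := eqVneq x 0.
  by rewrite x0 sub0r -mulN1r; apply: mM => //; apply: subringN => //; apply: subring1.
have [Vxy|Vyx] : V (x / y) \/ V (y / x).
  by rewrite -[y / x]invf_div; apply: vVP; rewrite mulf_neq0 ?invr_eq0.
  exact: mD.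
rewrite -opprB -mulN1r; apply: mM; last exact: mD.
by apply: subringN => //; apply: subring1.
Qed.

Lemma maxid_prime V : val_ring V -> prime_in V (maxid V).
Proof.
move=> vV; split; first exact: maxid_ideal.
split; first exact: maxid1 vV.1.
move=> a b Va Vb mab; apply: NNPP => /not_or_and [na nb].
suff : ~ maxid V (a * b) by [].
apply: unit_not_maxid; first by rewrite mulf_neq0 ?(not_maxid0 na) ?(not_maxid0 nb).
by rewrite invfM; apply: (subringM vV.1); apply: not_maxid.
Qed.

Lemma adj_subring A t : subring A -> subring (adj A t).
Proof.
move=> /coefs_subring sA; split; first by exists 0; [exact: (subring0 sA)|rewrite horner0].
split; first by exists 1; [exact: (subring1 sA)|rewrite hornerC].
split=> _ _ [f Af ->] [g Ag ->].
  by exists (f - g); [exact: (subringB sA)|rewrite !hornerE].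
by exists (f * g); [exact: (subringM sA)|rewrite !hornerE].
Qed.

Lemma adj_base A t x : subring A -> A x -> adj A t x.
Proof.
by move=> sA Ax; exists x%:P; [apply: coefs_C => //; apply: subring0|rewrite hornerC].
Qed.

Lemma adj_gen A t : subring A -> adj A t t.
Proof. by move=> sA; exists 'X; [apply: coefs_X|rewrite hornerX]. Qed.

Lemma adj_sub A R t : subring R -> subset A R -> R t -> subset (adj A t) R.
Proof.
by move=> sR AR Rt _ [f Af ->]; apply: coefs_horner_ring => // i; apply: AR.
Qed.

Lemma ext_intro R J a b : R a -> J b -> ext R J (b * a).
Proof.
move=> Ra Jb; exists [:: (b, a)]; split; last by rewrite big_seq1.
by move=> t; rewrite inE => /eqP ->.
Qed.

Lemma ext_cat R J x y : ext R J x -> ext R J y -> ext R J (x + y).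
Proof.
case=> s [Hs ->] [t [Ht ->]]; exists (s ++ t); split; last by rewrite big_cat.
by move=> u; rewrite mem_cat => /orP [/Hs|/Ht].
Qed.

Lemma ext_mul R J a x : subring R -> R a -> ext R J x -> ext R J (a * x).
Proof.
move=> sR Ra [s [Hs ->]]; exists [seq (t.1, t.2 * a) | t <- s]; split.
  by move=> _ /mapP [t /Hs [Jt Rt] ->]; split=> //=; apply: subringM.
by rewrite big_map mulr_sumr; apply: eq_bigr => t _ /=; ring.
Qed.

Lemma ext_addgrp R J : subring R -> addgrp (ext R J).
Proof.
move=> sR; split; first by exists [::]; rewrite big_nil.
move=> x y Rx Ry; apply: ext_cat => //; rewrite -mulN1r; apply: ext_mul => //.
by apply: subringN => //; apply: subring1.
Qed.

Lemma ext_ideal R J : subring R -> subset J R -> ideal_in R (ext R J).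
Proof.
move=> sR JR; have gE := @ext_addgrp R J sR; split.
  move=> _ [s [Hs ->]]; apply: addgrp_sum_seq => [|t /Hs [Jt Rt]].
    exact: subring_addgrp.
  by apply: subringM => //; apply: JR.
split; first by case: gE.
by split; [case: gE|move=> a x; apply: ext_mul].
Qed.

Lemma ext_self R J : ideal_in R J -> subset (ext R J) J.
Proof.
move=> iJ _ [s [Hs ->]]; apply: addgrp_sum_seq => [|t /Hs [Jt Rt]].
  exact: ideal_addgrp iJ.
exact: idealMr iJ Rt Jt.
Qed.

Lemma ext_adj R J t y : subring R -> subset J R -> ext (adj R t) J y ->
  exists2 f, coefs_in (ext R J) f & y = f.[t].
Proof.
move=> sR JR [s [Hs ->]]; have gE := coefs_addgrp (@ext_addgrp R J sR).
elim: s Hs => [_|[b a] s IHs Hs].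
  by exists 0; [case: gE|rewrite big_nil horner0].
have [|f Ef ef] := IHs; first by move=> u us; apply: Hs; rewrite inE us orbT.
have [/= Jb [g Rg eg]] := Hs (b, a) (mem_head _ _).
exists (b%:P * g + f); last by rewrite big_cons /= eg ef !hornerE.
apply: (addgrpD gE) => // i; rewrite coefCM; exact: ext_intro.
Qed.

Lemma exprVM (t : L) j m : t != 0 -> (j <= m)%N -> t^-1 ^+ j * t ^+ m = t ^+ (m - j).
Proof.
by move=> t0 jm; rewrite -{1}(subnKC jm) exprD exprVn mulrA mulVf ?mul1r ?expf_neq0.
Qed.

(** The core of Chevalley's theorem: if [I] became the unit ideal both in [R[t]] and in [R[1/t]],
    two such expressions of least total degree could be shortened further. The induction is on a
    bound for the sum of the sizes. *)
Lemma val_ring_no_units I R t : subring R -> ideal_in R I -> ~ I 1 -> t != 0 ->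
  (exists2 f, coefs_in I f & f.[t] = 1) ->
  (exists2 f, coefs_in I f & f.[t^-1] = 1) -> False.
Proof.
move=> sR iI nI1 t0 [f If ft] [g Ig gt].
have gI := ideal_addgrp iI.
have [N] : exists N, (size f + size g <= N)%N by exists (size f + size g)%N.
elim: N t t0 f g If Ig ft gt => [|N IHN] t t0 f g If Ig ft gt.
  rewrite leqn0 addn_eq0 size_poly_eq0 => /andP [/eqP f0 _].
  by move: ft; rewrite f0 horner0 => /esym/eqP; rewrite oner_eq0.
wlog le : t t0 f g If Ig ft gt / (size g <= size f)%N => [hwlog|sz].
  case: (leqP (size g) (size f)) => [|/ltnW] le; first exact: (hwlog t t0 f g).
  by rewrite addnC; apply: (hwlog t^-1 _ g f) => //; rewrite ?invr_eq0 ?invrK.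
have [n ef] : exists n, size f = n.+1.
  case e : (size f) => [|n]; last by exists n.
  move/eqP: e; rewrite size_poly_eq0 => /eqP f0.
  by move: ft; rewrite f0 horner0 => /esym/eqP; rewrite oner_eq0.
rewrite ef in le.
(* [t^n = g(1/t) t^n] lets [(1 - g_0) t^n] be replaced by a polynomial of degree [< n]. *)
pose h := \poly_(i < n) g`_(n - i).
pose f' := \poly_(i < n) f`_i.
have eh : (1 - g`_0) * t ^+ n = h.[t].
  have gt0 : t ^+ n = \sum_(j < n.+1) g`_j * t ^+ (n - j).
    rewrite -[LHS]mul1r -gt (horner_coef_wide _ le) mulr_suml.
    by apply: eq_bigr => j _; rewrite -mulrA exprVM // -ltnS.
  rewrite mulrBl mul1r {1}gt0 big_ord_recl /= subn0 addrAC subrr add0r.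
  rewrite horner_poly (reindex_inj rev_ord_inj) /=; apply: eq_bigr => j _.
  have jn : (j < n)%N by [].
  by rewrite /bump /= add1n subnSK // !subKn ?(ltnW jn) // -subSn // subSS.
have ff : f.[t] = f'.[t] + f`_n * t ^+ n.
  by rewrite horner_poly horner_coef ef big_ord_recr.
(* The equation [f(t) = 1] is multiplied by [1 - g_0] instead of being divided, so the argument
   works over any subring. *)
pose F := (g`_0)%:P + (1 - g`_0) *: f' + f`_n *: h.
apply: (IHN t t0 F g) => //.
- have IRM a b : R a -> I b -> I (a * b) by apply: idealM.
  have [I0 _] := gI.
  move=> i; rewrite !coefD !coefZ coefC !coef_poly.
  have Rg : R (1 - g`_0).
    by apply: subringB => //; [apply: subring1|apply: (idealS iI)].
  apply: (addgrpD gI); last first.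
    by case: ifP => _; apply: IRM => //; apply: (idealS iI).
  by apply: (addgrpD gI); case: ifP => _ //; apply: IRM.
- rewrite !hornerE -eh.
  have -> : f'.[t] = 1 - f`_n * t ^+ n by rewrite -ft ff addrK.
  ring.
- apply: leq_trans (_ : n + size g <= N)%N; last first.
    by move: sz; rewrite ef addSn ltnS.
  rewrite leq_add2r.
  have n0 : (0 < n)%N.
    rewrite lt0n; apply/eqP => n0; apply: nI1.
    by rewrite -ft horner_coef ef n0 big_ord1 expr0 mulr1.
  apply: leq_trans (size_polyD _ _) _; rewrite geq_max; apply/andP; split.
    apply: leq_trans (size_polyD _ _) _; rewrite geq_max; apply/andP; split.
      exact: leq_trans (size_polyC_leq1 _) n0.
    by apply: leq_trans (size_scale_leq _ _) (size_poly _ _).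
  by apply: leq_trans (size_scale_leq _ _) (size_poly _ _).
Qed.

(** A subring maximal among those in which [J] stays proper is a valuation ring: by maximality an
    element [u] outside it gives [f(u) = 1] with coefficients in the extended ideal, and
    [val_ring_no_units] excludes this for [t] and [t^-1] together. *)
Theorem chevalley0 A J : subring A -> ideal_in A J -> ~ J 1 ->
  exists V, [/\ val_ring V, subset A V & subset J (maxid V)].
Proof.
move=> sA iJ nJ1.
pose F R := [/\ subring R, subset A R & ~ ext R J 1].
have [||V [[sV AV nV1] _ Vmax]] := @zorn_above L F A.
- by split=> //; move=> /(ext_self iJ).
- move=> C [X CX] CF Ctot.
  have two x y : (exists2 X, C X & X x) -> (exists2 X, C X & X y) ->
      exists X, [/\ C X, X x & X y].
    case=> Y CY Yx [Z CZ Zy]; case: (Ctot _ _ CY CZ) => h.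
      by exists Z; split=> //; apply: h.
    by exists Y; split=> //; apply: h.
  have [sX AX _] := CF _ CX.
  split; last 1 first.
  + case=> s [Hs e1].
    have [Y CY HY] : exists2 Y, C Y & forall t, t \in s -> J t.1 /\ Y t.2.
      elim: s Hs {e1} => [_|t s IHs Hs]; first by exists X.
      have [|Y CY HY] := IHs; first by move=> u us; apply: Hs; rewrite inE us orbT.
      have [Jt [Z CZ Zt]] := Hs t (mem_head _ _).
      case: (Ctot _ _ CY CZ) => h; [exists Z => //|exists Y => //] => u;
        rewrite inE => /predU1P [->|/HY [Ju Yu]]; split=> //; exact: h.
    by have [_ _] := CF _ CY; apply; exists s.
  + split; first by exists X => //; apply: subring0.
    split; first by exists X => //; apply: subring1.
    split=> x y Ux Uy; have [Y [CY Yx Yy]] := two x y Ux Uy;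
      exists Y => //; have [sY _ _] := CF _ CY; by [apply: subringB|apply: subringM].
  + by move=> x Ax; exists X => //; apply: AX.
have JV : subset J V by move=> x /(idealS iJ) /AV.
have vV : val_ring V.
  split=> // t t0; apply: NNPP => /not_or_and [nt nt'].
  have key u : ~ V u -> exists2 f, coefs_in (ext V J) f & f.[u] = 1.
    move=> nu; apply: NNPP => nf; apply: nu.
    apply: (Vmax (adj V u)); last exact: adj_gen.
      split; first exact: adj_subring.
        by move=> x /AV Vx; apply: adj_base.
      by case/(ext_adj sV JV) => f Ef e; apply: nf; exists f.
    by move=> x Vx; apply: adj_base.
  by apply: (@val_ring_no_units (ext V J) V t) => //; [apply: ext_ideal|apply: key|apply: key].
exists V; split=> // x Jx; have [x0|x0] := eqVneq x 0; first by left.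
by right=> Vx; apply: nV1; rewrite -(mulfV x0); apply: ext_intro.
Qed.
End Valuations.

(** * Localization and valuation rings with prescribed centers *)

Section Extension.
Variable L : fieldType.
Implicit Types (A B C J R S P U V W : set L) (f g p : {poly L}).

Definition mult_set A S :=
  [/\ S 1, ~ S 0, subset S A & forall x y, S x -> S y -> S (x * y)].

Definition loc A S : set L := fun y => exists a s, [/\ A a, S s & y = a / s].

Definition compl A P : set L := fun x => A x /\ ~ P x.

Lemma mult_neq0 A S s : mult_set A S -> S s -> s != 0.
Proof. by case=> _ S0 _ _ Ss; apply/eqP => s0; apply: S0; rewrite -s0. Qed.

Lemma compl_mult A P : subring A -> prime_in A P -> mult_set A (compl A P).
Proof.
move=> sA pP; have [iP [nP1 _]] := pP; split.
- by split=> //; apply: subring1.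
- by case=> _; apply; apply: (ideal0 iP).
- by move=> x [].
move=> x y [Ax nx] [Ay ny]; split; first exact: subringM.
by case/(prime_mul pP Ax Ay).
Qed.

Lemma loc_addgrp A S J : subring A -> mult_set A S -> ideal_in A J -> addgrp (loc J S).
Proof.
move=> sA mS iJ; split.
  by exists 0, 1; split; [apply: (ideal0 iJ)|case: mS|rewrite mul0r].
move=> _ _ [a [s [Ja Ss ->]]] [b [t [Jb St ->]]].
have s0 := mult_neq0 mS Ss; have t0 := mult_neq0 mS St.
have [_ _ SA SM] := mS.
exists (t * a - s * b), (s * t); split; last by field; rewrite s0 t0.
  by apply: (idealB iJ); apply: (idealM iJ) => //; apply: SA.
exact: SM.
Qed.

Lemma loc_mul A S J x y : subring A -> mult_set A S -> ideal_in A J ->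
  loc A S x -> loc J S y -> loc J S (x * y).
Proof.
move=> sA mS iJ [a [s [Ja Ss ->]]] [b [t [Jb St ->]]].
have [_ _ SA SM] := mS.
exists (a * b), (s * t); split; last by rewrite invfM mulrACA.
  exact: (idealM iJ).
exact: SM.
Qed.

Lemma loc_base A S J x : mult_set A S -> J x -> loc J S x.
Proof. by case=> S1 _ _ _ Jx; exists x, 1; rewrite divr1. Qed.

Lemma loc_subring A S : subring A -> mult_set A S -> subring (loc A S).
Proof.
move=> sA mS; have iA := ideal_self sA; have [l0 lB] := loc_addgrp sA mS iA.
split=> //; split; first by apply: loc_base mS _; apply: subring1.
by split=> // x y; apply: loc_mul.
Qed.

Lemma loc_ideal A S J : subring A -> mult_set A S -> ideal_in A J ->
  ideal_in (loc A S) (loc J S).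
Proof.
move=> sA mS iJ; have [l0 lB] := loc_addgrp sA mS iJ.
split; first by move=> _ [a [s [Ja Ss ->]]]; exists a, s; split=> //; apply: (idealS iJ).
by split=> //; split=> // a x; apply: loc_mul.
Qed.

Lemma loc_inv A S s : mult_set A S -> subring A -> S s -> loc A S s^-1.
Proof. by move=> mS sA Ss; exists 1, s; rewrite mul1r; split=> //; apply: subring1. Qed.

(** Inverting [S] before extending turns its elements into units. With [S] the complement of a prime
    [J], the valuation ring is centered exactly on [J]. *)
Theorem chevalley A J S : subring A -> ideal_in A J -> mult_set A S ->
  (forall s, S s -> ~ J s) ->
  exists V, [/\ val_ring V, subset A V, subset J (maxid V) & forall s, S s -> ~ maxid V s].
Proof.
move=> sA iJ mS SJ.
have [|V [vV AV JV]] := chevalley0 (loc_subring sA mS) (loc_ideal sA mS iJ).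
  case=> a [s [Ja Ss e]]; apply: (SJ s) => //; suff -> : s = a by [].
  by rewrite -[s]mul1r e divfK // (mult_neq0 mS).
exists V; split=> //.
- by move=> x Ax; apply: AV; apply: loc_base mS _.
- by move=> x Jx; apply: JV; apply: loc_base mS _.
move=> s Ss; apply: unit_not_maxid; first exact: mult_neq0 mS Ss.
by apply: AV; apply: loc_inv.
Qed.

Lemma mult_set1 A : subring A -> mult_set A (fun x => x = 1).
Proof.
move=> sA; split=> //; first by move/esym/eqP; rewrite oner_eq0.
  by move=> _ ->; apply: subring1.
by move=> _ _ -> ->; rewrite mul1r.
Qed.

Lemma adj_ideal A J t : subring A -> ideal_in A J ->
  ideal_in (adj A t) (fun y => exists2 f, coefs_in A f /\ J f`_0 & y = f.[t]).
Proof.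
move=> sA iJ; have sAX := coefs_subring sA.
split; first by move=> _ [f [Af _] ->]; exists f.
split; first by exists 0; rewrite ?horner0 // coef0; split; [apply: (subring0 sAX)|apply: (ideal0 iJ)].
split.
  move=> _ _ [f [Af Jf] ->] [g [Ag Jg] ->]; exists (f - g); last by rewrite !hornerE.
  by split; [apply: (subringB sAX)|rewrite coefB; apply: (idealB iJ)].
move=> _ _ [f Af ->] [g [Ag Jg] ->]; exists (f * g); last by rewrite !hornerE.
by split; [apply: (subringM sAX)|rewrite coef0M; apply: (idealM iJ)].
Qed.

(** The ideal of [A[t]] generated by [t] and [J] is the one in [adj_ideal]. Applied to an inverse
    [v^-1], this produces valuation rings that omit [v], which is how the valuative criteria below
    are proved. *)
Lemma chevalley_adj A J S t : subring A -> ideal_in A J -> mult_set A S ->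
  (forall f, coefs_in A f -> J f`_0 -> ~ S f.[t]) ->
  exists V, [/\ val_ring V, subset A V, maxid V t, subset J (maxid V) &
                forall s, S s -> ~ maxid V s].
Proof.
move=> sA iJ mS SJ.
have mS' : mult_set (adj A t) S.
  by case: mS => S1 S0 SA SM; split=> // s /SA As; apply: adj_base.
have [|V [vV AV JV SV]] := chevalley (adj_subring t sA) (adj_ideal t sA iJ) mS'.
  by move=> s Ss [f [Af Jf] e]; apply: (SJ f) => //; rewrite -e.
exists V; split=> //.
- by move=> x Ax; apply: AV; apply: adj_base.
- apply: JV; exists 'X; last by rewrite hornerX.
  by split; [apply: coefs_X|rewrite coefX; apply: (ideal0 iJ)].
move=> x Jx; apply: JV; exists x%:P; last by rewrite hornerC.
split; last by rewrite coefC.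
by apply: coefs_C; [apply: subring0|apply: (idealS iJ)].
Qed.

(* The hypothesis on [t] says that its image modulo [P] may be chosen transcendental. *)
Lemma chevalley_gauss A P t : subring A -> prime_in A P ->
  (forall f, coefs_in A f -> f.[t] = 0 -> coefs_in P f) ->
  exists V, [/\ val_ring V, subset A V, V t &
    forall f, coefs_in A f -> maxid V f.[t] <-> coefs_in P f].
Proof.
move=> sA pP tP; have sAX := coefs_subring sA; have pPX := coefs_prime sA pP.
have iPX := pPX.1.
(* By [tP], whether [f] lies in [P[X]] depends only on the value [f(t)]; hence [J] and [S] below are
   disjoint. *)
have E f g : coefs_in A f -> coefs_in P g -> f.[t] = g.[t] -> coefs_in P f.
  move=> Af Pg e; rewrite -(subrK g f); apply: (idealD iPX) => //.
  apply: tP; last by rewrite hornerD hornerN e subrr.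
  by apply: (subringB sAX) => //; apply: (idealS iPX).
pose J : set L := fun y => exists2 f, coefs_in P f & y = f.[t].
pose S : set L := fun y => exists2 f, coefs_in A f /\ ~ coefs_in P f & y = f.[t].
have iJ : ideal_in (adj A t) J.
  split; first by move=> _ [f Pf ->]; exists f => //; apply: (idealS iPX).
  split; first by exists 0; [apply: (ideal0 iPX)|rewrite horner0].
  split=> [_ _ [f Pf ->] [g Pg ->]|_ _ [f Af ->] [g Pg ->]].
    by exists (f - g); [apply: (idealB iPX)|rewrite !hornerE].
  by exists (f * g); [apply: (idealM iPX)|rewrite !hornerE].
have mS : mult_set (adj A t) S.
  split.
  - exists 1; last by rewrite hornerC.
    by split; [apply: (subring1 sAX)|case: pPX => _ []].
  - case=> f [Af nf] /esym f0; apply: nf; exact: tP.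
  - by move=> _ [f [Af _] ->]; exists f.
  - move=> _ _ [f [Af nf] ->] [g [Ag ng] ->]; exists (f * g); last by rewrite !hornerE.
    by split; [apply: (subringM sAX)|case/(prime_mul pPX Af Ag)].
have [|V [vV AV JV SV]] := chevalley (adj_subring t sA) iJ mS.
  by move=> _ [f [Af nf] ->] [g Pg e]; apply: nf; apply: (E f g).
exists V; split=> //.
- by move=> x Ax; apply: AV; apply: adj_base.
- by apply: AV; apply: adj_gen.
move=> f Af; split=> [mf|Pf]; last by apply: JV; exists f.
by apply: NNPP => nf; apply: (SV f.[t]) => //; exists f.
Qed.

Lemma maxid_anti V W : val_ring V -> val_ring W -> subset (maxid V) (maxid W) -> subset W V.
Proof.
move=> vV vW VW x Wx; apply: NNPP => nVx.
have [x0 /VW m] := notin_val vV nVx.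
by move: (maxidVN m); rewrite invrK => /(_ Wx) /eqP; rewrite invr_eq0 (negPf x0).
Qed.

Definition plus A B : set L := fun y => exists a b, [/\ A a, B b & y = a + b].

Lemma plusl A B x : B 0 -> A x -> plus A B x.
Proof. by move=> B0 Ax; exists x, 0; rewrite addr0. Qed.

Lemma plusr A B x : A 0 -> B x -> plus A B x.
Proof. by move=> B0 Ax; exists 0, x; rewrite add0r. Qed.

Lemma plus_subring A V J : subring A -> subset A V -> ideal_in V J -> subring (plus A J).
Proof.
move=> sA AV iJ; have J0 := ideal0 iJ; split; first by apply: plusl => //; apply: subring0.
split; first by apply: plusl => //; apply: subring1.
split=> _ _ [a [m [Aa Jm ->]]] [b [n [Ab Jn ->]]].
  exists (a - b), (m - n); split; [exact: subringB|exact: (idealB iJ)|ring].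
exists (a * b), (a * n + b * m + m * n); split; [exact: subringM| |ring].
apply: (idealD iJ); last by apply: (idealM iJ) => //; apply: (idealS iJ).
by apply: (idealD iJ); apply: (idealM iJ) => //; apply: AV.
Qed.

Lemma plus_ideal A V P J : subring A -> subset A V -> ideal_in V J -> ideal_in A P ->
  ideal_in (plus A J) (plus P J).
Proof.
move=> sA AV iJ iP; have J0 := ideal0 iJ; split.
  by move=> _ [a [m [Aa Jm ->]]]; exists a, m; split=> //; apply: (idealS iP).
split; first by apply: plusl => //; apply: (ideal0 iP).
split=> _ _ [a [m [Aa Jm ->]]] [b [n [Ab Jn ->]]].
  exists (a - b), (m - n); split; [exact: (idealB iP)|exact: (idealB iJ)|ring].
exists (a * b), (a * n + b * m + m * n); split; [exact: (idealM iP)| |ring].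
apply: (idealD iJ); last by apply: (idealM iJ) => //; apply: (idealS iJ).
by apply: (idealD iJ); apply: (idealM iJ) => //; apply: AV => //; apply: (idealS iP).
Qed.

Lemma plus_mult A S V J : mult_set A S -> ideal_in V J -> mult_set (plus A J) S.
Proof.
move=> [S1 S0 SA SM] iJ; split=> // x /SA Ax; apply: plusl => //; exact: (ideal0 iJ).
Qed.

(** By [MP], the ideal [P + maxid V] of [A + maxid V] still has trace [P] on [A]. A valuation ring
    above it has a larger maximal ideal than [V], hence lies inside [V]; this lifts one step of a
    chain of primes. *)
Lemma chevalley_chain A V P : subring A -> val_ring V -> subset A V -> prime_in A P ->
  (forall a, A a -> maxid V a -> P a) ->
  exists W, [/\ val_ring W, subset A W, subset (maxid V) (maxid W) &
    forall a, A a -> maxid W a <-> P a].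
Proof.
move=> sA vV AV pP MP; have iM := maxid_ideal vV; have iP := pP.1.
have mS := compl_mult sA pP.
have sAJ := plus_subring sA AV iM; have iAJ := plus_ideal sA AV iM iP.
have [|W [vW AW JW SW]] := chevalley sAJ iAJ (plus_mult mS iM).
  move=> s [As ns] [p [m [Pp Mm e]]]; apply: ns.
  rewrite e; apply: (idealD iP) => //; apply: MP => //.
  have -> : m = s - p by rewrite e addrC addKr.
  by apply: (subringB sA) => //; apply: (idealS iP).
have M0 := ideal0 iM.
exists W; split=> //.
- by move=> a Aa; apply: AW; apply: plusl.
- by move=> m Mm; apply: JW; apply: plusr => //; apply: (ideal0 iP).
move=> a Aa; split=> [ma|Pa]; last by apply: JW; apply: plusl.
by apply: NNPP => nPa; apply: (SW a).
Qed.

End Extension.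

(** * Residually algebraic elements *)

Section Residual.
Variable L : fieldType.
Implicit Types (A B C E J R S P U V W : set L) (f g p : {poly L}).

Lemma split_low P f : P 0 -> ~ coefs_in P f -> exists n g h,
  [/\ f = h + g * 'X^n, coefs_in P h, ~ P g`_0 &
      forall i, g`_i = f`_(i + n)].
Proof.
move=> P0 nf; have [i0 ni0] : exists i, ~ P f`_i by apply: not_all_ex_not.
have ex : exists i, boolp.asbool (~ P f`_i) by exists i0; apply/boolp.asboolP.
have [n /boolp.asboolP nn min] := ex_minnP ex.
exists n, (drop_poly n f), (take_poly n f); split.
- by rewrite poly_take_drop.
- move=> i; rewrite coef_take_poly; case: ltnP => [lt|_] //.
  apply: NNPP => nj.
  by have := min i (introT (boolp.asboolP _) nj); rewrite leqNgt lt.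
- by rewrite coef_drop_poly.
by move=> i; rewrite coef_drop_poly.
Qed.

Lemma split_top P f : P 0 -> ~ coefs_in P f -> exists g h,
  [/\ f = g + h, coefs_in P h, ~ P (lead_coef g) & forall i, g`_i = f`_i \/ g`_i = 0].
Proof.
move=> P0 nf; have [i0 ni0] : exists i, ~ P f`_i by apply: not_all_ex_not.
have ex : exists i, boolp.asbool (~ P f`_i) by exists i0; apply/boolp.asboolP.
have bnd i : boolp.asbool (~ P f`_i) -> (i <= size f)%N.
  move/boolp.asboolP => ni; rewrite leqNgt; apply/negP => lt.
  by apply: ni; rewrite nth_default // ltnW.
have [n /boolp.asboolP nn max] := ex_maxnP ex bnd.
have fn0 : f`_n != 0 by apply/eqP => e; apply: nn; rewrite e.
exists (take_poly n.+1 f), (drop_poly n.+1 f * 'X^(n.+1)); split.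
- by rewrite poly_take_drop.
- move=> i; rewrite coefMXn; case: ltnP => // lt.
  rewrite coef_drop_poly subnK //; apply: NNPP => nj.
  by have := max i (introT (boolp.asboolP _) nj); rewrite leqNgt lt.
- suff -> : lead_coef (take_poly n.+1 f) = f`_n by [].
  rewrite lead_coefE; suff -> : size (take_poly n.+1 f) = n.+1.
    by rewrite coef_take_poly leqnn.
  apply/eqP; rewrite eqn_leq size_take_poly ltnNge; apply/negP => le.
  have : (take_poly n.+1 f)`_n = 0 by apply: nth_default.
  by rewrite coef_take_poly leqnn; apply/eqP.
by move=> i; rewrite coef_take_poly; case: ltnP; [left|right].
Qed.

(** If [x] were outside [U], its inverse would lie in [maxid U], and the equation divided by [x^n]
    would put the leading coefficient there too. *)
Lemma val_root U f x : val_ring U -> coefs_in U f -> ~ maxid U (lead_coef f) ->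
  maxid U f.[x] -> U x.
Proof.
move=> vU Uf nl mf; have iM := maxid_ideal vU; have [sU _] := vU.
apply: NNPP => nUx; have [x0 mx] := notin_val vU nUx.
have f0 : size f != 0%N.
  by rewrite size_poly_eq0 -lead_coef_eq0; apply: not_maxid0 nl.
have Ux := maxidS vU mx.
apply: nl; rewrite lead_coefE; set n := (size f).-1.
have en : size f = n.+1 by rewrite prednK // lt0n.
have -> : f`_n = f.[x] * x^-1 ^+ n - \sum_(i < n) f`_i * x^-1 ^+ (n - i).
  rewrite horner_coef en big_ord_recr /= mulrDl -mulrA -exprMn mulfV // expr1n mulr1.
  rewrite mulr_suml addrAC -sumrB big1 ?add0r // => i _.
  have le : (i <= n)%N by apply: ltnW.
  have xV0 : x^-1 != 0 by rewrite invr_eq0.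
  by have := exprVM xV0 le; rewrite invrK -mulrA => ->; rewrite subrr.
apply: (idealB iM); first by apply: (idealMr iM) => //; apply: subringX.
apply: addgrp_sum => [|i _]; first exact: ideal_addgrp iM.
apply: (idealM iM) => //; have : (0 < n - i)%N by rewrite subn_gt0.
by case: (n - i)%N => // k _; rewrite exprSr; apply: (idealM iM) => //; apply: subringX.
Qed.

Lemma horner_mod S I g x : subring S -> ideal_in S I -> coefs_in S g -> I x ->
  I (g.[x] - g`_0).
Proof.
move=> sS iI Sg Ix; elim/poly_ind: g Sg => [|g c _] Sg.
  by rewrite horner0 coef0 subr0; apply: (ideal0 iI).
rewrite hornerMXaddC coefD coefMX coefC /= add0r addrK.
apply: (idealM iI) => //; apply: coefs_horner_ring => // [|i]; first exact: (idealS iI).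
by have := Sg i.+1; rewrite coefD coefMX coefC /= addr0.
Qed.

(** The power [v ^+ size f] exceeds the degree by one, so no predecessor is taken and [f = 0] needs
    no case of its own; the coefficient at [j = 0] is then [0]. *)
Lemma horner_rev f (v : L) : v != 0 -> f.[v^-1] * v ^+ size f =
  f`_0 * v ^+ size f + (\poly_(j < size f) f`_(size f - j)).[v].
Proof.
move=> v0; set N := size f.
rewrite (horner_coef_wide _ (leqnSn N)) mulr_suml big_ord_recl /= expr0 mulr1.
congr (_ + _); rewrite horner_poly [RHS](reindex_inj rev_ord_inj) /=.
apply: eq_bigr => j _; rewrite /bump /= add1n -mulrA exprVM ?subKn //.
Qed.

Lemma lift_coefs B J f : B 0 -> J 0 -> coefs_in (plus B J) f ->
  exists2 g, coefs_in B g & coefs_in J (f - g).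
Proof.
move=> B0 J0 Af.
have [b bP] : exists b : nat -> L, forall i, B (b i) /\ J (f`_i - b i).
  apply: (choice_fun (P := fun i x => B x /\ J (f`_i - x))) => i; have [x [y [Bx Jy e]]] := Af i.
  by exists x; rewrite e addrC addKr.
exists (\poly_(i < size f) b i); first by apply: coefs_poly => // i _; case: (bP i).
move=> i; rewrite coefB coef_poly; case: ltnP => [_|le]; first by case: (bP i).
by rewrite nth_default // subr0.
Qed.

(** The inclusion of maximal ideals puts [U] inside [W]. Such [U] correspond to the valuation rings
    of the residue field of [W] that contain the field generated by the residues of [B]. *)
Definition same_center W B U := [/\ val_ring U, subset (maxid W) (maxid U), subset B U &
  forall b, B b -> maxid U b -> maxid W b].

(* By [ralgP], for [B] in [W] these are the elements of [W] whose residue is algebraic over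
   the residues of [B]; in this form they visibly form a ring. *)
Definition ralg W B : set L := fun v => forall U, same_center W B U -> U v.

Definition ralg_eq W B v :=
  exists f, [/\ coefs_in B f, ~ coefs_in (maxid W) f & maxid W f.[v]].

Lemma same_center_self W B : val_ring W -> subset B W -> same_center W B W.
Proof. by move=> vW BW; split. Qed.

Lemma ralg_eq_same_center W B U v : val_ring W -> same_center W B U -> W v -> ralg_eq W B v -> U v.
Proof.
move=> vW [vU WU BU UB] Wv [f [Bf nf mf]]; have iM := maxid_ideal vW.
have M0 := ideal0 iM.
have [g [h [ef Mh nl gf]]] := split_top M0 nf.
apply: (@val_root U g) => //.
- by move=> i; case: (gf i) => ->; [apply: BU|apply: subring0 vU.1].
- move=> ml; apply: nl; rewrite lead_coefE in ml *.
  by case: (gf (size g).-1) ml => -> // ml; apply: UB.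
apply: WU; rewrite (_ : g.[v] = f.[v] - h.[v]); last by rewrite ef hornerD addrK.
by apply: (idealB iM) => //; apply: (coefs_horner iM vW.1).
Qed.

(** Cancelling a power of the unit [v] leaves a residual equation with constant term outside
    [maxid W]. If [v] were in [maxid U], this constant term would be there too, against the equality
    of centers. *)
Lemma ralg_eq_unit W B U v : val_ring W -> subset B W -> same_center W B U -> W v ->
  ralg_eq W B v -> ~ maxid W v -> ~ maxid U v.
Proof.
move=> vW BW [vU WU BU UB] Wv [f [Bf nf mf]] nv mv; have iM := maxid_ideal vW.
have M0 := ideal0 iM; have [sW _] := vW.
have [n [g [h [ef Mh ng gf]]]] := split_low M0 nf; apply: ng.
have Bg : coefs_in B g by move=> i; rewrite gf.
have Wg : W g.[v] by apply: coefs_horner_ring => // i; apply: BW.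
have : maxid W (g.[v] * v ^+ n).
  rewrite (_ : _ * _ = f.[v] - h.[v]); last by rewrite ef !hornerE addrC addKr.
  by apply: (idealB iM) => //; apply: (coefs_horner iM sW).
have pM := maxid_prime vW.
case/(prime_mul pM Wg (subringX n sW Wv)) => [mg|/(prime_exp sW pM Wv) //].
apply: UB; first by rewrite gf; apply: Bf.
have iMU := maxid_ideal vU.
rewrite (_ : g`_0 = g.[v] - (g.[v] - g`_0)); last by rewrite opprB addrC subrK.
apply: (idealB iMU); first exact: WU.
by apply: (horner_mod vU.1 iMU) => // i; apply: BU.
Qed.

(** For the converse, [1/v] is placed in the maximal ideal of some [U] with the same center, so that
    [U] omits [v]. This fails only if a polynomial with constant term in [maxid W] takes at [1/v] a
    value in [B] outside [maxid W], and reversing it gives a residual equation. *)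
Lemma ralgP W B v : val_ring W -> subring B -> subset B W -> W v ->
  ralg W B v <-> ralg_eq W B v.
Proof.
move=> vW sB BW Wv; split=> [rv|rv U gU]; last exact: (ralg_eq_same_center vW gU).
apply: NNPP => nv; have iM := maxid_ideal vW; have [sW _] := vW; have M0 := ideal0 iM.
have B0 := subring0 sB.
have nmv : ~ maxid W v.
  move=> mv; apply: nv; exists 'X; rewrite hornerX; split=> //; first exact: coefs_X.
  by move/(_ 1%N); rewrite coefX; apply: maxid1.
have v0 := not_maxid0 nmv.
have mS : mult_set B (compl B (maxid W)).
  split; first by split; [apply: subring1|apply: maxid1].
  - by case=> _; apply.
  - by move=> x [].
  move=> x y [Bx nx] [By ny]; split; first exact: subringM.
  by case/(prime_mul (maxid_prime vW) (BW _ Bx) (BW _ By)).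
have iMB : ideal_in (plus B (maxid W)) (maxid W).
  split; first by move=> x Mx; apply: plusr.
  split=> //; split; first by move=> x y; apply: (idealB iM).
  move=> _ x [b [m [Bb Mm ->]]] Mx; apply: (idealM iM) => //.
  by apply: subringD => //; [apply: BW|apply: (idealS iM)].
have [|U [vU AU mt JU SU]] := @chevalley_adj L _ _ _ v^-1 (plus_subring sB BW iM)
  iMB (plus_mult mS iM).
  move=> F AF MF0 [Bs ns]; apply: nv.
  have [g Bg Mg] := lift_coefs B0 M0 AF.
  set s := F.[v^-1] in Bs ns *; pose N := size F.
  (* The reversal of [F(1/v) = s], coefficients lifted to [B]: the term of [F_0] drops out modulo
     [maxid W], and the top coefficient [s] lies outside [maxid W]. *)
  exists (s *: 'X^N - \poly_(j < N) g`_(N - j)); split.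
  - move=> i; rewrite coefB coefZ coefXn coef_poly.
    apply: subringB => //; last by case: ifP.
    by case: eqP => _; rewrite ?mulr1 ?mulr0.
  - by move/(_ N); rewrite coefB coefZ coefXn coef_poly eqxx ltnn mulr1 subr0.
  rewrite !hornerE /s horner_rev // -addrA -hornerN -hornerD.
  apply: (idealD iM); first by apply: (idealMr iM) => //; apply: subringX.
  apply: (coefs_horner iM) => // i; rewrite coefB !coef_poly; case: ifP => _.
    by rewrite -coefB.
  by rewrite subr0.
have gU : same_center W B U.
  split=> // [b Bb|b Bb mb]; first by apply: AU; apply: plusl.
  by apply: NNPP => nb; apply: (SU b).
have := maxidVN mt; rewrite invrK => /(_ (rv U gU)) /eqP.
by rewrite invr_eq0 (negPf v0).
Qed.

Lemma ralg_sub W B : val_ring W -> subset B W -> subset (ralg W B) W.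
Proof. by move=> vW BW v; apply; apply: same_center_self. Qed.

Lemma ralg_base W B : subset B (ralg W B).
Proof. by move=> b Bb U [_ _ + _]; apply. Qed.

Lemma ralg_subring W B : subring (ralg W B).
Proof.
split; first by move=> U [[sU _] _ _ _]; apply: subring0.
split; first by move=> U [[sU _] _ _ _]; apply: subring1.
split=> x y rx ry U gU; have [[sU _] _ _ _] := gU.
  by apply: (subringB sU); [apply: rx|apply: ry].
by apply: (subringM sU); [apply: rx|apply: ry].
Qed.

(** A ring [U] with the center of [W] on [B] also has the same center on [C]: by [ralg_eq_unit],
    elements of [C] that are units of [W] stay units of [U]. *)
Lemma ralg_trans W B C v : val_ring W -> subring B -> subset B W ->
  subset C (ralg W B) -> ralg W C v -> ralg W B v.
Proof.
move=> vW sB BW CB rv U gU; have [vU WU BU UB] := gU; apply: rv; split=> //.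
  by move=> c /CB; apply.
move=> c Cc mc; apply: NNPP => nc.
have rc := CB c Cc; have Wc := ralg_sub vW BW rc.
by apply: (@ralg_eq_unit W B U c) => //; apply/ralgP.
Qed.

Lemma ralg_mono W B C v : val_ring W -> subring C -> subset C W ->
  subset B C -> ralg W B v -> ralg W C v.
Proof.
by move=> vW sC CW BC; apply: ralg_trans => // b /BC; apply: ralg_base.
Qed.

End Residual.

(** * Integral and algebraic elements, relative algebraic closure *)

Section Algebraic.
Variable L : fieldType.
Implicit Types (A B C E J K R S P U V W : set L) (f g p : {poly L}).

Definition subfield E := subring E /\ forall x, E x -> E x^-1.

Definition frac A := loc A (fun x => A x /\ x != 0).

Definition alg C v := exists f, [/\ f != 0, coefs_in C f & f.[v] = 0].

Definition zeroS : set L := fun x => x = 0.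

Lemma zero_ideal A : subring A -> ideal_in A zeroS.
Proof.
move=> sA; split; first by move=> _ ->; apply: subring0.
split=> //; split; first by move=> _ _ -> ->; rewrite subrr.
by move=> a _ _ ->; rewrite /zeroS mulr0.
Qed.

(** If [v] is not integral over [C], no polynomial without constant term takes the value [1] at
    [1/v]; so [1/v] can be placed in a maximal ideal, and that valuation ring omits [v]. *)
Lemma integral_val C v : subring C -> (forall U, val_ring U -> subset C U -> U v) ->
  exists f, [/\ f \is monic, coefs_in C f & f.[v] = 0].
Proof.
move=> sC Uv; have [->|v0] := eqVneq v 0.
  by exists 'X; rewrite monicX hornerX; split=> //; apply: coefs_X.
apply: NNPP => nf.
have [|U [vU CU mv _ _]] :=
  @chevalley_adj _ _ _ _ v^-1 sC (zero_ideal sC) (mult_set1 sC).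
  move=> F CF F0 F1; apply: nf.
  have C0 := subring0 sC; have C1 := subring1 sC.
  pose q := \poly_(j < size F) F`_(size F - j).
  have lt : (size (- q)%R < size ('X^(size F) : {poly L})%R)%N.
    by rewrite size_polyN size_polyXn ltnS size_poly.
  exists ('X^(size F) - q); split.
  - by rewrite monicE lead_coefDl // lead_coefXn.
  - move=> i; rewrite coefB coefXn coef_poly.
    by apply: (subringB sC); [case: eqP|case: ifP].
  by have := horner_rev F v0; rewrite F1 F0 mul1r mul0r add0r !hornerE => ->; rewrite subrr.
by have := maxidVN mv; rewrite invrK => /(_ (Uv U vU CU)) /eqP; rewrite invr_eq0 (negPf v0).
Qed.

Lemma subfield_unit E U x : subfield E -> subset E U -> E x -> x != 0 -> ~ maxid U x.
Proof. by move=> [_ EV] EU Ex x0; apply: unit_not_maxid => //; apply/EU/EV. Qed.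

(** Over a field, integral and algebraic agree. Algebraicity thus becomes membership in valuation
    rings, which makes closure under sums and products immediate. *)
Lemma algP E v : subfield E ->
  alg E v <-> forall U, val_ring U -> subset E U -> U v.
Proof.
move=> fE; split=> [[f [f0 Ef fv]] U vU EU|Uv].
  apply: (@val_root _ U f) => //; first by move=> i; apply: EU.
    by apply: (subfield_unit fE EU); [rewrite lead_coefE; apply: Ef|rewrite lead_coef_eq0].
  by left.
have [f [mf Ef fv]] := integral_val fE.1 Uv.
by exists f; split=> //; apply: monic_neq0.
Qed.

Lemma alg_base C x : subring C -> C x -> alg C x.
Proof.
move=> sC Cx; exists ('X - x%:P); rewrite polyXsubC_eq0 !hornerE subrr; split=> //.
apply: (subringB (coefs_subring sC)); first exact: coefs_X.
by apply: coefs_C => //; apply: subring0.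
Qed.

Lemma alg_mono C E v : subset C E -> alg C v -> alg E v.
Proof. by move=> CE [f [f0 Cf fv]]; exists f; split=> // i; apply: CE. Qed.

Lemma alg_subfield E : subfield E -> subfield (alg E).
Proof.
move=> fE; have [sE EV] := fE; have op x y : alg E x -> alg E y -> forall U,
    val_ring U -> subset E U -> U x /\ U y /\ subring U.
  by move=> /algP ax /algP ay U vU EU; split; [apply: ax|split; [apply: ay|case: vU]].
split.
  split; first by apply: alg_base => //; apply: subring0.
  split; first by apply: alg_base => //; apply: subring1.
  split=> x y ax ay; apply/algP => // U vU EU; have [Ux [Uy sU]] := op x y ax ay U vU EU.
    exact: subringB.
  exact: subringM.
move=> x ax; have [->|x0] := eqVneq x 0.
  by rewrite invr0; apply: alg_base => //; apply: subring0.
apply/algP => // U vU EU; apply: NNPP => nU.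
have [_] := notin_val vU nU; rewrite invrK => mx.
have [f [f0 Ef fx]] := ax.
have nz : ~ coefs_in zeroS f by move=> z; case/eqP: f0; apply/polyP => i; rewrite coef0; apply: z.
have [n [g [h [ef zh ng gf]]]] := split_low (erefl : zeroS 0) nz.
have h0 : h = 0 by apply/polyP => i; rewrite coef0; apply: zh.
have gx : g.[x] = 0.
  move/eqP: fx; rewrite ef h0 add0r !hornerE mulf_eq0 expf_eq0 (negPf x0) andbF orbF.
  by move/eqP.
have Eg : E g`_0 by rewrite gf.
apply: (subfield_unit fE EU Eg); first by apply/eqP.
have Ug : coefs_in U g by move=> i; rewrite gf; apply/EU/Ef.
have := horner_mod vU.1 (maxid_ideal vU) Ug mx; rewrite gx sub0r => m.
by rewrite -[g`_0]opprK; apply: (idealN (maxid_ideal vU)).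
Qed.

Lemma alg_idem E v : subfield E -> alg (alg E) v -> alg E v.
Proof.
move=> fE /(algP v (alg_subfield fE)) h; apply/algP => // U vU EU.
by apply: h => // x /(algP x fE); apply.
Qed.

Lemma frac_mult A : subring A -> mult_set A (fun x => A x /\ x != 0).
Proof.
move=> sA; split.
- by split; [apply: subring1|apply: oner_neq0].
- by case=> _; rewrite eqxx.
- by move=> x [].
by move=> x y [Ax x0] [Ay y0]; split; [apply: subringM|apply: mulf_neq0].
Qed.

Lemma frac_subfield A : subring A -> subfield (frac A).
Proof.
move=> sA; split; first by apply: loc_subring => //; apply: frac_mult.
move=> _ [a [b [Aa [Ab b0] ->]]]; have [->|a0] := eqVneq a 0.
  by rewrite mul0r invr0; exists 0, 1; rewrite mul0r; split=> //;
     [apply: subring0|split; [apply: subring1|apply: oner_neq0]].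
by exists b, a; rewrite invf_div.
Qed.

Lemma frac_base A x : subring A -> A x -> frac A x.
Proof. by move=> sA Ax; apply: (loc_base (A := A)) => //; apply: frac_mult. Qed.

Lemma frac_sub A E : subfield E -> subset A E -> subset (frac A) E.
Proof.
by move=> [sE EV] AE _ [a [b [Aa [Ab _] ->]]]; apply: subringM; auto.
Qed.

Lemma loc_common_denom A S J f : subring A -> mult_set A S -> ideal_in A J ->
  coefs_in (loc J S) f -> exists2 s, S s & coefs_in J (s *: f).
Proof.
move=> sA mS iJ; have [S1 S0 SA SM] := mS.
elim/poly_ind: f => [|f c IHf] Jf.
  by exists 1 => // i; rewrite scaler0 coef0; apply: (ideal0 iJ).
have [i|s Ss Js] := IHf.
  by have := Jf i.+1; rewrite coefD coefMX coefC /= addr0.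
have := Jf 0%N; rewrite coefD coefMX coefC /= add0r => -[a [t [Ja St ec]]].
exists (s * t); first exact: SM.
move=> i; rewrite coefZ coefD coefMX coefC mulrDr; case: i => [|i] /=.
  rewrite mulr0 add0r ec -mulrA [t * _]mulrC divfK ?(mult_neq0 mS St) //.
  by apply: (idealM iJ) => //; apply: SA.
rewrite mulr0 addr0 mulrAC -coefZ; apply: (idealMr iJ); [exact: SA|exact: Js].
Qed.

Lemma alg_frac C v : subring C -> alg (frac C) v -> alg C v.
Proof.
move=> sC [f [f0 Cf fv]]; have mS := frac_mult sC.
have [s [Cs s0] Csf] := loc_common_denom sC mS (ideal_self sC) Cf.
exists (s *: f); rewrite scaler_eq0 negb_or s0 hornerZ fv mulr0; split=> //.
Qed.

(** Closedness is relative to the ambient field [L], and [acl] is the matching closure of a fraction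
    field. *)
Definition closed_field E := subfield E /\ forall v, alg E v -> E v.

Definition acl C := alg (frac C).

Lemma acl_closed C : subring C -> closed_field (acl C).
Proof.
move=> sC; split; first by apply: alg_subfield; apply: frac_subfield.
by move=> v; apply: alg_idem; apply: frac_subfield.
Qed.

Lemma acl_base C x : subring C -> C x -> acl C x.
Proof.
by move=> sC Cx; apply: alg_base; [case: (frac_subfield sC)|apply: frac_base].
Qed.

Lemma acl_sub C E : closed_field E -> subset C E -> subset (acl C) E.
Proof. by move=> [fE cE] CE v /(alg_mono (frac_sub fE CE)); apply: cE. Qed.

Lemma transc_poly0 K t f : closed_field K -> ~ K t -> coefs_in K f -> f.[t] = 0 -> f = 0.
Proof.
move=> [_ cK] nK Kf ft; apply/eqP; apply: contra_notT nK => f0.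
by apply: cK; exists f.
Qed.

Lemma subfield_inter K W : subfield K -> val_ring W ->
  subring (fun x => K x /\ W x).
Proof.
move=> [sK _] [sW _]; split; first by split; apply: subring0.
split; first by split; apply: subring1.
by split=> x y [? ?] [? ?]; split; by [apply: subringB|apply: subringM].
Qed.

(** The coefficient [f_i] has least value. Division by it makes [f] primitive over [W], the form in
    which equations pass to the residue field. *)
Lemma max_coef W f : val_ring W -> f != 0 -> exists i, f`_i != 0 /\
  coefs_in W ((f`_i)^-1 *: f).
Proof.
move=> [sW vW]; elim/poly_ind: f => [|f c IHf]; first by rewrite eqxx.
move=> nz; have W0 := subring0 sW; have W1 := subring1 sW.
have [f0|f0] := eqVneq f 0.
  move: nz; rewrite f0 mul0r add0r polyC_eq0 => c0; exists 0%N; rewrite coefC eqxx.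
  split=> // i; rewrite coefZ coefC; case: eqP => _; rewrite ?mulr0 ?mulVf //.
have [i [fi Wf]] := IHf f0.
have coef k : (f * 'X + c%:P)`_k = if k == 0%N then c else f`_k.-1.
  by rewrite coefD coefMX coefC; case: k => [|k] /=; rewrite ?add0r ?addr0.
case: (classic (W ((f`_i)^-1 * c))) => [Wc|nWc].
  exists i.+1; rewrite coef /=; split=> // k; rewrite coefZ coef; case: eqP => // _.
  by rewrite -coefZ.
have c0 : c != 0 by apply/eqP => c0; apply: nWc; rewrite c0 mulr0.
have Wc : W (c^-1 * f`_i).
  have : (f`_i)^-1 * c != 0 by rewrite mulf_neq0 ?invr_eq0.
  by case/vW => //; rewrite invfM invrK mulrC.
exists 0%N; rewrite coef /=; split=> // k; rewrite coefZ coef; case: eqP => _.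
  by rewrite mulVf.
rewrite (_ : _ * _ = (c^-1 * f`_i) * ((f`_i)^-1 * f`_k.-1)); last by field; rewrite fi c0.
by apply: subringM => //; rewrite -coefZ.
Qed.

End Algebraic.

(** * Minimal polynomials and Gauss's lemma over valuation rings *)

Section GoingDown.
Variable L : fieldType.
Implicit Types (A B C E J K R S P U V W : set L) (f g p : {poly L}).

Lemma subfield_divp E f g : subfield E -> g != 0 -> coefs_in E f -> coefs_in E g ->
  exists q r, [/\ coefs_in E q, coefs_in E r, f = q * g + r & (size r < size g)%N].
Proof.
move=> [sE EV] g0 + Eg; have sEX := coefs_subring sE.
have [n] := ubnP (size f); elim: n f => // n IHn f; rewrite ltnS => sf Ef.
case: (ltnP (size f) (size g)) => [lt|le].
  by exists 0, f; rewrite mul0r add0r; split=> //; apply: (subring0 sEX).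
have f0 : f != 0.
  by apply: contraTneq le => ->; rewrite size_poly0 -ltnNge size_poly_gt0.
pose c := lead_coef f / lead_coef g; pose m : {poly L} := c *: 'X^(size f - size g).
have Em : coefs_in E m.
  move=> i; rewrite coefZ coefXn; apply: subringM => //.
    by apply: subringM => //; [apply: Ef|apply/EV/Eg].
  by case: eqP => _; [apply: subring1|apply: subring0].
have lg0 : lead_coef g != 0 by rewrite lead_coef_eq0.
have lf0 : lead_coef f != 0 by rewrite lead_coef_eq0.
have sg0 : (0 < size g)%N by rewrite size_poly_gt0.
have smg : size (m * g) = size f.
  rewrite -scalerAl size_scale ?mulf_neq0 ?invr_eq0 // mulrC size_mulXn //.
  by rewrite subnK.
have lt : (size (f - m * g)%R < size f)%N.
  have sf0 : (0 < size f)%N by rewrite size_poly_gt0.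
  rewrite -(prednK sf0) ltnS; apply/leq_sizeP => j; rewrite leq_eqVlt => /predU1P [<-|lt].
    have -> : (f - m * g)`_(size f).-1 = lead_coef f - lead_coef (m * g).
      by rewrite coefB !lead_coefE smg.
    by rewrite lead_coefM lead_coefZ lead_coefXn mulr1 divfK // subrr.
  rewrite coefB !nth_default ?subrr //; last by rewrite -(prednK sf0).
  by rewrite smg -(prednK sf0).
have [||q [r [Eq Er e sr]]] := IHn (f - m * g).
- exact: leq_trans lt sf.
- by apply: (subringB sEX) => //; apply: (subringM sEX).
exists (q + m), r; split=> //; first exact: (subringD sEX).
by rewrite mulrDl addrAC -e subrK.
Qed.

Lemma min_poly E x : subfield E -> alg E x -> exists m,
  [/\ m \is monic, coefs_in E m, m.[x] = 0 &
    forall f, coefs_in E f -> f.[x] = 0 -> exists2 q, coefs_in E q & f = q * m].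
Proof.
move=> fE [f0 [nz0 Ef0 f0x]]; have [sE EV] := fE; have sEX := coefs_subring sE.
pose Q n := boolp.asbool (exists f, [/\ f != 0, coefs_in E f, f.[x] = 0 & size f = n]).
have ex : exists n, Q n by exists (size f0); apply/boolp.asboolP; exists f0.
have [n /boolp.asboolP [g [g0 Eg gx sg]] min] := ex_minnP ex.
have lg0 : lead_coef g != 0 by rewrite lead_coef_eq0.
exists ((lead_coef g)^-1 *: g).
have Em : coefs_in E ((lead_coef g)^-1 *: g).
  by move=> i; rewrite coefZ; apply: subringM => //; apply/EV/Eg.
split=> //.
- by rewrite monicE lead_coefZ mulVf.
- by rewrite hornerZ gx mulr0.
move=> f Ef fx; have [q [r [Eq Er e sr]]] := subfield_divp fE g0 Ef Eg.
have rx : r.[x] = 0 by move: fx; rewrite e !hornerE gx mulr0 add0r.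
have r0 : r = 0.
  apply/eqP; apply: contraTT sr => nr; rewrite -leqNgt sg; apply: min.
  by apply/boolp.asboolP; exists r.
exists (lead_coef g *: q).
  by move=> i; rewrite coefZ; apply: subringM => //; apply: Eg.
by rewrite -scalerAl -scalerAr scalerA mulfV // scale1r e r0 addr0.
Qed.

(** Divided by coefficients of least value, both factors become primitive, and so is their product.
    If the least value for [m] were negative, the scaling would put all coefficients of the product
    into [maxid U]. *)
Lemma gauss_monic U p m : val_ring U -> m \is monic -> (p * m) \is monic ->
  coefs_in U (p * m) -> coefs_in U m.
Proof.
move=> vU mm mpm Um; have iM := maxid_ideal vU; have [sU vUP] := vU.
have m0 := monic_neq0 mm; have p0 : p != 0.
  by apply: contraTneq mpm => ->; rewrite mul0r monicE lead_coef0 eq_sym oner_eq0.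
have [i [mi Umi]] := max_coef vU m0; have [j [pj Upj]] := max_coef vU p0.
have prim f k : f`_k != 0 -> ~ coefs_in (maxid U) ((f`_k)^-1 *: f).
  by move=> fk /(_ k); rewrite coefZ mulVf //; apply: maxid1.
case: (classic (maxid U (m`_i)^-1)) => [mx|nmx]; last first.
  have Umi' := not_maxid nmx; rewrite invrK in Umi'.
  move=> k; have := subringM sU Umi' (Umi k).
  by rewrite coefZ mulrA mulfV // mul1r.
have pP := coefs_prime sU (maxid_prime vU).
have [] : ~ coefs_in (maxid U) ((p`_j)^-1 *: p * ((m`_i)^-1 *: m)).
  by case/(prime_mul pP Upj Umi) => [/(prim _ _ pj)|/(prim _ _ mi)].
rewrite -scalerAl -scalerAr => k; rewrite !coefZ mulrCA.
apply: (idealMr iM) mx; apply: subringM => //.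
have := Upj (size p).-1; rewrite coefZ -lead_coefE.
have -> : lead_coef p = 1; last by rewrite mulr1.
by move: mpm; rewrite monicE lead_coefM (monicP mm) mulr1 => /eqP.
Qed.

(** Modulo the maximal ideal the product is a power of ['X]. The lowest coefficients of [m] and [p]
    outside [maxid U] multiply to such a coefficient of the product, which can only be the leading
    one; so both are leading. *)
Lemma gauss_monic_lt U p m : val_ring U -> m \is monic -> (p * m) \is monic ->
  (forall i, (i < (size (p * m)%R).-1)%N -> maxid U (p * m)`_i) ->
  forall i, (i < (size m).-1)%N -> maxid U m`_i.
Proof.
move=> vU mm mpm Mpm; have iM := maxid_ideal vU; have [sU vUP] := vU.
have M0 := ideal0 iM; have m0 := monic_neq0 mm; have p0 : p != 0.
  by apply: contraTneq mpm => ->; rewrite mul0r monicE lead_coef0 eq_sym oner_eq0.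
have mp : p \is monic by move: mpm; rewrite !monicE lead_coefM (monicP mm) mulr1.
have U1 := subring1 sU.
have Upm : coefs_in U (p * m).
  move=> i; case: (ltngtP i (size (p * m)%R).-1) => [/Mpm|lt|->].
  - exact: maxidS.
  - rewrite nth_default; first exact: subring0.
    by move: lt; case: (size _).
  - by rewrite -lead_coefE (monicP mpm).
have Um := gauss_monic vU mm mpm Upm.
have Up : coefs_in U p by rewrite mulrC in mpm Upm; apply: gauss_monic mpm Upm.
have notM f : f \is monic -> ~ coefs_in (maxid U) f.
  by move=> mf /(_ (size f).-1); rewrite -lead_coefE (monicP mf); apply: maxid1.
have [n1 [g1 [h1 [e1 M1 ng1 c1]]]] := split_low M0 (notM _ mm).
have [n2 [g2 [h2 [e2 M2 ng2 c2]]]] := split_low M0 (notM _ mp).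
have le f n : ~ maxid U f`_n -> (n <= (size f).-1)%N.
  move=> nf; rewrite leqNgt; apply/negP => lt; apply: nf; left; apply: nth_default.
  by move: lt; case: (size f).
have le1 : (n1 <= (size m).-1)%N by apply: le; rewrite -[n1]add0n -c1.
have le2 : (n2 <= (size p).-1)%N by apply: le; rewrite -[n2]add0n -c2.
have iMX := coefs_ideal iM.
have Ug1 : coefs_in U g1 by move=> i; rewrite c1; apply: Um.
have Ug2 : coefs_in U g2 by move=> i; rewrite c2; apply: Up.
have UXn n : coefs_in U ('X^n : {poly L}).
  by move=> i; rewrite coefXn; case: eqP => _ //; apply: subring0.
have sUX := coefs_subring sU.
have ePM : p * m = g2 * g1 * 'X^(n2 + n1) + (h2 * m + g2 * 'X^n2 * h1).
  by rewrite {1}e2 mulrDl {2}e1 exprD; ring.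
have MR : coefs_in (maxid U) (h2 * m + g2 * 'X^n2 * h1).
  apply: (idealD iMX); first exact: (idealMr iMX).
  by apply: (idealM iMX) => //; apply: (subringM sUX).
have nM : ~ maxid U (p * m)`_(n2 + n1).
  rewrite ePM coefD coefMXn ltnn subnn coef0M => m'.
  have : maxid U (g2`_0 * g1`_0) by rewrite -[_ * _](addrK (h2 * m + g2 * 'X^n2 * h1)`_(n2 + n1)); apply: (idealB iM m' (MR _)).
  by case/(prime_mul (maxid_prime vU) (Ug2 0%N) (Ug1 0%N)).
have : ((size (p * m)%R).-1 <= n2 + n1)%N.
  by rewrite leqNgt; apply/negP => /Mpm.
have m_gt0 : (0 < size m)%N by rewrite size_poly_gt0.
have p_gt0 : (0 < size p)%N by rewrite size_poly_gt0.
have -> : (size (p * m)%R).-1 = ((size p).-1 + (size m).-1)%N.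
  by rewrite size_mul // -(prednK m_gt0) -(prednK p_gt0) /= addnS.
move=> leN i lt.
have e : n1 = (size m).-1.
  apply/eqP; rewrite eqn_leq le1 /= -(leq_add2l (size p).-1).
  by apply: leq_trans leN _; rewrite leq_add2r.
by rewrite e1 coefD coefMXn e lt addr0; apply: M1.
Qed.

End GoingDown.

(** * Normality of [V1[r]] and going down *)

Section Normal.
Variables (L : fieldType) (K : set L) (r : L).
Hypotheses (cK : closed_field K) (nKr : ~ K r).
Implicit Types (U W : set L) (f g p : {poly L}).

Let fK : subfield K. Proof. by case: cK. Qed.
Let sK : subring K. Proof. by case: fK. Qed.
Let sKX : subring (coefs_in K). Proof. exact: coefs_subring. Qed.

(** As [r] is transcendental over [K], a nonconstant [b(r)] is not a unit of [K[r]] and generates a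
    proper ideal. *)
Lemma poly_center b : coefs_in K b -> (1 < size b)%N -> exists U,
  [/\ val_ring U, subset K U, U r & maxid U b.[r]].
Proof.
move=> Kb sb; have sA := adj_subring r sK.
pose J : set L := fun y => exists2 f, coefs_in K f & y = b.[r] * f.[r].
have iJ : ideal_in (adj K r) J.
  split; first by move=> _ [f Kf ->]; exists (b * f); [apply: (subringM sKX)|rewrite hornerM].
  split; first by exists 0; [apply: (subring0 sKX)|rewrite horner0 mulr0].
  split=> [_ _ [f Kf ->] [g Kg ->]|_ _ [f Kf ->] [g Kg ->]].
    by exists (f - g); [apply: (subringB sKX)|rewrite !hornerE mulrBr].
  by exists (f * g); [apply: (subringM sKX)|rewrite hornerM mulrCA].
have [|U [vU AU JU]] := chevalley0 sA iJ.
  case=> f Kf e; have Kbf : coefs_in K (b * f - 1).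
    by apply: (subringB sKX); [apply: (subringM sKX)|apply: (subring1 sKX)].
  have /eqP : b * f - 1 = 0.
    by apply: (transc_poly0 cK nKr Kbf); rewrite !hornerE -e subrr.
  rewrite subr_eq0 => /eqP e1.
  have := size_poly1 L; rewrite -e1 => s1.
  have b0 : b != 0 by rewrite -size_poly_gt0 ltnW.
  have f0 : f != 0.
    by apply/eqP => f0; move/eqP: s1; rewrite f0 mulr0 size_poly0.
  move: s1; rewrite size_mul //; move: f0; rewrite -size_poly_gt0.
  by case: (size b) sb => [|[|k]] // _; case: (size f) => // l _; rewrite addnS.
exists U; split=> //.
- by move=> x Kx; apply: AU; apply: adj_base.
- by apply: AU; apply: adj_gen.
by apply: JU; exists 1; [apply: (subring1 sKX)|rewrite hornerC mulr1].
Qed.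

(** Normality of [K[r]]: for a denominator [b] of least size, numerator and denominator combine to a
    nonzero constant. A valuation ring containing [m] and centered at a nonconstant [b(r)] would
    have this constant in its maximal ideal. *)
Lemma integral_poly m : frac (adj K r) m ->
  (forall U, val_ring U -> subset K U -> U r -> U m) ->
  exists2 a, coefs_in K a & m = a.[r].
Proof.
case=> _ [_ [[a0 Ka0 ->] [[b0 Kb0 ->] nb0] em]] Um.
have transc f : coefs_in K f -> f != 0 -> f.[r] != 0.
  by move=> Kf; apply: contra_neq => /(transc_poly0 cK nKr Kf).
pose Q n := boolp.asbool (exists a b, [/\ coefs_in K a, coefs_in K b, b != 0,
  m * b.[r] = a.[r] & size b = n]).
have ex : exists n, Q n.
  exists (size b0); apply/boolp.asboolP; exists a0, b0; split=> //.
    by apply: contra_neq nb0 => ->; rewrite horner0.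
  by rewrite em divfK.
have [n /boolp.asboolP [a [b [Ka Kb nzb e sb]]] min] := ex_minnP ex.
case: (leqP n 1) => [n1|n1].
  have [c c0 eb] : exists2 c, c != 0 & b = c%:P.
    have /size_poly1P [c c0 ->] : size b == 1%N by rewrite sb eqn_leq n1 -sb size_poly_gt0.
    by exists c.
  have Kc : K c by have := Kb 0%N; rewrite eb coefC.
  exists (c^-1 *: a).
    by move=> i; rewrite coefZ; apply: subringM => //; apply: (proj2 fK).
  by rewrite hornerZ -e eb hornerC mulrCA mulVf ?mulr1.
exfalso.
(* A nonzero combination [d] of [a] and [b] of least size is their greatest common divisor;
   cancelling it shows by minimality of [b] that [d] is constant. *)
pose Q' k := boolp.asbool (exists u v, [/\ coefs_in K u, coefs_in K v,
  u * a + v * b != 0 & size (u * a + v * b) = k]).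
have ex' : exists k, Q' k.
  exists (size b); apply/boolp.asboolP; exists 0, 1.
  by rewrite mul0r mul1r add0r; split=> //; [apply: (subring0 sKX)|apply: (subring1 sKX)].
have [k /boolp.asboolP [u [v [Ku Kv]]]] := ex_minnP ex'.
set d := u * a + v * b => nzd sd mind.
have Kd : coefs_in K d by apply: (subringD sKX); apply: (subringM sKX).
have dvd x y f : coefs_in K x -> coefs_in K y -> coefs_in K f ->
    f = x * a + y * b -> exists2 q, coefs_in K q & f = q * d.
  move=> Kx Ky Kf ef; have [q [s [Kq Ks efs ss]]] := subfield_divp fK nzd Kf Kd.
  exists q => //; suff s0 : s = 0 by rewrite efs s0 addr0.
  apply/eqP; apply: contraTT ss => s0; rewrite -leqNgt sd; apply: mind.
  apply/boolp.asboolP; exists (x - q * u), (y - q * v).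
  have -> : (x - q * u) * a + (y - q * v) * b = s.
    have -> : s = f - q * d by rewrite efs addrC addKr.
    by rewrite ef /d; ring.
  by split=> //; apply: (subringB sKX) => //; apply: (subringM sKX).
have K1 := subring1 sKX; have K0 := subring0 sKX.
have [qa Kqa ea] : exists2 q, coefs_in K q & a = q * d.
  by apply: (dvd 1 0) => //; rewrite mul1r mul0r addr0.
have [qb Kqb eb] : exists2 q, coefs_in K q & b = q * d.
  by apply: (dvd 0 1) => //; rewrite mul1r mul0r add0r.
have nzqb : qb != 0 by apply: contra_neq nzb => z; rewrite eb z mul0r.
have le : (n <= size qb)%N.
  apply: min; apply/boolp.asboolP; exists qa, qb; split=> //.
  apply: (mulIf (transc d Kd nzd)); rewrite -mulrA -hornerM -eb e.
  by rewrite -hornerM -ea.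
have : size d == 1%N.
  move: le; rewrite -sb eb size_mul //; move: nzqb nzd; rewrite -!size_poly_gt0.
  case: (size qb) => // i _; case: (size d) => // j _; rewrite addSn /= addnS.
  by rewrite ltnS -[X in (_ <= X)%N]addn0 leq_add2l leqn0 => /eqP ->.
case/size_poly1P => c c0 edc.
have [|U [vU KU Ur Ub]] := poly_center Kb; first by rewrite sb.
have iM := maxid_ideal vU.
have UK f : coefs_in K f -> U f.[r].
  by move=> Kf; apply: coefs_horner_ring Ur _; [case: vU|move=> i; apply: KU].
have Kc : K c by have := Kd 0%N; rewrite edc coefC.
apply: (subfield_unit fK KU Kc c0).
have -> : c = d.[r] by rewrite edc hornerC.
rewrite /d hornerD !hornerM -e; apply: (idealD iM).
  by apply: (idealM iM) (UK _ Ku) _; apply: (idealM iM) Ub; apply: Um.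
by apply: (idealM iM) (UK _ Kv) _.
Qed.

Variable W : set L.
Hypothesis vW : val_ring W.
Let V1 : set L := fun x => K x /\ W x.
Let sV1 : subring V1. Proof. exact: subfield_inter. Qed.

(** In an extension of the trace of [W] where the residue of [r] is transcendental, [a(r)] has the
    least value of the coefficients of [a], so its integrality bounds them all. With [integral_poly]
    this is the normality of [V1[r]]. *)
Lemma integral_coefs a : coefs_in K a ->
  (forall U, val_ring U -> subset V1 U -> U r -> U a.[r]) -> coefs_in W a.
Proof.
move=> Ka Ua; have [a0|a0] := eqVneq a 0.
  by rewrite a0 => i; rewrite coef0; apply: subring0 vW.1.
have [i [ai Wa]] := max_coef vW a0; have [sW _] := vW.
pose m1 : set L := fun x => K x /\ maxid W x.
have pm1 : prime_in V1 m1.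
  have iM := maxid_ideal vW; split.
    split; first by move=> x [Kx Mx]; split=> //; apply: maxidS.
    split; first by split; [apply: subring0|apply: (ideal0 iM)].
    split=> [x y [Kx Mx] [Ky My]|x y [Kx Wx] [Ky My]].
      by split; [apply: subringB|apply: (idealB iM)].
    by split; [apply: subringM|apply: (idealM iM)].
  split; first by case=> _; apply: maxid1.
  move=> x y [Kx Wx] [Ky Wy] [_ /(prime_mul (maxid_prime vW) Wx Wy) [mx|my]];
    by [left|right].
have [|U [vU VU Ur UP]] := @chevalley_gauss _ V1 m1 r sV1 pm1.
  move=> f Vf fr; have -> : f = 0.
    by apply: transc_poly0 cK nKr _ fr => j; case: (Vf j).
  by move=> j; rewrite coef0; split; [apply: subring0|left].
have Kai : K (a`_i)^-1 by apply: (proj2 fK).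
have Va : coefs_in V1 ((a`_i)^-1 *: a).
  by move=> j; split=> //; rewrite coefZ; apply: subringM.
have nm : ~ maxid U ((a`_i)^-1 *: a).[r].
  by move/(UP _ Va)/(_ i) => [_]; rewrite coefZ mulVf //; apply: maxid1.
have Uai : U a`_i.
  have -> : a`_i = a.[r] * (((a`_i)^-1 *: a).[r])^-1.
    rewrite hornerZ invfM invrK mulrCA mulfV ?mulr1 //.
    by apply: contra_neq a0 => /(transc_poly0 cK nKr Ka).
  by apply: (subringM vU.1); [apply: Ua|apply: not_maxid].
have Wai : W a`_i.
  apply: NNPP => nW; have [_ mW] := notin_val vW nW.
  have : maxid U (a`_i)^-1.
    have := UP (a`_i)^-1%:P; rewrite hornerC => -[].
      by apply: coefs_C; [apply: subring0|split=> //; apply: maxidS].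
    move=> _; apply; apply: coefs_C; last by split.
    by split; [apply: subring0|left].
  by move/maxidVN; rewrite invrK => /(_ Uai) /eqP; rewrite invr_eq0 (negPf ai).
by move=> j; have := subringM sW Wai (Wa j); rewrite coefZ mulrA mulfV // mul1r.
Qed.

Hypothesis mr : maxid W r.

(** By [integral_val] this is the integral closure of [V1[r]] in [L]. *)
Definition icl : set L := fun x => forall U, val_ring U -> subset V1 U -> U r -> U x.

(* Going down for [V1[r]] in its integral closure, at the prime [r V1[r]]: the minimal
   polynomial of [s] over [K(r)] has coefficients in [V1[r]], and the equation of integral
   dependence of [o = v s / r] shows that it is a power of ['X] modulo [r]. *)
Lemma going_down v s o : K v -> W v -> v != 0 -> icl s -> icl o -> v * s = r * o ->
  maxid W s.
Proof.
move=> Kv Wv v0 Os Oo e; have [sW _] := vW; have iM := maxid_ideal vW.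
have Wr := maxidS vW mr.
have Ws : W s by apply: Os => // x [].
have sC := adj_subring r sV1; set C := adj V1 r in sC.
have CU U : val_ring U -> subset C U -> subset V1 U /\ U r.
  by move=> vU CU; split; [move=> x Vx; apply: CU; apply: adj_base|apply: CU; apply: adj_gen].
have [f [mf Cf fs]] : exists f, [/\ f \is monic, coefs_in C f & f.[s] = 0].
  by apply: integral_val => // U vU /(CU U vU) []; apply: Os.
have [g [mg Cg go]] : exists f, [/\ f \is monic, coefs_in C f & f.[o] = 0].
  by apply: integral_val => // U vU /(CU U vU) []; apply: Oo.
have sA := adj_subring r sK; pose E := frac (adj K r); have fE := frac_subfield sA.
have CA : subset C (adj K r).
  by move=> _ [h Vh ->]; exists h => // i; case: (Vh i).
have CE : subset C E by move=> x /CA; apply: frac_base.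
have algs : alg E s by exists f; split=> [||//]; [apply: monic_neq0|move=> i; apply: CE].
have [m [mm Em ms mdiv]] := min_poly fE algs.
have [q Eq efq] := mdiv f (fun i => CE _ (Cf i)) fs.
have mI i : icl m`_i.
  move=> U vU VU Ur; have CU' : subset C U by apply: adj_sub => //; case: vU.
  have := @gauss_monic _ U q m vU mm; rewrite -efq => /(_ mf) h.
  by apply: h => j; apply: CU'.
have mP i : exists2 a, coefs_in K a & m`_i = a.[r].
  apply: integral_poly; first exact: Em.
  by move=> U vU KU Ur; apply: mI => // x [Kx _]; apply: KU.
(* [U] is a place over [r = 0] of [K[r]]: it contains [K], has [r] in its maximal ideal, and meets
   [K] there only in [0]. *)
have [|U [vU KU Ur]] := @poly_center 'X (coefs_X sK); first by rewrite size_polyX.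
rewrite hornerX => mUr; have iMU := maxid_ideal vU.
have r0 : r != 0 by apply/eqP => z; apply: nKr; rewrite z; apply: subring0.
pose N := (size g).-1; pose w := r / v.
have Kw : adj K r w.
  by apply: (subringM sA); [apply: adj_gen|apply: adj_base => //; apply: (proj2 fK)].
have mUw : maxid U w by apply: (idealMr iMU) => //; apply/KU/(proj2 fK).
(* [G(X) = w^N g(X / w)] is the monic equation of [s = w o]. As [w] lies in [maxid U], it is a power
   of ['X] modulo [maxid U], and [m] divides it. *)
pose G := \poly_(i < N.+1) (g`_i * w ^+ (N - i)).
have g_gt0 : (0 < size g)%N by rewrite size_poly_gt0 monic_neq0.
have gN : g`_N = 1 by rewrite -(monicP mg) lead_coefE.
have sG : size G = N.+1.
  by rewrite size_poly_eq // subnn mulr1 gN oner_neq0.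
have mG : G \is monic by rewrite monicE lead_coefE sG coef_poly ltnSn subnn mulr1 gN.
have EG : coefs_in E G.
  apply: coefs_poly => [|i _]; first by case: fE => /subring0.
  apply: (subringM fE.1); first by apply: CE.
  by apply: frac_base => //; apply: subringX.
have Gs : G.[s] = 0.
  have es : s = w * o by rewrite /w mulrAC -e mulrAC mulfV ?mul1r.
  transitivity (w ^+ N * g.[o]); last by rewrite go mulr0.
  have sgN : (size g <= N.+1)%N by rewrite prednK.
  rewrite horner_poly (horner_coef_wide _ sgN) mulr_sumr.
  apply: eq_bigr => i _; have le : (i <= N)%N by rewrite -ltnS.
  have -> : w ^+ N = w ^+ (N - i) * w ^+ i by rewrite -exprD subnK.
  by rewrite es [(w * o) ^+ i]exprMn [g`_i * _]mulrC mulrACA.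
have [p Ep eGp] := mdiv G EG Gs.
have mlow i : (i < (size m).-1)%N -> maxid U m`_i.
  apply: (@gauss_monic_lt _ U p m) => //; rewrite -eGp // sG /= => j lt.
  rewrite coef_poly ltnS ltnW //; apply: (idealM iMU).
    have [h Vh ->] := Cg j; apply: coefs_horner_ring => //; first by case: vU.
    by move=> k; apply: KU; case: (Vh k).
  have : (0 < N - j)%N by rewrite subn_gt0.
  by case: (N - j)%N => // k _; rewrite exprSr; apply: (idealM iMU) => //;
     apply: (subringX _ vU.1); apply: maxidS.
(* By normality [m_i = a(r)] with [a] over [V1]. The constant term of [a] lies in [K] and in
   [maxid U], hence vanishes, so [r] divides [m_i] in [V1[r]]. *)
have mW i : (i < (size m).-1)%N -> maxid W m`_i.
  move=> lt; have [a Ka ea] := mP i.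
  have Wa : coefs_in W a.
    by apply: integral_coefs => // U' vU' VU' Ur'; rewrite -ea; apply: mI.
  have Ua : coefs_in U a by move=> j; apply: KU.
  have a0 : a`_0 = 0.
    apply/eqP; apply: contraT => nz; exfalso.
    apply: (subfield_unit fK KU (Ka 0%N) nz).
    have := horner_mod vU.1 iMU Ua mUr; rewrite -ea => h.
    have := idealB iMU (mlow i lt) h; by rewrite opprB addrC subrK.
  by have := horner_mod sW iM Wa mr; rewrite a0 subr0 -ea.
have m_gt0 : (0 < size m)%N by rewrite size_poly_gt0 monic_neq0.
apply: (prime_exp sW (maxid_prime vW) Ws (n := (size m).-1)).
have -> : s ^+ (size m).-1 = - \sum_(i < (size m).-1) m`_i * s ^+ i.
  apply/eqP; rewrite -addr_eq0 addrC; apply/eqP; rewrite -[RHS]ms horner_coef.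
  rewrite -[in RHS](prednK m_gt0) big_ord_recr /= -lead_coefE.
  by rewrite (monicP mm) mul1r.
apply: (idealN iM); apply: addgrp_sum => [|i _]; first exact: ideal_addgrp iM.
by apply: (idealMr iM); [apply: subringX|apply: mW].
Qed.

End Normal.

(** * Reduction of algebraic elements to monomials *)

Section LocalParameter.
Variables (L : fieldType) (W K : set L).
Hypotheses (vW : val_ring W) (cK : closed_field K).
Implicit Types (R U : set L) (f g p : {poly L}) (s : seq L).

Definition val_closed R := forall x, (forall U, val_ring U -> subset R U -> U x) -> R x.

(** The local rings dominated by [W] and integrally closed in [L]. Besides [W], the example that
    matters is the localization of [icl] in [prime_density]. *)
Definition local_closed R :=
  [/\ subring R, subset R W, forall x, R x -> ~ maxid W x -> R x^-1 & val_closed R].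

Let fK : subfield K. Proof. by case: cK. Qed.
Let sK : subring K. Proof. by case: fK. Qed.
Let KV x : K x -> K x^-1. Proof. by case: fK => _; apply. Qed.
Let sW : subring W. Proof. by case: vW. Qed.
Let iM := maxid_ideal vW.

Lemma closed_field_val : val_closed K.
Proof. by move=> x Ux; case: cK => _; apply; apply/(algP _ fK). Qed.

Lemma local_closed_self : local_closed W.
Proof.
split=> //; first by move=> x _; apply: not_maxid.
by move=> x; apply.
Qed.

(* With [u_i = sum_(k >= i) f_k x^(k-i)], both [u_i] and [x u_i] are integral over [R],
   and [f_i = u_i - x u_(i+1)]. *)
Lemma local_closed_root R x f : local_closed R -> W x -> coefs_in R f -> f.[x] = 0 ->
  ~ coefs_in (maxid W) f -> R x.
Proof.
move=> [sR RW RV vR] Wx Rf fx nf.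
pose u i := (drop_poly i f).[x].
have uS i : u i = f`_i + x * u i.+1.
  rewrite /u (_ : drop_poly i f = (f`_i)%:P + 'X * drop_poly i.+1 f); last first.
    apply/polyP => k; rewrite coefD coefC coefXM !coef_drop_poly.
    by case: k => [|k] /=; rewrite ?addr0 ?add0r // addSnnS.
  by rewrite !hornerE.
have Uu i U : val_ring U -> subset R U -> U (u i.+1) /\ U (x * u i.+1).
  move=> vU RU; have [sU _] := vU; have Uf : coefs_in U f by move=> k; apply: RU.
  case: (classic (U x)) => [Ux|nUx].
    have Uui : U (u i.+1).
      by apply: coefs_horner_ring => // k; rewrite coef_drop_poly.
    by split=> //; apply: subringM.
  have [x0 mx] := notin_val vU nUx; have Uxv := maxidS vU mx.
  have e : u i.+1 = - \sum_(k < i.+1) f`_k * x^-1 ^+ (i.+1 - k).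
    have e : (drop_poly i.+1 f).[x] * x ^+ i.+1 = - (take_poly i.+1 f).[x].
      by apply/eqP; rewrite -addr_eq0 addrC -hornerXn -hornerM -hornerD poly_take_drop fx.
    have xi : x ^+ i.+1 != 0 by rewrite expf_neq0.
    apply: (mulIf xi); rewrite /u e mulNr; congr (- _).
    rewrite horner_poly mulr_suml; apply: eq_bigr => k _.
    have le : (k <= i.+1)%N by apply: ltnW.
    have xv0 : x^-1 != 0 by rewrite invr_eq0.
    by rewrite -mulrA -(exprVM xv0 le) invrK -mulrA -exprMn mulVf // expr1n mulr1.
  rewrite e mulrN mulr_sumr; split; apply: (subringN sU);
    apply: addgrp_sum => [|k _]; try exact: subring_addgrp.
    by apply: subringM => //; apply: subringX.
  have lt : (k <= i)%N by rewrite -ltnS.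
  rewrite subSn // exprS mulrCA mulVKf //.
  by apply: subringM => //; apply: subringX.
have Ru i : R (u i.+1) /\ R (x * u i.+1).
  by split; apply: vR => U vU RU; have [] := Uu i U vU RU.
have [[i ni]|nex] := classic (exists i, ~ maxid W (u i.+1)).
  have [R1 R2] := Ru i; have u0 := not_maxid0 ni.
  by rewrite -(mulfK u0 x); apply: subringM => //; apply: RV.
have mu i : maxid W (u i).
  case: i => [|i]; last by apply: NNPP => ni; apply: nex; exists i.
  by rewrite /u drop_poly0l fx; left.
case: nf => i; rewrite (_ : f`_i = u i - x * u i.+1); last by rewrite uS addrK.
by apply: (idealB iM) => //; apply: (idealM iM).
Qed.

Definition inter : set L := fun x => K x /\ W x.

Variable y : L.
Hypotheses (nKy : ~ K y) (Wy : W y).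

Let y0 : y != 0.
Proof. by apply/eqP => z; apply: nKy; rewrite z; apply: subring0. Qed.

Definition monomial c := exists k m n, [/\ K k, c = k * y ^+ m * y^-1 ^+ n & W c].

(** The notion trades generators of [A] for finitely many monomials before the ring [R] is known;
    [R] depends on the element [r] that [local_parameter] finds for these monomials. *)
Definition captured x := exists2 s : seq L, (forall c, c \in s -> monomial c) &
  forall R, local_closed R -> subset inter R -> (forall c, c \in s -> R c) -> R x.

Lemma captured_seq s : (forall x, x \in s -> captured x) ->
  exists2 t : seq L, (forall c, c \in t -> monomial c) &
  forall R, local_closed R -> subset inter R -> (forall c, c \in t -> R c) ->
    forall x, x \in s -> R x.
Proof.
elim: s => [_|x s IHs Hs]; first by exists [::].
have [|t tm tR] := IHs; first by move=> z zs; apply: Hs; rewrite inE zs orbT.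
have [t' tm' tR'] := Hs x (mem_head _ _).
exists (t' ++ t); first by move=> c; rewrite mem_cat => /orP [/tm'|/tm].
move=> R cR VR Rc z; rewrite inE => /predU1P [->|zs].
  by apply: tR' => // c ct; apply: Rc; rewrite mem_cat ct.
by apply: tR zs => // c ct; apply: Rc; rewrite mem_cat ct orbT.
Qed.

Lemma captured_sub x : captured x -> W x.
Proof.
case=> s sm; apply; [exact: local_closed_self|by move=> z []|].
by move=> c /sm [k [m [n []]]].
Qed.

Lemma captured_op x : (forall R, local_closed R -> subset inter R -> R x) -> captured x.
Proof. by move=> Rx; exists [::] => // R cR VR _; apply: Rx. Qed.

Lemma capturedM a b : captured a -> captured b -> captured (a * b).
Proof.
move=> ca cb; have [|t tm tR] := @captured_seq [:: a; b].
  by move=> x; rewrite !inE => /orP [] /eqP ->.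
exists t => // R cR VR Rt; have [sR _ _ _] := cR.
by apply: subringM => //; apply: (tR R) => //; rewrite !inE eqxx ?orbT.
Qed.

Definition captured_unit u := [/\ u != 0, captured u & captured u^-1].

Lemma captured_unitM a b : captured_unit a -> captured_unit b -> captured_unit (a * b).
Proof.
move=> [a0 ca ca'] [b0 cb cb']; split; first exact: mulf_neq0.
  exact: capturedM.
by rewrite invfM; apply: capturedM.
Qed.

Lemma captured_unit1 : captured_unit 1.
Proof.
rewrite /captured_unit invr1; split; first exact: oner_neq0.
  by apply: captured_op => R [sR _ _ _] _; apply: subring1.
by apply: captured_op => R [sR _ _ _] _; apply: subring1.
Qed.

Definition mono_unit x := exists k m u, [/\ K k, k != 0, captured_unit u &
  x = k * y ^+ m * u].

Lemma mono_unitM a b : mono_unit a -> mono_unit b -> mono_unit (a * b).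
Proof.
move=> [k [m [u [Kk k0 cu ->]]]] [k' [m' [u' [Kk' k0' cu' ->]]]].
exists (k * k'), (m + m')%N, (u * u'); split; first exact: subringM.
- exact: mulf_neq0.
- exact: captured_unitM.
by rewrite exprD; ring.
Qed.

Lemma mono_unit_const k : K k -> k != 0 -> mono_unit k.
Proof.
by move=> Kk k0; exists k, 0%N, 1; rewrite !mulr1; split=> //; apply: captured_unit1.
Qed.

(** By hypothesis the value of [y] is at least that of [y - b]. Factoring out whichever of [y] and
    [-b] has smaller value leaves [1 - c] with [c] a monomial, and this is a unit of [W]. *)
Lemma mono_unit_sub b : K b -> W (y / (y - b)) -> mono_unit (y - b).
Proof.
move=> Kb Wyb; have yb0 : y - b != 0.
  by rewrite subr_eq0; apply/eqP => e; apply: nKy; rewrite e.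
have W1 := subring1 sW.
have unit u c : W u -> ~ maxid W u -> monomial c -> u = 1 - c -> captured_unit u.
  move=> Wu nu mc e; split; first exact: not_maxid0 nu.
    exists [:: c] => [d|R [sR _ _ _] _ Rc]; first by rewrite inE => /eqP ->.
    by rewrite e; apply: subringB; [|apply: subring1|apply: Rc; rewrite inE].
  exists [:: c] => [d|R [sR _ RV _] _ Rc]; first by rewrite inE => /eqP ->.
  apply: RV => //; rewrite e.
  by apply: subringB; [|apply: subring1|apply: Rc; rewrite inE].
case: (classic (W (b / y))) => [Wb|nWb].
  exists 1, 1%N, (1 - b / y); split; first exact: subring1.
  - exact: oner_neq0.
  - apply: (unit _ (b / y)) => //; first by apply: subringB.
      apply: unit_not_maxid.
        by rewrite -(divff y0) -mulrBl mulf_neq0 ?invr_eq0.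
      by rewrite -(divff y0) -mulrBl invf_div.
    by exists b, 0%N, 1%N; rewrite mulr1 expr1.
  by field.
have [b0 mb] := notin_val vW nWb; rewrite invf_div in mb.
have nzb : b != 0 by apply: contra_neq b0 => ->; rewrite mul0r.
exists (- b), 0%N, (1 - y / b); split; first exact: subringN.
- by rewrite oppr_eq0.
- apply: (unit _ (y / b)) => //.
  + by apply: subringB => //; apply: maxidS.
  + move=> m; apply: (maxid1 sW); rewrite -(subrK (y / b) 1); exact: (idealD iM).
  exists b^-1, 1%N, 0%N; split; [exact: KV|by rewrite mulr1 expr1 mulrC|exact: maxidS].
by field.
Qed.

(** After division by the coefficient of least value, every coefficient is zero or a monomial times
    a captured unit, and [local_closed_root] applies. *)
Lemma captured_root x f : W x -> f != 0 -> f.[x] = 0 ->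
  (forall i, f`_i != 0 -> mono_unit f`_i) -> captured x.
Proof.
move=> Wx f0 fx mf; have [i0 [fi Wf]] := max_coef vW f0.
pose g := (f`_i0)^-1 *: f.
have cg i : captured g`_i.
  have [fi0|fi0] := eqVneq f`_i 0.
    by rewrite coefZ fi0 mulr0; apply: captured_op => R [sR _ _ _] _; apply: subring0.
  have Wg := Wf i; rewrite coefZ in Wg.
  have [k [m [u [Kk k0 [u0 cu cu'] ef]]]] := mf i fi0.
  have [k' [m' [u' [Kk' k0' [u0' cv cv'] ef']]]] := mf i0 fi.
  pose c := (k / k') * y ^+ m * y^-1 ^+ m'.
  have ec : g`_i = c * (u / u').
    rewrite coefZ ef ef' /c exprVn; field.
    by rewrite u0' k0' expf_neq0.
  rewrite ec; apply: capturedM; last exact: capturedM.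
  exists [:: c] => [d|R _ _]; last by apply; rewrite inE.
  rewrite inE => /eqP ->; exists (k / k'), m, m'; split=> //.
    by apply: subringM => //; apply: KV.
  have -> : c = g`_i * (u' * u^-1).
    by rewrite ec -mulrA -[u / u']invf_div mulVf ?mulr1 // mulf_neq0 ?invr_eq0.
  by apply: subringM; [|rewrite coefZ|apply: subringM => //; apply: captured_sub].
have [t|t tm tR] := @captured_seq (polyseq g).
  by move/(nthP 0) => [i _ <-].
exists t => // R cR VR Rt; have [sR _ _ _] := cR.
apply: (@local_closed_root R x g) => //.
- move=> i; case: (ltnP i (size g)) => [lt|le]; last by rewrite nth_default //; apply: subring0.
  by apply: (tR R) => //; apply: mem_nth.
- by rewrite hornerZ fx mulr0.
by move/(_ i0); rewrite coefZ mulVf //; apply: maxid1.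
Qed.

End LocalParameter.

(** * One local parameter for finitely many monomials *)

Section LocalParameters.
Variables (L : fieldType) (W K B : set L).
Hypotheses (vW : val_ring W) (cK : closed_field K) (sB : subring B).
Hypotheses (BK : subset B K) (BW : subset B W).
Hypothesis resid : forall v, W v -> ralg W B v.
Implicit Types (R U : set L) (f g p : {poly L}) (s : seq L).

Local Notation V1 := (inter W K).

Let fK : subfield K. Proof. by case: cK. Qed.
Let sK : subring K. Proof. by case: fK. Qed.
Let KV x : K x -> K x^-1. Proof. by case: fK => _; apply. Qed.
Let sW : subring W. Proof. by case: vW. Qed.
Let iM := maxid_ideal vW.

Lemma val_param_root U g r x : val_ring U -> g \is monic -> (1 < size g)%N ->
  coefs_in U g -> U r -> g.[x] = r -> U x.
Proof.
move=> vU mg sg Ug Ur gx; have [sU _] := vU.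
have lt : (size (- r%:P)%R < size g)%N.
  by rewrite size_polyN; apply: leq_ltn_trans (size_polyC_leq1 _) sg.
apply: (@val_root _ U (g - r%:P)) => //.
- apply: (subringB (coefs_subring sU)) => //.
  by apply: coefs_C => //; apply: subring0.
- by rewrite lead_coefDl // (monicP mg); apply: maxid1.
by left; rewrite !hornerE gx subrr.
Qed.

Lemma residual_poly v : W v -> exists g,
  [/\ g \is monic, (1 < size g)%N, coefs_in V1 g & maxid W g.[v]].
Proof.
move=> Wv; have [f [Bf nf mf]] := proj1 (ralgP vW sB BW Wv) (resid Wv).
have M0 := ideal0 iM; have [g [h [ef Mh nl gf]]] := split_top M0 nf.
have Bg : coefs_in B g by move=> i; case: (gf i) => ->; [apply: Bf|apply: subring0].
have lg0 := not_maxid0 nl.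
have mg : maxid W g.[v].
  rewrite (_ : g.[v] = f.[v] - h.[v]); last by rewrite ef hornerD addrK.
  by apply: (idealB iM) => //; apply: (coefs_horner iM sW).
have mm : (lead_coef g)^-1 *: g \is monic by rewrite monicE lead_coefZ mulVf.
have mv : maxid W ((lead_coef g)^-1 *: g).[v].
  by rewrite hornerZ; apply: (idealM iM) => //; apply: not_maxid.
exists ((lead_coef g)^-1 *: g); split=> //; last first.
  move=> i; rewrite coefZ; split.
    by apply: subringM; [|apply/KV/BK; rewrite lead_coefE|apply/BK].
  by apply: subringM; [|apply: not_maxid|apply/BW].
rewrite ltnNge; apply/negP => /size1_polyC e; move: mm mv; rewrite e monicE lead_coefC hornerC.
by move=> /eqP ->; apply: maxid1.
Qed.

(** If both factors are nonunits, [r = a + b] works, since [a] and [b] are the roots of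
    [X^2 - r X + c]. If one of them is a unit [x] of [W], then [r = g(x)] for a monic [g] from
    [residual_poly], and the other factor is [c / x]. *)
Lemma parameter_pair a b c : W a -> W b -> a * b = c -> K c -> ~ K a ->
  (b = 0 \/ ~ K b) -> exists r, [/\ ~ K r, maxid W r &
    forall R, local_closed W R -> subset V1 R -> R r -> R a /\ R b].
Proof.
move=> Wa Wb e Kc nKa nKb.
have unit x x' : x * x' = c -> W x -> W x' -> ~ K x -> ~ maxid W x ->
  exists r, [/\ ~ K r, maxid W r &
    forall R, local_closed W R -> subset V1 R -> R r -> R x /\ R x'].
  move=> ex Wx Wx' nKx nx; have [g [mg sg Vg mgx]] := residual_poly Wx.
  exists g.[x]; split=> //.
    move=> Kr; apply: nKx; apply: (closed_field_val cK) => U vU KU.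
    apply: (val_param_root vU mg sg) (KU _ Kr) erefl => i.
    by apply: KU; case: (Vg i).
  move=> R [sR RW RV vR] VR Rr.
  have Rx : R x.
    apply: vR => U vU RU; apply: (val_param_root vU mg sg) (RU _ Rr) erefl => i.
    by apply: RU; apply: VR.
  split=> //; rewrite (_ : x' = c * x^-1); last first.
    by rewrite -ex mulrAC mulfV ?mul1r // (not_maxid0 nx).
  apply: subringM => //; last exact: RV.
  by apply: VR; split=> //; rewrite -ex; apply: subringM.
have [ma|na] := classic (maxid W a); last exact: unit.
have [mb|nb] := classic (maxid W b); last first.
  have [|||||r [nKr mr Rr]] := unit b a => //; first by rewrite mulrC.
    by case: nKb => // b0; case: nb; left.
  by exists r; split=> // R cR VR R1; have [] := Rr R cR VR R1.
have int U : val_ring U -> U (a + b) -> U c -> U a.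
  move=> vU Us Uc; apply: NNPP => nU; have [a0 mx] := notin_val vU nU.
  apply: nU; rewrite (_ : a = (a + b) - c * a^-1); last first.
    by rewrite -e mulrAC mulfV // mul1r addrK.
  by apply: (subringB vU.1) => //; apply: (subringM vU.1) => //; apply: maxidS.
exists (a + b); split; last 1 first.
- move=> R [sR RW RV vR] VR Rs.
  have Rc : R c by apply: VR; split=> //; rewrite -e; apply: subringM.
  have Ra : R a by apply: vR => U vU RU; apply: int vU (RU _ Rs) (RU _ Rc).
  by split=> //; rewrite (_ : b = (a + b) - a); [apply: subringB|rewrite addrC addKr].
- move=> Ks; apply: nKa; apply: (closed_field_val cK) => U vU KU.
  exact: int vU (KU _ Ks) (KU _ Kc).
exact: (idealD iM).
Qed.

Variable y : L.
Hypotheses (nKy : ~ K y) (Wy : W y).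

Let y0 : y != 0.
Proof. by apply/eqP => z; apply: nKy; rewrite z; apply: subring0. Qed.

(** Raising each monomial to a suitable power leaves only the exponents [0], [n] and [-n] of [y].
    Integrally closed rings contain [c] along with [c^j], so nothing is lost. *)
Lemma common_power s : (forall c, c \in s -> monomial W K y c) ->
  exists2 n, (0 < n)%N & forall c, c \in s -> exists k j, [/\ K k, (0 < j)%N &
    [\/ c ^+ j = k, c ^+ j = k * y ^+ n | c ^+ j = k * y^-1 ^+ n]].
Proof.
elim: s => [_|c s IHs Hs]; first by exists 1%N.
have [|n n0 sn] := IHs; first by move=> d ds; apply: Hs; rewrite inE ds orbT.
have [k [m [l [Kk ec _]]]] := Hs c (mem_head _ _).
have [e e0 [j j0 ce]] : exists2 e, (0 < e)%N & exists2 j, (0 < j)%N & exists k' : L, K k' /\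
    [\/ c ^+ j = k', c ^+ j = k' * y ^+ e | c ^+ j = k' * y^-1 ^+ e].
  case: (ltngtP m l) => [lt|lt|eq].
  - exists (l - m)%N; first by rewrite subn_gt0.
    exists 1%N => //; exists k; split=> //; apply: Or33.
    have yv0 : y^-1 != 0 by rewrite invr_eq0.
    by rewrite expr1 ec -mulrA -(exprVM yv0 (ltnW lt)) invrK.
  - exists (m - l)%N; first by rewrite subn_gt0.
    exists 1%N => //; exists k; split=> //; apply: Or32.
    by rewrite expr1 ec -mulrA [y ^+ _ * _]mulrC (exprVM y0 (ltnW lt)).
  exists 1%N => //; exists 1%N => //; exists k; split=> //; apply: Or31.
  by rewrite expr1 ec eq -mulrA -exprMn mulfV // expr1n mulr1.
exists (n * e)%N; first by rewrite muln_gt0 n0.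
move=> d; rewrite inE => /predU1P [->|/sn [k' [j' [Kk' j'0 dk]]]].
  have [k' [Kk' ck]] := ce; exists (k' ^+ n), (j * n)%N; split.
  - exact: subringX.
  - by rewrite muln_gt0 j0.
  by rewrite exprM; case: ck => ->; [apply: Or31|apply: Or32|apply: Or33];
    rewrite // exprMn -exprM mulnC.
exists (k' ^+ e), (j' * e)%N; split.
- exact: subringX.
- by rewrite muln_gt0 j'0.
by rewrite exprM; case: dk => ->; [apply: Or31|apply: Or32|apply: Or33];
  rewrite // exprMn -exprM.
Qed.

(** [k0] has least value among the [k] in [s] with [k Z] in [W], or is [0] if these are all zero. *)
Lemma pick_generator s (Z : L) : Z != 0 -> (forall k, k \in s -> K k) -> exists k0,
  [/\ K k0, W (k0 * Z) & forall k, k \in s -> W (k * Z) -> exists2 t, V1 t & k = t * k0].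
Proof.
move=> Z0; elim: s => [_|k s IHs Hs].
  by exists 0; rewrite mul0r; split=> //; apply: subring0.
have [|k0 [Kk0 Wk0 sk]] := IHs; first by move=> d ds; apply: Hs; rewrite inE ds orbT.
have Kk := Hs k (mem_head _ _).
have V1_ x : K x -> W x -> V1 x by [].
have [Wk|nWk] := classic (W (k * Z)); last first.
  by exists k0; split=> // d; rewrite inE => /predU1P [->|/sk].
have [k1|nzk] := eqVneq k 0.
  exists k0; split=> // d; rewrite inE => /predU1P [->|/sk //] _.
  by exists 0; rewrite ?k1 ?mul0r //; apply: V1_; apply: subring0.
have [z0|nz0] := eqVneq k0 0.
  exists k; split=> // d; rewrite inE => /predU1P [-> _|ds Wd].
    by exists 1; rewrite ?mul1r //; apply: V1_; apply: subring1.
  have [t _ ->] := sk d ds Wd; exists 0; last by rewrite z0 mulr0 mul0r.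
  by apply: V1_; apply: subring0.
have [Wq|Wq] : W (k / k0) \/ W (k0 / k).
  by rewrite -[k0 / k]invf_div; apply: (proj2 vW); rewrite mulf_neq0 ?invr_eq0.
  exists k0; split=> // d; rewrite inE => /predU1P [-> _|/sk //].
  by exists (k / k0); rewrite ?divfK //; apply: V1_ => //; apply: subringM => //; apply: KV.
exists k; split=> // d; rewrite inE => /predU1P [-> _|ds Wd].
  by exists 1; rewrite ?mul1r //; apply: V1_; apply: subring1.
have [t [Kt Wt] ->] := sk d ds Wd; exists (t * (k0 / k)); last by rewrite -mulrA divfK.
by apply: V1_; apply: subringM => //; apply: subringM => //; apply: KV.
Qed.

Lemma closed_field_root n x : (0 < n)%N -> K (x ^+ n) -> K x.
Proof.
move=> n0 Kx; apply: (closed_field_val cK) => U vU KU.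
apply: (@val_param_root U 'X^n (x ^+ n)) => //; rewrite ?monicXn ?size_polyXn ?hornerXn //.
  move=> i; rewrite coefXn; case: eqP => _; [apply: subring1 vU.1|apply: subring0 vU.1].
exact: KU.
Qed.

Lemma local_closed_rootn R n x : local_closed W R -> (0 < n)%N -> R (x ^+ n) -> R x.
Proof.
move=> [sR RW RV vR] n0 Rx; apply: vR => U vU RU.
apply: (@val_param_root U 'X^n (x ^+ n)) => //; rewrite ?monicXn ?size_polyXn ?hornerXn //.
  move=> i; rewrite coefXn; case: eqP => _; [apply: subring1 vU.1|apply: subring0 vU.1].
exact: RU.
Qed.

(** Up to powers, every monomial lies in [V1] or is a [V1]-multiple of [k0 Y] or of [l0 / Y]. The
    product of these two lies in [K], so [parameter_pair] handles them with one [r]. *)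
Lemma local_parameter s : (forall c, c \in s -> monomial W K y c) ->
  exists r, [/\ ~ K r, maxid W r &
    forall R, local_closed W R -> subset V1 R -> R r -> forall c, c \in s -> R c].
Proof.
move=> ms; have [n n0 sn] := common_power ms.
pose Y := y ^+ n; have Y0 : Y != 0 by rewrite expf_neq0.
have nKY : ~ K Y by move/closed_field_root => /(_ n0).
have [kap kapP] : exists kap : L -> L, forall c, c \in s -> exists j, [/\ K (kap c), (0 < j)%N &
    [\/ c ^+ j = kap c, c ^+ j = kap c * Y | c ^+ j = kap c * Y^-1]].
  apply: (choice_fun (P := fun c k => c \in s -> exists j, [/\ K k, (0 < j)%N &
    [\/ c ^+ j = k, c ^+ j = k * Y | c ^+ j = k * Y^-1]])) => c.
  case: (boolP (c \in s)) => [cs|_]; last by exists 0.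
  have [k [j h]] := sn c cs; exists k => _; exists j; by rewrite exprVn in h.
pose ks := [seq kap c | c <- s].
(* Adding [1] to the list makes [k0] nonzero, because [Y] lies in [W]; [l0] may still be zero. *)
have Kks k : k \in 1 :: ks -> K k.
  rewrite inE => /predU1P [->|]; first exact: subring1.
  by case/mapP => c /kapP [j [Kk _ _]] ->.
have [k0 [Kk0 Wk0 k0P]] := pick_generator Y0 Kks.
have [l0 [Kl0 Wl0 l0P]] : exists k0, [/\ K k0, W (k0 * Y^-1) &
  forall k, k \in 1 :: ks -> W (k * Y^-1) -> exists2 t, V1 t & k = t * k0].
  by apply: pick_generator => //; rewrite invr_eq0.
have nz0 : k0 != 0.
  have [|t _ /esym/eqP] := k0P 1 (mem_head _ _); first by rewrite mul1r; apply: subringX.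
  by apply: contraTneq => ->; rewrite mulr0 eq_sym oner_neq0.
have [||||r [nKr mr Rr]] := @parameter_pair (k0 * Y) (l0 * Y^-1) (k0 * l0) Wk0 Wl0.
- by rewrite mulrACA mulfV // mulr1.
- exact: subringM.
- by move=> Kk; apply: nKY; rewrite -(mulKf nz0 Y); apply: subringM => //; apply: KV.
- have [->|lz] := eqVneq l0 0; [by left; rewrite mul0r|right=> Kl; apply: nKY].
  rewrite -[Y]invrK; apply: KV; rewrite -(mulKf lz Y^-1).
  by apply: subringM => //; apply: KV.
exists r; split=> // R cR VR R1 c cs; have [sR RW RV vR] := cR.
have [RkY RlY] := Rr R cR VR R1.
have [j [Kk j0 cj]] := kapP c cs; apply: (local_closed_rootn cR j0).
have [k' [m' [l' [_ _ Wc]]]] := ms c cs.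
have Wcj : W (c ^+ j) by apply: subringX.
have inks : kap c \in 1 :: ks by rewrite inE map_f ?orbT.
case: cj => e; rewrite e in Wcj *.
- by apply: VR.
- have [t Vt ->] := k0P _ inks Wcj; rewrite -mulrA.
  by apply: subringM => //; apply: VR.
have [t Vt ->] := l0P _ inks Wcj; rewrite -mulrA.
by apply: subringM => //; apply: VR.
Qed.

End LocalParameters.

(** * Minimal valuation rings with a bounded center *)

Section MinimalValuation.
Variable L : fieldType.
Implicit Types (A B C E K R S P U V W : set L).

(** At a maximal [maxid W], every [U] with the same center on [B] has no larger maximal ideal, hence
    contains [W]; that is residual algebraicity of all of [W]. *)
Lemma minimal_valuation W0 B P : val_ring W0 -> subring B -> subset B W0 ->
  (forall b, B b -> maxid W0 b -> P b) -> exists W,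
  [/\ val_ring W, subset (maxid W0) (maxid W), subset B W,
      forall b, B b -> maxid W b -> P b & forall v, W v -> ralg W B v].
Proof.
move=> vW0 sB BW0 MP.
pose F (M : set L) := exists V, [/\ val_ring V, subset B V,
  (forall b, B b -> maxid V b -> P b) & M = maxid V].
have [||M [[W [vW BW WP eM]] W0M Mmax]] := @zorn_above L F (maxid W0).
- by exists W0.
- move=> C [X0 CX0] CF Ctot.
  pose M : set L := fun x => exists2 X, C X & X x.
  (* [V] is the intersection of the valuation rings in the chain, written through the union [M] of
     their maximal ideals. *)
  pose V : set L := fun x => x = 0 \/ ~ M x^-1.
  have VX X U : C X -> val_ring U -> X = maxid U -> subset V U.
    move=> CX vU eX x [->|nM]; first exact: subring0 vU.1.
    apply: NNPP => nU; have [x0 mx] := notin_val vU nU.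
    by apply: nM; exists X => //; rewrite eX.
  have inV x : (forall X U, C X -> val_ring U -> X = maxid U -> U x) -> V x.
    move=> h; have [->|x0] := eqVneq x 0; [by left|right=> -[X CX]].
    have [U [vU _ _ eX]] := CF X CX; rewrite eX => m.
    move: (maxidVN m); rewrite invrK => /(_ (h X U CX vU eX)) /eqP.
    by rewrite invr_eq0 (negPf x0).
  have sV : subring V.
    split; first by left.
    split; first by apply: inV => X U _ [sU _] _; apply: subring1.
    split=> x y Vx Vy; apply: inV => X U CX vU eX;
      have Ux := VX X U CX vU eX x Vx; have Uy := VX X U CX vU eX y Vy.
      exact: (subringB vU.1).
    exact: (subringM vU.1).
  have vV : val_ring V.
    split=> // x x0; apply: NNPP => /not_or_and [/not_or_and [_ /NNPP [X CX Xx]]].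
    case/not_or_and => _; rewrite invrK => /NNPP [Y CY Yx].
    have [Z [CZ Zx Zxv]] : exists Z, [/\ C Z, Z x & Z x^-1].
      by case: (Ctot _ _ CX CY) => h; [exists Y|exists X]; split=> //; apply: h.
    have [U [vU _ _ eZ]] := CF Z CZ; rewrite eZ in Zx Zxv.
    by move/eqP: (maxidVN Zx (maxidS vU Zxv)); apply/negP.
  exists V; split=> //.
  + move=> b Bb; apply: inV => X U CX vU eX; have [U' [vU' BU' _ eX']] := CF X CX.
    have : subset U' U by apply: maxid_anti => //; rewrite -eX -eX'.
    by apply; apply: BU'.
  + move=> b Bb [->|nV].
      have [U' [vU' BU' UP' eX']] := CF X0 CX0; apply: UP'; last by left.
      exact: subring0.
    have [X CX Xb] : M b.
      by apply: NNPP => nM; apply: nV; right; rewrite invrK.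
    have [U [vU _ UP eX]] := CF X CX; rewrite eX in Xb; exact: UP.
  + apply: boolp.funext => x; apply: boolp.propext; split.
      case=> X CX Xx; have [x0|x0] := eqVneq x 0; [by left|right=> -[/eqP|]].
        by rewrite invr_eq0 (negPf x0).
      by rewrite invrK; apply; exists X.
    case=> [->|nV]; last by apply: NNPP => nM; apply: nV; right; rewrite invrK.
    by exists X0 => //; have [U [_ _ _ ->]] := CF X0 CX0; left.
exists W; rewrite eM in W0M Mmax; split=> // v Wv U gU.
have [vU WU BU UB] := gU.
have UW : subset (maxid U) (maxid W).
  by apply: Mmax => //; exists U; split=> // b Bb mb; apply: WP => //; apply: UB.
exact: (maxid_anti vU vW UW).
Qed.

End MinimalValuation.

(** * A prime that meets a closed subfield in zero *)

Section Density.
Variable L : fieldType.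
Implicit Types (A B C E K R S P U V W : set L).

(** In terms of values, [a] is a point of [s] nearest to [z]. *)
Lemma max_val W (s : seq L) (z : L) : val_ring W -> (forall a, a \in s -> z - a != 0) ->
  s != [::] -> exists2 a, a \in s & forall b, b \in s -> W ((z - a) / (z - b)).
Proof.
move=> [sW vW]; elim: s => // a s IHs Hs _.
have za : z - a != 0 by apply: Hs; rewrite inE eqxx.
have Waa : W ((z - a) / (z - a)) by rewrite divff //; apply: subring1.
have [->|s0] := eqVneq s [::].
  by exists a => [|b]; rewrite inE // => /eqP ->.
have [|//|c cs Wc] := IHs; first by move=> b bs; apply: Hs; rewrite inE bs orbT.
have zc : z - c != 0 by apply: Hs; rewrite inE cs orbT.
have [W1|W2] : W ((z - a) / (z - c)) \/ W ((z - c) / (z - a)).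
  by rewrite -[(z - c) / _]invf_div; apply: vW; rewrite mulf_neq0 ?invr_eq0.
  exists a => [|b]; rewrite inE ?eqxx // => /predU1P [->|bs] //.
  rewrite (_ : _ / _ = (z - a) / (z - c) * ((z - c) / (z - b))); last by rewrite mulrA divfK.
  by apply: subringM => //; apply: Wc.
exists c => [|b]; rewrite inE ?cs ?orbT // => /predU1P [->|bs] //.
exact: Wc.
Qed.

Lemma collect (T : eqType) (xs : seq T) (G : L -> Prop) (Q : seq L -> T -> Prop) :
  (forall (S S' : seq L) x, {subset S <= S'} -> Q S x -> Q S' x) ->
  (forall x, x \in xs -> exists2 S : seq L, (forall a, a \in S -> G a) & Q S x) ->
  exists2 S : seq L, (forall a, a \in S -> G a) & forall x, x \in xs -> Q S x.
Proof.
move=> mono; elim: xs => [_|x xs IHxs Hx]; first by exists [::].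
have [|S GS QS] := IHxs; first by move=> y yx; apply: Hx; rewrite inE yx orbT.
have [S' GS' QS'] := Hx x (mem_head _ _).
exists (S' ++ S); first by move=> a; rewrite mem_cat => /orP [/GS'|/GS].
move=> y; rewrite inE => /predU1P [->|/QS].
  by apply: mono QS' => a aS; rewrite mem_cat aS.
by apply: mono => a aS; rewrite mem_cat aS orbT.
Qed.

(** With [s] a common denominator of the coefficients, [s^n f(X / s)] is a monic equation of [s x]
    over [O]. *)
Lemma integral_loc O S x : subring O -> mult_set O S ->
  (exists f, [/\ f \is monic, coefs_in (loc O S) f & f.[x] = 0]) ->
  exists2 s, S s & forall U', val_ring U' -> subset O U' -> U' (s * x).
Proof.
move=> sO mS [f [mf Lf fx]]; have [s Ss Osf] := loc_common_denom sO mS (ideal_self sO) Lf.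
have [_ _ SO _] := mS.
exists s => // U' vU' OU'; have [sU' _] := vU'; pose n := (size f).-1.
have f_gt0 : (0 < size f)%N by rewrite size_poly_gt0 monic_neq0.
pose G := \poly_(i < n.+1) (f`_i * s ^+ (n - i)).
have fn : f`_n = 1 by rewrite -(monicP mf) lead_coefE.
have sG : size G = n.+1 by rewrite size_poly_eq // subnn mulr1 fn oner_neq0.
apply: (@val_root _ U' G) => //.
- apply: coefs_poly; first exact: subring0.
  move=> i; rewrite ltnS leq_eqVlt => /predU1P [->|lt].
    by rewrite subnn mulr1 fn; apply: subring1.
  rewrite -subn_gt0 in lt; case: (n - i)%N lt => // k _.
  rewrite exprS mulrA [_ * s]mulrC; apply: subringM => //.
    by apply: OU'; have := Osf i; rewrite coefZ.
  by apply: subringX => //; apply/OU'/SO.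
- by rewrite lead_coefE sG coef_poly ltnSn subnn mulr1 fn; apply: maxid1.
left; transitivity (s ^+ n * f.[x]); last by rewrite fx mulr0.
have sfn : (size f <= n.+1)%N by rewrite prednK.
rewrite horner_poly (horner_coef_wide _ sfn) mulr_sumr.
apply: eq_bigr => i _; have le : (i <= n)%N by rewrite -ltnS.
have -> : s ^+ n = s ^+ (n - i) * s ^+ i by rewrite -exprD subnK.
by rewrite exprMn [f`_i * _]mulrC mulrACA.
Qed.

(** Each generator has an equation over [K[z]] with split coefficients, and every factor [z - b] is
    a monomial in [y = z - a] up to a captured unit, for [a] nearest to [z]. So one [r] puts [A]
    into a localization [R] of the integral closure of [V1[r]], and [q] is the trace of a prime of
    [R] containing [r]. *)
Theorem prime_density A B P K (xs : seq L) (z : L) :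
  subring A -> subring B -> subset B A -> prime_in A P ->
  (forall x, x \in xs -> A x) ->
  (forall R, subring R -> subset B R -> (forall x, x \in xs -> R x) -> subset A R) ->
  (forall x, x \in xs -> exists f, [/\ coefs_in B f, ~ coefs_in P f & P f.[x]]) ->
  closed_field K -> subset B K -> ~ K z -> A z ->
  (exists p, [/\ P p, K p & p != 0]) ->
  (forall x, x \in xs -> exists2 F : {poly {poly L}}, F != 0 &
     [/\ forall i j, K F`_i`_j, (map_poly (fun p => p.[z]) F).[x] = 0 &
         forall i, F`_i != 0 -> exists c rs, F`_i = c *: \prod_(a <- rs) ('X - a%:P)]) ->
  (forall v, alg A v) ->
  exists q, [/\ prime_in A q, subset q P, exists2 x, q x & x != 0 &
    forall x, q x -> K x -> x = 0].
Proof.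
move=> sA sB BA pP Axs gen res cK BK nKz Az [p0 [Pp0 Kp0 nzp0]] rel algA.
have [fK _] := cK; have [sK KV] := fK; have iP := pP.1.
have [|W1 [vW1 AW1 PW1 SW1]] := chevalley sA iP (compl_mult sA pP); first by move=> s [].
have M1 a : A a -> maxid W1 a -> P a.
  by move=> Aa ma; apply: NNPP => nPa; apply: (SW1 a).
have BW1 : subset B W1 by move=> b /BA /AW1.
(* [W1] has center [P] on [A]. The smaller [W] is residually algebraic over [B] throughout; as [A]
   is so already inside [W1], it stays in [W] with the same center. *)
have [|W [vW W1W BW WP resW]] := @minimal_valuation L W1 B P vW1 sB BW1.
  by move=> b /BA Ab; apply: M1.
have [sW _] := vW; have iM := maxid_ideal vW; have M0 := ideal0 iM.
have gW : same_center W1 B W.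
  by split=> // b Bb mb; apply: PW1; apply: WP.
have rxs x : x \in xs -> ralg W1 B x.
  move=> xx; have [f [Bf nf Pf]] := res x xx.
  apply/ralgP => //; first exact/AW1/Axs.
  exists f; split=> //; last exact: PW1.
  by move=> mf; apply: nf => i; apply: M1 => //; apply: BA.
have rA : subset A (ralg W1 B).
  by apply: gen => //; [apply: ralg_subring|apply: ralg_base].
have AW : subset A W by move=> a /rA; apply.
have PW a : A a -> maxid W a -> P a.
  move=> Aa ma; apply: NNPP => nPa.
  have Wa := AW1 a Aa; apply: (@ralg_eq_unit _ W1 B W a) => //.
    by apply/ralgP => //; apply: rA.
  exact: SW1.
have WPs a : P a -> maxid W a by move=> Pa; apply/W1W/PW1.
pose split (S : seq L) (p : {poly L}) := p != 0 -> exists (c : L) (rs : seq L),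
  [/\ K c, c != 0, {subset rs <= S} & p = c *: \prod_(a <- rs) ('X - a%:P)].
have split_mono (S S' : seq L) p : {subset S <= S'} -> split S p -> split S' p.
  move=> SS' sp /sp [c [rs [Kc c0 rsS ->]]]; exists c, rs; split=> // a /rsS.
  exact: SS'.
pose rel' (S : seq L) x := exists2 F : {poly {poly L}}, F != 0 &
  [/\ forall i, coefs_in K F`_i, (map_poly (fun p => p.[z]) F).[x] = 0 &
      forall i, split S F`_i].
have [S KS relS] : exists2 S : seq L, (forall a, a \in S -> K a) &
    forall x, x \in xs -> rel' S x.
  apply: collect => [S S' x SS' [F F0 [KF Fx sF]]|x xx].
    by exists F => //; split=> // i; apply: split_mono (sF i).
  have [F F0 [KF Fx sF]] := rel x xx.
  have [S KS sS] : exists2 S : seq L, (forall a, a \in S -> K a) &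
      forall i, i \in iota 0 (size F) -> split S F`_i.
    apply: collect => [S S' i|i _]; first exact: split_mono.
    have [Fi|Fi] := eqVneq F`_i 0; first by exists [::] => // /eqP; rewrite Fi.
    have [c [rs e]] := sF i Fi.
    have c0 : c != 0 by apply: contra_neq Fi => c0; rewrite e c0 scale0r.
    exists rs => [a ars|_].
      case: cK => _; apply; exists F`_i; split=> //.
      apply/eqP; rewrite e hornerZ mulf_eq0; apply/orP; right.
      by rewrite -/(root _ a) root_prod_XsubC.
    exists c, rs; split=> //.
    have -> : c = lead_coef F`_i.
      by rewrite e lead_coefZ lead_coef_prod_XsubC mulr1.
    by rewrite lead_coefE.
  exists S => //; exists F => //; split=> // i.
  case: (ltnP i (size F)) => [lt|le]; first by apply: sS; rewrite mem_iota.
  by rewrite nth_default // => /eqP.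
have zS a : a \in 0 :: S -> z - a != 0.
  rewrite inE subr_eq0 => aS; apply/eqP => e; apply: nKz; rewrite e.
  by case/predU1P: aS => [->|/KS //]; apply: subring0.
(* Including [0] among the candidates keeps [y = z - a] in [W]. *)
have [a aS Wa] := max_val vW zS isT.
have Ka : K a by move: aS; rewrite inE => /predU1P [->|/KS //]; apply: subring0.
have Wz : W z by apply: AW.
pose y := z - a.
have z0 : z != 0 by apply/eqP => e; apply: nKz; rewrite e; apply: subring0.
have Wy : W y.
  have := Wa 0 (mem_head _ _); rewrite subr0 => /(subringM sW)/(_ Wz).
  by rewrite divfK.
have nKy : ~ K y by move=> Ky; apply: nKz; rewrite -(subrK a z); apply: subringD.
have mono_root b : b \in S -> mono_unit W K y (z - b).
  move=> bS; rewrite (_ : z - b = y - (b - a)); last by rewrite /y opprB addrA subrK.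
  apply: mono_unit_sub => //; first by apply: subringB => //; apply: KS.
  by rewrite /y opprB addrA subrK; apply: Wa; rewrite inE bS orbT.
have mono_split p : coefs_in K p -> p != 0 -> split S p -> mono_unit W K y p.[z].
  move=> Kp nzp /(_ nzp) [c [rs [Kc c0 rsS ->]]]; rewrite hornerZ.
  apply: mono_unitM => //; first exact: mono_unit_const.
  elim: rs rsS => [_|b rs IHrs rsS].
    by rewrite big_nil hornerC; apply: mono_unit_const;
       [exact: (subring1 sK)|exact: oner_neq0].
  rewrite big_cons hornerM hornerXsubC; apply: mono_unitM => //.
    by apply/mono_root/rsS/mem_head.
  by apply: IHrs => d drs; apply: rsS; rewrite inE drs orbT.
have cap x : x \in xs -> captured W K y x.
  move=> xx; have [F F0 [KF Fx sF]] := relS x xx.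
  have h0 : (fun p : {poly L} => p.[z]) 0 = 0 by rewrite horner0.
  have cF i : (map_poly (fun p => p.[z]) F)`_i = (F`_i).[z] by rewrite coef_map_id0.
  have nz i : F`_i != 0 -> (F`_i).[z] != 0.
    by apply: contra_neq => /(transc_poly0 cK nKz (KF i)).
  apply: captured_root Fx _ => //; first exact/AW/Axs.
    apply: contraNneq F0 => e; apply/eqP/polyP => i; rewrite coef0; apply/eqP.
    by apply: contraT => /nz; rewrite -cF e coef0 eqxx.
  move=> i; rewrite cF => Fi; apply: mono_split => //.
  by apply: contraNneq Fi => ->; rewrite horner0.
have [t tm tR] := captured_seq cap.
have [r [nKr mr Rr]] := local_parameter vW cK sB BK BW resW nKy Wy tm.
pose O := icl K r W; pose S' : set L := fun s => O s /\ ~ maxid W s.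
have sV : subring (inter W K) by apply: subfield_inter.
have sO : subring O.
  split; first by move=> U [sU _] _ _; apply: subring0.
  split; first by move=> U [sU _] _ _; apply: subring1.
  split=> u v Ou Ov U vU VU Ur; have Uu := Ou U vU VU Ur; have Uv := Ov U vU VU Ur.
    exact: (subringB vU.1).
  exact: (subringM vU.1).
have Wr := maxidS vW mr.
have OW : subset O W by move=> u; apply=> // v [].
have mS' : mult_set O S'.
  split; first by split; [exact: (subring1 sO)|exact: maxid1].
  - by case=> _; apply.
  - by move=> s [].
  move=> u v [Ou nu] [Ov nv]; split; first exact: (subringM sO).
  by case/(prime_mul (maxid_prime vW) (OW _ Ou) (OW _ Ov)).
pose R := loc O S'; have sR : subring R by apply: loc_subring.
have RW : subset R W.
  move=> _ [u [s [Ou [Os ns] ->]]]; apply: (subringM sW); first exact: OW.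
  exact: not_maxid.
have OR : subset O R by move=> u; apply: loc_base mS'.
have lR : local_closed W R.
  split=> //.
    move=> _ [u [s [Ou [Os ns] ->]]] nus; rewrite invf_div; exists s, u; split=> //.
    split=> // mu; apply: nus; apply: (idealMr iM) => //; exact: not_maxid.
  move=> u Ru; have int := integral_val sR Ru.
  have [s Ss sU] := integral_loc sO mS' int.
  exists (s * u), s; split=> //; last by rewrite mulrAC mulfV ?mul1r // (mult_neq0 mS').
  move=> U vU VU Ur; apply: sU => // v; exact.
have VO : subset (inter W K) O by move=> v Vv U vU VU Ur; apply: VU.
have VR : subset (inter W K) R by move=> v /VO /OR.
have Or : O r by move=> U.
have Rxs := tR R lR VR (Rr R lR VR (OR _ Or)).
have AR : subset A R by apply: gen => // b Bb; apply: VR; split; [apply: BK|apply: BW].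
(* A prime avoiding [T] meets [K] only in [0] and stays inside the center of [W]. *)
pose T : set L := fun t => exists v s, [/\ inter W K v, v != 0, R s, ~ maxid W s & t = v * s].
have mT : mult_set R T.
  split.
  - exists 1, 1; rewrite mulr1; split=> //; [exact: subring1|exact: oner_neq0| |].
      exact: subring1.
    exact: maxid1.
  - case=> v [s [_ v0 _ ns /esym/eqP]]; rewrite mulf_eq0 (negPf v0) /=.
    by rewrite (negPf (not_maxid0 ns)).
  - by move=> _ [v [s [Vv v0 Rs ns ->]]]; apply: subringM => //; apply: VR.
  move=> _ _ [v [s [Vv v0 Rs ns ->]]] [v' [s' [Vv' v0' Rs' ns' ->]]].
  exists (v * v'), (s * s'); rewrite mulrACA; split=> //.
  - exact: subringM.
  - exact: mulf_neq0.
  - exact: subringM.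
  by case/(prime_mul (maxid_prime vW) (RW _ Rs) (RW _ Rs')).
pose J : set L := fun u => exists2 x, R x & u = r * x.
have iJ : ideal_in R J.
  split; first by move=> _ [x Rx ->]; apply: subringM => //; apply: OR.
  split; first by exists 0; [apply: subring0|rewrite mulr0].
  split=> [_ _ [u Ru ->] [v Rv ->]|u _ Ru [v Rv ->]].
    by exists (u - v); [apply: subringB|rewrite mulrBr].
  by exists (u * v); [apply: subringM|rewrite mulrCA].
have [|U [vU RU JU TU]] := chevalley sR iJ mT.
  move=> _ [v [_ [[Kv Wv] v0 [o1 [s1 [Oo1 [Os1 ns1] ->]]] no ->]]] [_ [o2 [s2 [Oo2 [Os2 ns2] ->]]] e].
  (* Cleared of denominators, a common element of [J] and [T] gives the equation of [going_down]
     with [s = o1 * s2], a unit of [W]. *)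
  have e' : v * (o1 * s2) = r * (o2 * s1).
    have s10 := not_maxid0 ns1; have s20 := not_maxid0 ns2.
    have -> : v * (o1 * s2) = (v * (o1 / s1)) * (s1 * s2) by field.
    by rewrite e; field.
  have m12 : maxid W (o1 * s2).
    by apply: (going_down cK nKr vW mr Kv Wv v0 _ _ e'); apply: (subringM sO).
  case: (prime_mul (maxid_prime vW) (OW _ Oo1) (OW _ Os2) m12) => // m1.
  by apply: no; apply: (idealMr iM) => //; apply: not_maxid.
have iMU := maxid_ideal vU; have AU a' : A a' -> U a' by move=> /AR /RU.
have V1_ : inter W K 1 by split; apply: subring1.
exists (fun x => A x /\ maxid U x); split.
- split.
    split; first by move=> x [].
    split; first by split; [apply: subring0|left].
    split=> [u v [Au mu] [Av mv]|u v Au [Av mv]].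
      by split; [apply: subringB|apply: (idealB iMU)].
    by split; [apply: subringM|apply: (idealM iMU) => //; apply: AU].
  split; first by case=> _; apply: (maxid1 vU.1).
  move=> u v Au Av [_ /(prime_mul (maxid_prime vU) (AU _ Au) (AU _ Av))] [m|m];
    by [left|right].
- move=> x [Ax mx]; apply: NNPP => nPx; apply: (TU x) => //.
  exists 1, x; rewrite mul1r; split=> //; first exact: oner_neq0.
    exact: AR.
  by move/(PW x Ax).
(* After cancelling powers of [r], the constant term of an equation of [r] over [A] is nonzero and
   lies in [maxid U] because [r] does. *)
- have [f [f0 Af fr]] := algA r.
  have r0 : r != 0 by apply/eqP => e; apply: nKr; rewrite e; apply: subring0.
  have nz : ~ coefs_in (@zeroS L) f.
    by move=> zf; case/eqP: f0; apply/polyP => i; rewrite coef0; apply: zf.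
  have [n [g [h [ef zh ng gf]]]] := split_low (erefl : @zeroS L 0) nz.
  have h0 : h = 0 by apply/polyP => i; rewrite coef0; apply: zh.
  have gr : g.[r] = 0.
    move/eqP: fr; rewrite ef h0 add0r !hornerE mulf_eq0 expf_eq0 (negPf r0) andbF orbF.
    by move/eqP.
  exists g`_0; last by apply/eqP.
  split; first by rewrite gf; apply: Af.
  have mUr : maxid U r by apply: JU; exists 1; [apply: subring1|rewrite mulr1].
  have Ug : coefs_in U g by move=> i; rewrite gf; apply: AU.
  have := horner_mod vU.1 iMU Ug mUr; rewrite gr sub0r => m.
  by rewrite -[g`_0]opprK; apply: (idealN iMU).
move=> x [Ax mx] Kx; apply/eqP; apply: contraT => x0; exfalso.
apply: (TU x) => //; exists x, 1; rewrite mulr1; split=> //.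
- by split=> //; apply: AW.
- exact: subring1.
exact: maxid1.
Qed.

End Density.

(** * The residue field of a prime *)

Section ResidueField.
Variable B : comNzRingType.

(** Bundling ring, prime and proofs gives [residue_field] a single parameter over which its
    algebraic structures are declared. *)
Record prime_pair := PrimePair {
  pp_ring : set B; pp_ideal : set B;
  pp_sub : subring pp_ring; pp_prime : prime_in pp_ring pp_ideal }.

Variable X : prime_pair.
Local Notation S := (pp_ring X).
Local Notation P := (pp_ideal X).
Let sS := pp_sub X.
Let pP := pp_prime X.
Let iP := pP.1.

Definition pp_frac (a b : B) := [/\ S a, S b & ~ P b].

Definition pp_class (a b : B) : B * B -> Prop :=
  fun u => pp_frac u.1 u.2 /\ P (a * u.2 - u.1 * b).

(* A fraction of [S / P] is encoded as the set of its representatives. *)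
Definition residue_field : Type :=
  {c : B * B -> Prop | exists a b, pp_frac a b /\ c = pp_class a b}.

HB.instance Definition _ := boolp.gen_eqMixin residue_field.
HB.instance Definition _ := boolp.gen_choiceMixin residue_field.

Let P0 : P 0 := ideal0 iP.
Let nP1 : ~ P 1. Proof. by case: pP => _ []. Qed.

Let frac01 : pp_frac 0 1.
Proof. by split=> //; [apply: subring0|apply: subring1]. Qed.

(** A total function: a pair that is not a fraction gets the class of [0 / 1]. *)
Definition frc (a b : B) : residue_field :=
  match excluded_middle_informative (pp_frac a b) with
  | left h => exist _ (pp_class a b) (ex_intro _ a (ex_intro _ b (conj h erefl)))
  | right _ => exist _ (pp_class 0 1) (ex_intro _ 0 (ex_intro _ 1 (conj frac01 erefl)))
  end.

Lemma frcE a b : pp_frac a b -> sval (frc a b) = pp_class a b.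
Proof. by rewrite /frc; case: excluded_middle_informative. Qed.

Lemma pp_fracM a b c d : pp_frac a b -> pp_frac c d -> pp_frac (a * c) (b * d).
Proof.
move=> [Sa Sb nb] [Sc Sd nd]; split; [exact: subringM|exact: subringM|].
by case/(prime_mul pP Sb Sd).
Qed.

Lemma pp_fracD a b c d : pp_frac a b -> pp_frac c d -> pp_frac (a * d + c * b) (b * d).
Proof.
move=> fab fcd; have [_ Sbd nbd] := pp_fracM fab fcd.
have [Sa Sb _] := fab; have [Sc Sd _] := fcd.
by split=> //; apply: subringD => //; apply: subringM.
Qed.

Lemma pp_cancel x y : S x -> S y -> ~ P y -> P (y * x) -> P x.
Proof. by move=> Sx Sy ny /(prime_mul pP Sy Sx) []. Qed.

Lemma frc_eq a b c d : pp_frac a b -> pp_frac c d ->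
  frc a b = frc c d <-> P (a * d - c * b).
Proof.
move=> fab fcd; have [Sa Sb nb] := fab; have [Sc Sd nd] := fcd; split=> [e|Pe].
  have : sval (frc a b) (c, d).
    by rewrite e frcE //; split=> //=; rewrite subrr.
  by rewrite frcE // => -[].
suff e : pp_class a b = pp_class c d.
  have := frcE fab; have := frcE fcd; rewrite e.
  case: (frc a b) (frc c d) => [x hx] [y hy] /= ey ex.
  by move: hx hy; rewrite ex ey => hx hy; congr exist; apply: boolp.Prop_irrelevance.
apply: boolp.funext => -[u v]; apply: boolp.propext; split=> -[[/= Su Sv nv] Pu];
  split=> //=.
  apply: (pp_cancel (y := b)) => //.
    by apply: subringB => //; apply: subringM.
  rewrite (_ : _ * _ = d * (a * v - u * b) - v * (a * d - c * b)); last by ring.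
  by apply: (idealB iP); apply: (idealM iP).
apply: (pp_cancel (y := d)) => //.
  by apply: subringB => //; apply: subringM.
rewrite (_ : _ * _ = b * (c * v - u * d) + v * (a * d - c * b)); last by ring.
by apply: (idealD iP); apply: (idealM iP).
Qed.

Lemma frc_eq0 a b c d : pp_frac a b -> pp_frac c d -> a * d = c * b -> frc a b = frc c d.
Proof. by move=> fab fcd e; apply/frc_eq => //; rewrite e subrr. Qed.

Lemma frcP (q : residue_field) : exists u : B * B, pp_frac u.1 u.2 /\ q = frc u.1 u.2.
Proof.
case: q => c hc; have [a [b [fab ec]]] := hc; exists (a, b); split=> //=.
have := frcE fab; case: (frc a b) => y hy /= ey.
by move: hc hy; rewrite ec ey => hc hy; congr exist; apply: boolp.Prop_irrelevance.
Qed.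

Definition rep q := sval (constructive_indefinite_description _ (frcP q)).

Lemma repP q : pp_frac (rep q).1 (rep q).2 /\ q = frc (rep q).1 (rep q).2.
Proof. exact: (svalP (constructive_indefinite_description _ (frcP q))). Qed.

Definition rf_add q r := frc ((rep q).1 * (rep r).2 + (rep r).1 * (rep q).2)
                             ((rep q).2 * (rep r).2).
Definition rf_mul q r := frc ((rep q).1 * (rep r).1) ((rep q).2 * (rep r).2).
Definition rf_opp q := frc (- (rep q).1) (rep q).2.
Definition rf_inv q :=
  if boolp.asbool (P (rep q).1) then q else frc (rep q).2 (rep q).1.

Lemma pp_fracN a b : pp_frac a b -> pp_frac (- a) b.
Proof. by case=> Sa Sb nb; split=> //; apply: subringN. Qed.

Let rel a b : pp_frac a b -> exists c d, [/\ pp_frac c d, rep (frc a b) = (c, d) &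
  P (a * d - c * b)].
Proof.
move=> fab; have [fr e] := repP (frc a b).
case er : (rep (frc a b)) fr e => [c d] /= fr e; exists c, d; split=> //.
by apply/frc_eq.
Qed.

Lemma rf_addE a b c d : pp_frac a b -> pp_frac c d ->
  rf_add (frc a b) (frc c d) = frc (a * d + c * b) (b * d).
Proof.
move=> fab fcd; rewrite /rf_add.
have [a' [b' [fab' -> Pab]]] := rel fab; have [c' [d' [fcd' -> Pcd]]] := rel fcd.
have [_ Sb _] := fab; have [_ Sb' _] := fab'.
have [_ Sd _] := fcd; have [_ Sd' _] := fcd'.
apply/frc_eq; [exact: pp_fracD|exact: pp_fracD|] => /=.
rewrite (_ : _ - _ = - (d' * d * (a * b' - a' * b)) - b * b' * (c * d' - c' * d)); last by ring.
apply: (idealB iP); last by apply: (idealM iP) => //; apply: subringM.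
by apply: (idealN iP); apply: (idealM iP) => //; apply: subringM.
Qed.

Lemma rf_mulE a b c d : pp_frac a b -> pp_frac c d ->
  rf_mul (frc a b) (frc c d) = frc (a * c) (b * d).
Proof.
move=> fab fcd; rewrite /rf_mul.
have [a' [b' [fab' -> Pab]]] := rel fab; have [c' [d' [fcd' -> Pcd]]] := rel fcd.
have [Sa Sb _] := fab; have [Sa' Sb' _] := fab'.
have [Sc Sd _] := fcd; have [Sc' Sd' _] := fcd'.
apply/frc_eq; [exact: pp_fracM|exact: pp_fracM|] => /=.
rewrite (_ : _ - _ = - (c' * d * (a * b' - a' * b)) - a * b' * (c * d' - c' * d)); last by ring.
apply: (idealB iP); last by apply: (idealM iP) => //; apply: subringM.
by apply: (idealN iP); apply: (idealM iP) => //; apply: subringM.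
Qed.

Lemma rf_oppE a b : pp_frac a b -> rf_opp (frc a b) = frc (- a) b.
Proof.
move=> fab; rewrite /rf_opp; have [a' [b' [fab' -> Pab]]] := rel fab.
apply/frc_eq; [exact: pp_fracN|exact: pp_fracN|] => /=.
by rewrite (_ : _ - _ = a * b' - a' * b); last by ring.
Qed.

Let ind (Q : residue_field -> Prop) : (forall a b, pp_frac a b -> Q (frc a b)) -> forall q, Q q.
Proof. by move=> h q; have [[a b] [fab ->]] := frcP q; apply: h. Qed.

Let frac11 : pp_frac 1 1. Proof. by split=> //; apply: subring1. Qed.

Lemma rf_addA : associative rf_add.
Proof.
elim/ind => a b fab; elim/ind => c d fcd; elim/ind => e f fef.
rewrite !rf_addE //; try exact: pp_fracD.
by congr frc; ring.
Qed.

Lemma rf_addC : commutative rf_add.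
Proof.
by elim/ind => a b fab; elim/ind => c d fcd; rewrite !rf_addE //; congr frc; ring.
Qed.

Lemma rf_add0 : left_id (frc 0 1) rf_add.
Proof. by elim/ind => a b fab; rewrite rf_addE //; congr frc; ring. Qed.

Lemma rf_addN : left_inverse (frc 0 1) rf_opp rf_add.
Proof.
elim/ind => a b fab; rewrite rf_oppE // rf_addE //; last exact: pp_fracN.
apply: frc_eq0 => //; last by ring.
by apply: pp_fracD => //; apply: pp_fracN.
Qed.

HB.instance Definition _ := GRing.isZmodule.Build residue_field
  rf_addA rf_addC rf_add0 rf_addN.

Lemma rf_mulA : associative rf_mul.
Proof.
elim/ind => a b fab; elim/ind => c d fcd; elim/ind => e f fef.
by rewrite !rf_mulE //; try exact: pp_fracM; congr frc; ring.
Qed.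

Lemma rf_mulC : commutative rf_mul.
Proof.
by elim/ind => a b fab; elim/ind => c d fcd; rewrite !rf_mulE //; congr frc; ring.
Qed.

Lemma rf_mul1 : left_id (frc 1 1) rf_mul.
Proof. by elim/ind => a b fab; rewrite rf_mulE //; congr frc; ring. Qed.

Lemma rf_mulD : left_distributive rf_mul rf_add.
Proof.
elim/ind => a b fab; elim/ind => c d fcd; elim/ind => e f fef.
rewrite rf_addE // !rf_mulE //; last exact: pp_fracD.
rewrite rf_addE; try exact: pp_fracM.
apply: frc_eq0; last by ring.
  by apply: pp_fracM => //; apply: pp_fracD.
by apply: pp_fracD; apply: pp_fracM.
Qed.

Lemma rf_one_neq0 : frc 1 1 != 0 :> residue_field.
Proof.
apply/eqP => e; have := proj1 (frc_eq frac11 frac01) e.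
by rewrite mulr1 mul0r subr0; apply: nP1.
Qed.

HB.instance Definition _ := GRing.Zmodule_isComNzRing.Build residue_field
  rf_mulA rf_mulC rf_mul1 rf_mulD rf_one_neq0.

Lemma frc0P a b : pp_frac a b -> frc a b = 0 <-> P a.
Proof.
by move=> fab; rewrite (frc_eq fab frac01) mulr1 mul0r subr0.
Qed.

Lemma rf_mulV (q : residue_field) : q != 0 -> rf_inv q * q = 1.
Proof.
move=> q0; have [fr e] := repP q; rewrite /rf_inv; case: boolp.asboolP => [Pa|nPa].
  by case/eqP: q0; rewrite e; apply/frc0P.
have [Sa Sb nb] := fr; rewrite [X in _ * X]e; apply: etrans (rf_mulE _ fr) _; first by split.
apply: frc_eq0 => //; last by rewrite mulr1 mul1r mulrC.
by apply: pp_fracM; split.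
Qed.

Lemma rf_inv0 : rf_inv (0 : residue_field) = 0.
Proof.
have [fr e] := repP 0; rewrite /rf_inv; case: boolp.asboolP => // nPa.
by case: nPa; apply/(frc0P fr).
Qed.

HB.instance Definition _ := GRing.ComNzRing_isField.Build residue_field rf_mulV rf_inv0.

Definition residue (a : B) : residue_field := frc a 1.

Let fS a : S a -> pp_frac a 1.
Proof. by move=> Sa; split=> //; apply: subring1. Qed.

Lemma residueB a b : S a -> S b -> residue (a - b) = residue a - residue b.
Proof.
move=> Sa Sb; rewrite /residue.
have -> : - frc b 1 = frc (- b) 1 :> residue_field by apply: rf_oppE; apply: fS.
symmetry; apply: etrans (rf_addE _ _) _; [exact: fS|by apply/pp_fracN/fS|].
by congr frc; ring.
Qed.

Lemma residueM a b : S a -> S b -> residue (a * b) = residue a * residue b.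
Proof.
move=> Sa Sb; rewrite /residue; symmetry; apply: etrans (rf_mulE _ _) _; try exact: fS.
by rewrite mulr1.
Qed.

Lemma residue1 : residue 1 = 1. Proof. by []. Qed.

Lemma residue_eq0 a : S a -> residue a = 0 <-> P a.
Proof. by move=> Sa; apply: frc0P; apply: fS. Qed.

Lemma residue_frac (q : residue_field) : exists a b, [/\ S a, S b & q = residue a / residue b].
Proof.
elim/ind: q => a b fab; have [Sa Sb nb] := fab; exists a, b; split=> //.
have nz : residue b != 0 by apply/eqP => /residue_eq0; auto.
apply: (mulIf nz); rewrite divfK //; apply: etrans (rf_mulE fab (fS Sb)) _.
by apply: frc_eq0; [apply: pp_fracM => //; apply: fS|apply: fS|ring].
Qed.

End ResidueField.

(** * Homomorphisms on a subring, splitting fields *)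

Definition hom_on (B C : comNzRingType) (S : set B) (phi : B -> C) :=
  [/\ phi 1 = 1, forall x y, S x -> S y -> phi (x - y) = phi x - phi y &
      forall x y, S x -> S y -> phi (x * y) = phi x * phi y].

(** Later arguments see the residue field only through this package, not through classes of
    fractions. *)
Lemma residue_field_hom (B : comNzRingType) (S P : set B) : subring S -> prime_in S P ->
  exists (F : fieldType) (phi : B -> F), [/\ hom_on S phi,
    forall a, S a -> phi a = 0 <-> P a &
    forall q, exists a b, [/\ S a, S b & q = phi a / phi b]].
Proof.
move=> sS pP; pose X := PrimePair sS pP.
exists (residue_field X), (@residue B X); split.
- split; [exact: residue1|exact: (@residueB _ X)|exact: (@residueM _ X)].
- exact: (@residue_eq0 _ X).
exact: (@residue_frac _ X).
Qed.

Definition range (X Y : Type) (f : X -> Y) : set Y := fun y => exists x, y = f x.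

Lemma rmorphism_of (F L : fieldType) (phi : F -> L) :
  hom_on (fun _ => True) phi -> exists i : {rmorphism F -> L}, forall x, i x = phi x.
Proof.
case=> phi1 phiB phiM.
have hB : zmod_morphism phi by move=> x y; apply: phiB.
have hM : monoid_morphism phi by split=> // x y; apply: phiM.
pose mB := GRing.isZmodMorphism.Build F L phi hB.
pose mM := GRing.isMonoidMorphism.Build F L phi hM.
pose i : {rmorphism F -> L} := HB.pack phi mB mM.
by exists i.
Qed.

Lemma range_subfield (F L : fieldType) (i : {rmorphism F -> L}) : subfield (range i).
Proof.
split; last by move=> _ [x ->]; exists x^-1; rewrite fmorphV.
split; first by exists 0; rewrite rmorph0.
split; first by exists 1; rewrite rmorph1.
by split=> _ _ [x ->] [y ->]; [exists (x - y)|exists (x * y)]; rewrite (rmorphB, rmorphM).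
Qed.

Lemma irreducible_prime (F : fieldType) (q : {poly F}) : (1 < size q)%N ->
  (forall d : {poly F}, (1 < size d)%N -> d %| q -> (size q <= size d)%N) ->
  prime_in (fun _ : {poly F} => True) (fun f => q %| f).
Proof.
move=> sq qmin; have q0 : q != 0 by rewrite -size_poly_gt0 ltnW.
split.
  split=> //; split; first exact: dvdp0.
  by split=> *; [apply: dvdp_sub|apply: dvdp_mull].
split; first by rewrite dvdp1; case: (size q) sq => [|[|]].
move=> a b _ _ qab; case: (leqP (size (gcdp q a)) 1) => [le|lt].
  have cop : coprimep q a.
    by rewrite coprimep_def eqn_leq le size_poly_gt0 gcdp_eq0 negb_and q0.
  by right; rewrite -(Gauss_dvdpr b cop).
left; apply: dvdp_trans _ (dvdp_gcdr q a).
have gq := dvdp_gcdl q a.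
have : size (gcdp q a) == size q by rewrite eqn_leq dvdp_leq //= qmin.
by rewrite dvdp_size_eqp // => /eqp_dvdr ->; apply: dvdpp.
Qed.

(** [L] is the residue field of [F[X]] at a nonconstant factor [q] of [p] of least degree, which is
    irreducible. *)
Lemma adjoin_root (F : fieldType) (p : {poly F}) : (1 < size p)%N ->
  exists (L : fieldType) (i : {rmorphism F -> L}),
    (exists z, root (map_poly i p) z) /\ forall v, alg (range i) v.
Proof.
move=> sp; pose Q n := boolp.asbool (exists d : {poly F}, [/\ (1 < size d)%N, d %| p & size d = n]).
have ex : exists n, Q n by exists (size p); apply/boolp.asboolP; exists p.
have [n /boolp.asboolP [q [sq qp en]] min] := ex_minnP ex.
have qmin (d : {poly F}) : (1 < size d)%N -> d %| q -> (size q <= size d)%N.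
  move=> sd dq; rewrite en; apply: min; apply/boolp.asboolP; exists d; split=> //.
  exact: dvdp_trans dq qp.
have sT : subring (fun _ : {poly F} => True) by do !split.
have [L [phi [[phi1 phiB phiM] phi0 phifrac]]] :=
  residue_field_hom sT (irreducible_prime sq qmin).
have [i ei] : exists i : {rmorphism F -> L}, forall x, i x = phi x%:P.
  apply: rmorphism_of; split=> [|x y _ _|x y _ _]; first exact: phi1.
    by rewrite -phiB // polyCB.
  by rewrite -phiM // polyCM.
have phi00 : phi 0 = 0 by apply/phi0 => //; apply: dvdp0.
have phiN x : phi (- x) = - phi x by rewrite -sub0r phiB // phi00 sub0r.
have phiD x y : phi (x + y) = phi x + phi y by rewrite -{1}[y]opprK phiB // phiN opprK.
have ephi f : phi f = (map_poly i f).[phi 'X].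
  elim/poly_ind: f => [|f c IHf]; first by rewrite rmorph0 horner0.
  by rewrite phiD phiM // IHf rmorphD rmorphM /= map_polyX map_polyC !hornerE /= ei.
exists L, i; split.
  exists (phi 'X); rewrite /root -ephi; apply/eqP/phi0 => //.
have fE := range_subfield i; have fA := alg_subfield fE.
have aX : alg (range i) (phi 'X).
  exists (map_poly i q); split.
  - by rewrite map_poly_eq0 -size_poly_gt0 ltnW.
  - by move=> k; exists q`_k; rewrite coef_map.
  by rewrite -ephi; apply/phi0 => //; apply: dvdpp.
have aphi f : alg (range i) (phi f).
  rewrite ephi; apply: coefs_horner_ring aX _; first by case: fA.
  by move=> k; rewrite coef_map; apply: alg_base; [case: fE|exists f`_k].
move=> v; have [a [b [_ _ ->]]] := phifrac v.
by apply: (subringM fA.1) => //; apply: (proj2 fA).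
Qed.

Lemma splitting_field (F : fieldType) (p : {poly F}) : p != 0 ->
  exists (L : fieldType) (i : {rmorphism F -> L}),
    (exists c rs, map_poly i p = c *: \prod_(a <- rs) ('X - a%:P)) /\
    forall v, alg (range i) v.
Proof.
have [n] := ubnP (size p); elim: n F p => // n IHn F p; rewrite ltnS => sp p0.
case: (leqP (size p) 1) => [le|lt].
  exists F, (GRing.RMorphism.clone F F idfun _); split.
    by exists p`_0, [::]; rewrite map_poly_id // big_nil alg_polyC {1}(size1_polyC le).
  by move=> v; apply: alg_base; [case: (range_subfield (GRing.RMorphism.clone F F idfun _))|exists v].
have [L1 [i1 [[z rz] a1]]] := adjoin_root lt.
have [p1 ep] := factor_theorem _ _ rz.
have mp0 : map_poly i1 p != 0 by rewrite map_poly_eq0.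
have p10 : p1 != 0 by apply: contraNneq mp0 => e; rewrite ep e mul0r.
have sp1 : (size p1 < n)%N.
  apply: leq_trans sp; rewrite -(size_map_poly i1 p) ep size_mul ?polyXsubC_eq0 //.
  by rewrite size_XsubC addn2.
have [L2 [i2 [[c [rs e2]] a2]]] := IHn L1 p1 sp1 p10.
have [i ei] : exists i : {rmorphism F -> L2}, forall x, i x = i2 (i1 x).
  apply: rmorphism_of; split=> [|x y _ _|x y _ _]; by rewrite ?rmorph1 ?rmorphB ?rmorphM.
exists L2, i; split.
  exists c, (i2 z :: rs).
  have -> : map_poly i p = map_poly i2 (map_poly i1 p).
    by apply/polyP => k; rewrite !coef_map /= ei.
  rewrite ep rmorphM /= e2 big_cons rmorphB /= map_polyX map_polyC /=.
  by rewrite -scalerAl mulrC.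
have fE := range_subfield i.
move=> v; apply: alg_idem => //; apply: alg_mono (a2 v) => _ [x ->].
have [f [f0 Rf fx]] := a1 x.
exists (map_poly i2 f); split.
- by rewrite map_poly_eq0.
- by move=> k; rewrite coef_map; have [w ->] := Rf k; exists w; rewrite ei.
by rewrite horner_map fx rmorph0.
Qed.

(** * Closed subfields with residually algebraic trace *)

Section ResidualClosure.
Variable L : fieldType.
Implicit Types (A B C E K R S T U V W : set L) (f g p : {poly L}).

Lemma inter_subring W E : val_ring W -> subfield E -> subring (inter W E).
Proof. by move=> vW fE; apply: subfield_inter. Qed.

(** Divided by its coefficient of least value, an equation over [E] becomes a residual one over the
    trace of [W] on [E]. *)
Lemma ralg_alg W B E v : val_ring W -> subring B -> subset B W -> subfield E ->
  (forall x, E x -> W x -> ralg W B x) -> alg E v -> W v -> ralg W B v.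
Proof.
move=> vW sB BW fE EB [f [f0 Ef fv]] Wv; have [i [fi Wf]] := max_coef vW f0.
have [sE EV] := fE; have sV := inter_subring vW fE.
apply: (@ralg_trans _ W B (inter W E)) => //; first by move=> x [Ex Wx]; apply: EB.
apply/ralgP => //; first by move=> x [].
exists ((f`_i)^-1 *: f); split.
- by move=> j; split=> //; rewrite coefZ; apply: subringM => //; apply: EV.
- by move/(_ i); rewrite coefZ mulVf //; apply: maxid1; case: vW.
by rewrite hornerZ fv mulr0; left.
Qed.

(** Write [u = a(w) / b(w)] and scale [a] and [b] by a common least value. Then [b(w) X - a(w)] is a
    residual equation of [u]: as [w] is residually transcendental, its two coefficients cannot both
    have zero residue. *)
Lemma ralg_adjoin W B E w : val_ring W -> subring B -> subset B W -> subfield E ->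
  (forall x, E x -> W x -> ralg W B x) -> W w -> ~ ralg W B w ->
  forall v, frac (adj E w) v -> W v -> ralg W (adj B w) v.
Proof.
move=> vW sB BW fE EB Ww nrw _ [_ [_ [[a Ea ->] [[b Eb ->] nb] ->]]] Wu.
have [sE EV] := fE; have sV := inter_subring vW fE; have [sW _] := vW.
have W0 := subring0 sW.
have VW : subset (inter W E) W by move=> x [].
have VB : subset (inter W E) (ralg W B) by move=> x [Ex Wx]; apply: EB.
have sB' := adj_subring w sB; have B'W : subset (adj B w) W by apply: adj_sub.
have transc g : coefs_in (inter W E) g -> maxid W g.[w] -> coefs_in (maxid W) g.
  move=> Vg mg; apply: NNPP => ng; apply: nrw.
  by apply: ralg_trans VB _ => //; apply/ralgP => //; exists g.
(* [p] lists the coefficients of [a], then those of [b], so that [max_coef] finds the least value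
   among both. *)
pose p := a + b * 'X^(size a).
have coef_a k : (k < size a)%N -> p`_k = a`_k.
  by move=> lt; rewrite coefD coefMXn lt addr0.
have coef_b k : p`_(k + size a) = b`_k.
  rewrite coefD coefMXn ltnNge leq_addl addnK nth_default ?add0r //.
  exact: leq_addl.
have p0 : p != 0.
  apply: contraNneq nb => e; suff -> : b = 0 by rewrite horner0.
  by apply/polyP => k; rewrite -coef_b e !coef0.
have [i [pi Wp]] := max_coef vW p0; have Ep : coefs_in E p.
  move=> k; case: (ltnP k (size a)) => [lt|le]; first by rewrite coef_a.
  by rewrite -(subnK le) coef_b.
set e := (p`_i)^-1; have Ee : E e by apply: EV.
have Va : coefs_in (inter W E) (e *: a).
  move=> k; split; first by rewrite coefZ; apply: subringM.
  case: (ltnP k (size a)) => [lt|le]; last by rewrite coefZ nth_default // mulr0.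
  by rewrite coefZ -coef_a // -coefZ.
have Vb : coefs_in (inter W E) (e *: b).
  by move=> k; split; [rewrite coefZ; apply: subringM|rewrite coefZ -coef_b -coefZ].
have sC' := adj_subring w sV.
have C'B' : subset (adj (inter W E) w) (ralg W (adj B w)).
  apply: adj_sub; first exact: ralg_subring.
    by move=> x /VB; apply: ralg_mono => // z Bz; apply: adj_base.
  by apply: ralg_base; apply: adj_gen.
apply: (ralg_trans vW sB' B'W C'B').
have C'W : subset (adj (inter W E) w) W by apply: adj_sub.
apply/ralgP => //; pose f := (e *: b).[w] *: 'X - ((e *: a).[w])%:P.
have cf k : f`_k = (e *: b).[w] * (k == 1%N)%:R - (if k == 0%N then (e *: a).[w] else 0).
  by rewrite coefB coefZ coefX coefC.
exists f; split.
- have Ca : adj (inter W E) w (e *: a).[w] by exists (e *: a).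
  have Cb : adj (inter W E) w (e *: b).[w] by exists (e *: b).
  move=> k; rewrite cf; apply: (subringB sC').
    by case: eqP => _; rewrite ?mulr1 ?mulr0 //; apply: subring0.
  by case: eqP => _ //; apply: subring0.
- move=> mf; have mb : coefs_in (maxid W) (e *: b).
    by apply: transc => //; have := mf 1%N; rewrite cf /= mulr1 subr0.
  have ma : coefs_in (maxid W) (e *: a).
    apply: transc => //; have := mf 0%N; rewrite cf /= mulr0 sub0r => m.
    by rewrite -[X in maxid W X]opprK; apply: (idealN (maxid_ideal vW)).
  apply: (maxid1 sW); rewrite -(mulVf pi) -/e.
  case: (ltnP i (size a)) => [lt|le].
    by have := ma i; rewrite coefZ -coef_a.
  by have := mb (i - size a)%N; rewrite coefZ -coef_b subnK.
left; rewrite hornerD hornerN hornerZ hornerX hornerC !hornerZ -mulrA [b.[w] * _]mulrC.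
by rewrite divfK // subrr.
Qed.

(** A residually transcendental generator is adjoined to the field and to the subring alike, and
    [ralg_adjoin] keeps the field residually algebraic over the subring. The other generators change
    nothing. *)
Lemma residual_closure W A E0 B0 (xs : seq L) : val_ring W -> subset A W ->
  subring A -> subring B0 -> subset B0 A -> closed_field E0 -> subset B0 E0 ->
  (forall v, E0 v -> W v -> ralg W B0 v) -> (forall x, x \in xs -> A x) ->
  exists E B, [/\ closed_field E, subring B, subset E0 E, subset B0 B & subset B A] /\
    [/\ subset B E, forall v, E v -> W v -> ralg W B v & forall x, x \in xs -> ralg W B x].
Proof.
move=> vW AW sA; elim: xs E0 B0 => [|x xs IHxs] E0 B0 sB0 BA cE0 BE0 EB0 Axs.
  by exists E0, B0; split; split.
have Ax : A x by apply: Axs; apply: mem_head.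
have BW : subset B0 W by move=> b /BA /AW.
have Axs' z : z \in xs -> A z by move=> zs; apply: Axs; rewrite inE zs orbT.
have [rx|nrx] := classic (ralg W B0 x).
  have [E [B [[cE sB E0E B0B BA'] [BE EB xsB]]]] := IHxs E0 B0 sB0 BA cE0 BE0 EB0 Axs'.
  exists E, B; split=> //; split=> // z; rewrite inE => /predU1P [->|/xsB //].
  by apply: ralg_mono rx => // b /BA' /AW.
have [fE0 _] := cE0; have [sE0 _] := fE0.
have sEx := adj_subring x sE0; have sBx := adj_subring x sB0.
have BxA : subset (adj B0 x) A by apply: adj_sub.
have BxW : subset (adj B0 x) W by move=> b /BxA /AW.
have [||||||E [B [[cE sB E0E B0B BA'] [BE EB xsB]]]] := IHxs (acl (adj E0 x)) (adj B0 x) => //.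
- exact: acl_closed.
- move=> b Bb; apply: acl_base => //; have [f Bf ->] := Bb.
  by exists f => // i; apply: BE0.
- move=> v av Wv; apply: ralg_alg (av) Wv => //; first exact: frac_subfield.
  by apply: ralg_adjoin => //; apply: AW.
exists E, B; split; [split=> //|split=> //].
- by move=> e Ee; apply: E0E; apply: acl_base => //; apply: adj_base.
- by move=> b Bb; apply: B0B; apply: adj_base.
move=> z; rewrite inE => /predU1P [->|/xsB //].
by apply: ralg_base; apply: B0B; apply: adj_gen.
Qed.

(** Generators are adjoined one at a time, with algebraic closure after each; [K] is the last proper
    stage and [z] the generator adjoined to it. *)
Lemma closed_tower E (xs : seq L) : closed_field E -> (exists v, ~ E v) ->
  (forall R, closed_field R -> subset E R -> (forall x, x \in xs -> R x) -> forall v, R v) ->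
  exists K z, [/\ closed_field K, subset E K, z \in xs, ~ K z & forall v, acl (adj K z) v].
Proof.
elim: xs E => [|x xs IHxs] E cE [v0 nv0] full.
  by case: nv0; apply: full.
have [fE _] := cE; have [sE _] := fE; have sEx := adj_subring x sE.
have cEx := acl_closed sEx.
have [all|nall] := classic (forall v, acl (adj E x) v).
  exists E, x; split=> //; first exact: mem_head.
  by move=> Ex; apply: nv0; apply: (acl_sub cE _ (all v0)); apply: adj_sub.
have EEx : subset E (acl (adj E x)).
  by move=> e Ee; apply: acl_base => //; apply: adj_base.
have [||K [z [cK EK zxs nKz fullz]]] := IHxs (acl (adj E x)) cEx.
- exact: not_all_ex_not.
- move=> R cR ER Rxs; apply: full => // [e /EEx /ER //|z].
  rewrite inE => /predU1P [->|/Rxs //]; apply: ER; apply: acl_base => //.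
  exact: adj_gen.
by exists K, z; split=> //; [move=> e /EEx /EK|rewrite inE zxs orbT].
Qed.

Lemma ralg_fracT W T P : val_ring W -> subring T -> subset T W ->
  (forall t, T t -> maxid W t -> P t) ->
  (forall u, frac T u -> exists f, [/\ coefs_in T f, ~ coefs_in P f & f.[u] = 0]) ->
  forall u, frac T u -> W u -> ralg W T u.
Proof.
move=> vW sT TW MP rel u /rel [f [Tf nf fu]] Wu; apply/ralgP => //.
by exists f; split=> //; [move=> mf; apply: nf => i; apply: MP|rewrite fu; left].
Qed.

(* The nonzero elements of [T] are units of [W], so a quotient of polynomials in [z1] is
   congruent to the quotient of their lowest coefficients. *)
Lemma ralg_frac_adj W T z1 : val_ring W -> subring T -> subset T W ->
  (forall t, T t -> maxid W t -> t = 0) -> maxid W z1 -> z1 != 0 ->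
  forall u, frac (adj T z1) u -> W u -> ralg W T u.
Proof.
move=> vW sT TW T0 mz z0 _ [_ [_ [[a Ta ->] [[b Tb ->] nb] ->]]] Wu.
have iM := maxid_ideal vW; have [sW _] := vW.
have ex : exists k, (a`_k != 0) || (b`_k != 0).
  apply: NNPP => n; case/eqP: nb; suff -> : b = 0 by rewrite horner0.
  apply/polyP => k; rewrite coef0; apply/eqP; apply: contraT => bk.
  by case: n; exists k; rewrite bk orbT.
have [k ab min] := ex_minnP ex.
have low (c : {poly L}) : (forall j, (c`_j != 0) -> (k <= j)%N) -> c = drop_poly k c * 'X^k.
  move=> h; rewrite -[LHS](poly_take_drop k) (_ : take_poly k c = 0) ?add0r //.
  apply/polyP => j; rewrite coef_take_poly coef0; case: ltnP => // lt.
  by apply/eqP; apply: contraT => /h; rewrite leqNgt lt.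
have ea : a = drop_poly k a * 'X^k by apply: low => j aj; apply: min; rewrite aj.
have eb : b = drop_poly k b * 'X^k by apply: low => j bj; apply: min; rewrite bj orbT.
set a' := drop_poly k a in ea; set b' := drop_poly k b in eb.
have Wa' : coefs_in W a' by move=> j; rewrite coef_drop_poly; apply: TW.
have Wb' : coefs_in W b' by move=> j; rewrite coef_drop_poly; apply: TW.
have zk : z1 ^+ k != 0 by rewrite expf_neq0.
set u := a.[z1] / b.[z1] in Wu *.
have nb' : b'.[z1] != 0 by apply: contraNneq nb => e; rewrite eb hornerM e mul0r.
have eu : b'.[z1] * u = a'.[z1].
  by rewrite /u ea eb !hornerM !hornerXn; field; rewrite zk nb'.
apply/ralgP => //; pose f := b'`_0 *: 'X - (a'`_0)%:P.
have cf j : f`_j = b'`_0 * (j == 1%N)%:R - (if j == 0%N then a'`_0 else 0).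
  by rewrite coefB coefZ coefX coefC.
have Ta0 : T a'`_0 by rewrite coef_drop_poly.
have Tb0 : T b'`_0 by rewrite coef_drop_poly.
exists f; split.
- move=> j; rewrite cf; apply: (subringB sT).
    by case: eqP => _; rewrite ?mulr1 ?mulr0 //; apply: subring0.
  by case: eqP => _ //; apply: subring0.
- move=> mf; have b0 : b'`_0 = 0.
    by apply: T0 => //; have := mf 1%N; rewrite cf /= mulr1 subr0.
  have a0 : a'`_0 = 0.
    apply: T0 => //; have := mf 0%N; rewrite cf /= mulr0 sub0r => m.
    by rewrite -[X in maxid W X]opprK; apply: (idealN iM).
  by move: ab; rewrite -[k]add0n -!coef_drop_poly -/a' -/b' a0 b0 eqxx.
have ma := horner_mod sW iM Wa' mz; have mb := horner_mod sW iM Wb' mz.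
rewrite (_ : f.[u] = (a'.[z1] - a'`_0) - u * (b'.[z1] - b'`_0)).
  by apply: (idealB iM) => //; apply: (idealM iM).
rewrite /f hornerD hornerN hornerZ hornerX hornerC -eu.
move: u {Wu eu} => u; ring.
Qed.

End ResidualClosure.

(** * Transport along a field embedding *)

Section Image.
Variables (F L : fieldType) (i : {rmorphism F -> L}).
Implicit Types (A P R X : set F).

Definition img X : set L := fun y => exists2 x, X x & y = i x.

Lemma img_mem X x : img X (i x) <-> X x.
Proof. by split=> [[x' Xx' /fmorph_inj ->]|Xx] //; exists x. Qed.

Lemma img_subring A : subring A -> subring (img A).
Proof.
move=> sA; split; first by exists 0; [apply: subring0|rewrite rmorph0].
split; first by exists 1; [apply: subring1|rewrite rmorph1].
split=> _ _ [x Ax ->] [y Ay ->].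
  by exists (x - y); [apply: subringB|rewrite rmorphB].
by exists (x * y); [apply: subringM|rewrite rmorphM].
Qed.

Lemma img_prime A P : subring A -> prime_in A P -> prime_in (img A) (img P).
Proof.
move=> sA pP; have iP := pP.1; split.
  split; first by move=> _ [x Px ->]; exists x => //; apply: (idealS iP).
  split; first by exists 0; [apply: (ideal0 iP)|rewrite rmorph0].
  split=> [_ _ [x Px ->] [y Py ->]|_ _ [x Ax ->] [y Py ->]].
    by exists (x - y); [apply: (idealB iP)|rewrite rmorphB].
  by exists (x * y); [apply: (idealM iP)|rewrite rmorphM].
split; first by rewrite -(rmorph1 i) => /img_mem; case: pP => _ [].
move=> _ _ [x Ax ->] [y Ay ->]; rewrite -rmorphM => /img_mem Pxy.
by case: (prime_mul pP Ax Ay Pxy); [left|right]; apply/img_mem.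
Qed.

Lemma img_coefs X f : coefs_in (img X) (map_poly i f) <-> coefs_in X f.
Proof. by split=> h k; have := h k; rewrite coef_map => /img_mem. Qed.

Lemma coefs_imgP X g : coefs_in (img X) g -> exists2 f, coefs_in X f & g = map_poly i f.
Proof.
move=> Xg; have [c cP] : exists c : nat -> F, forall k, X (c k) /\ g`_k = i (c k).
  apply: (choice_fun (P := fun k x => X x /\ g`_k = i x)) => k.
  by have [x Xx e] := Xg k; exists x.
have e : g = map_poly i (\poly_(k < size g) c k).
  apply/polyP => k; rewrite coef_map coef_poly; case: ltnP => lt.
    by case: (cP k).
  by rewrite nth_default //= ?rmorph0.
exists (\poly_(k < size g) c k) => //; apply/img_coefs; rewrite -e => k.
by have [Xk ->] := cP k; apply/img_mem.
Qed.

Lemma img_subfield E : subfield E -> subfield (img E).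
Proof.
move=> [sE EV]; split; first exact: img_subring.
by move=> _ [x Ex ->]; exists x^-1; [apply: EV|rewrite fmorphV].
Qed.

Lemma img_alg E x : alg (img E) (i x) <-> alg E x.
Proof.
split=> [[g [g0 Eg gx]]|[f [f0 Ef fx]]].
  have [f Ef eg] := coefs_imgP Eg; exists f; split=> //.
    by move: g0; rewrite eg map_poly_eq0.
  by apply: (fmorph_inj i); rewrite rmorph0 -gx eg horner_map.
exists (map_poly i f); rewrite map_poly_eq0; split=> //; first exact/img_coefs.
by rewrite horner_map fx rmorph0.
Qed.

End Image.

(** * A prime strictly between zero and [P] *)

Lemma dvd_prod_XsubC (L : fieldType) (p q : {poly L}) c rs : q != 0 ->
  p %| q -> q = c *: \prod_(a <- rs) ('X - a%:P) ->
  exists d ss, p = d *: \prod_(a <- ss) ('X - a%:P).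
Proof.
move=> q0 pq eq; have c0 : c != 0 by apply: contra_neq q0 => c0; rewrite eq c0 scale0r.
have : p %| \prod_(a <- rs) ('X - a%:P) by rewrite -(dvdpZr _ _ c0) -eq.
case/dvdp_prod_XsubC => m /eqp_eq; rewrite lead_coef_prod_XsubC scale1r => ->.
by exists (lead_coef p), (mask m rs).
Qed.

(** [W] is centered on [P] and the residue of [y] is transcendental over those of [A], so [y] lies
    outside the field [E], whose residues are algebraic over a subring [B] of [A]. Then
    [closed_tower] supplies [K] and [z] for [prime_density]. *)
Theorem prime_below (F : fieldType) (T A P : set F) (xs : seq F) (y : F) :
  subring T -> subring A -> subset T A -> (forall x, x \in xs -> A x) ->
  (forall R, subring R -> subset T R -> (forall x, x \in xs -> R x) -> subset A R) ->
  prime_in A P -> (exists2 p, P p & p != 0) ->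
  (forall f, coefs_in A f -> f.[y] = 0 -> coefs_in P f) ->
  (forall v, frac (adj A y) v) -> alg A y ->
  (forall u, frac T u -> exists f, [/\ coefs_in T f, ~ coefs_in P f & f.[u] = 0]) ->
  exists q, [/\ prime_in A q, subset q P, exists2 x, q x & x != 0 &
    exists2 x, P x & ~ q x].
Proof.
move=> sT sA TA Axs gen pP [p Pp p0] tr fr al at_; have iP := pP.1.
have [W [vW AW Wy WP]] := chevalley_gauss sA pP tr.
have MP a : A a -> maxid W a <-> P a.
  move=> Aa; have Ca : coefs_in A a%:P by apply: coefs_C => //; apply: subring0.
  rewrite -{1}(hornerC a y); split=> [/(WP _ Ca)/(_ 0%N)|Pa]; first by rewrite coefC.
  by apply/(WP _ Ca); apply: coefs_C => //; apply: (ideal0 iP).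
have [sW _] := vW; have TW : subset T W by move=> t /TA /AW.
(* A nonzero element of [T] in [P] serves as [z1] if there is one. Otherwise the nonzero elements of
   [T] are units of [W], and adjoining [p] keeps all residues algebraic over [T]. Having [z1] in
   [E0] is what finally separates [q] from [P]. *)
have [z1 [E0 [Pz1 z10 cE0 E0z1 [TE0 E0T]]]] : exists z1 E0, [/\ P z1, z1 != 0,
    closed_field E0, E0 z1 & subset T E0 /\ forall v, E0 v -> W v -> ralg W T v].
  have [[t [Tt Pt t0]]|nt] := classic (exists t, [/\ T t, P t & t != 0]).
    exists t, (acl T); split=> //; [exact: acl_closed|exact: acl_base|split].
      by move=> x; apply: acl_base.
    move=> v av Wv; apply: ralg_alg (av) Wv => //; first exact: frac_subfield.
    by apply: (ralg_fracT (P := P)) => // x /TA Ax /MP; apply.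
  have sTp := adj_subring p sT.
  exists p, (acl (adj T p)); split=> //; first exact: acl_closed.
    by apply: acl_base => //; apply: adj_gen.
  split; first by move=> x Tx; apply: acl_base => //; apply: adj_base.
  move=> v av Wv; apply: ralg_alg (av) Wv => //; first exact: frac_subfield.
  apply: ralg_frac_adj => //; last by apply/MP => //; apply: (idealS iP).
  move=> t Tt /MP mt; apply/eqP; apply: contraT => t0; exfalso; apply: nt.
  by exists t; split=> //; apply/mt/TA.
have [E [B [[cE sB E0E TB BA] [BE EB xsB]]]] :=
  residual_closure vW AW sA sT TA cE0 TE0 E0T Axs.
have BW : subset B W by move=> b /BA /AW.
have nEy : ~ E y.
  move=> Ey; have /(ralgP vW sB BW Wy) [f [Bf nf mf]] := EB y Ey Wy.
  have Af : coefs_in A f by move=> k; apply: BA.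
  by apply: nf => k; apply/MP => //; move: k; apply/(WP _ Af).
have full R : closed_field R -> subset T R -> (forall x, x \in xs -> R x) -> forall v, R v.
  move=> cR TR Rxs v; have [fR clR] := cR; have [sR _] := fR.
  have AR : subset A R by apply: gen.
  apply: (frac_sub fR _ (fr v)); apply: adj_sub => //; apply: clR.
  exact: alg_mono AR al.
have [|R cR ER|K [z [cK EK zxs nKz fullz]]] := closed_tower (xs := xs) cE.
- by exists y.
- by apply: full => // t Tt; apply/ER/BE/TB.
have [fK _] := cK; have [sK _] := fK; have Az := Axs z zxs.
have [G GP] : exists G : F -> {poly {poly F}}, forall x, x \in xs -> [/\ G x != 0,
    forall k, coefs_in K (G x)`_k & (map_poly (fun p => p.[z]) (G x)).[x] = 0].
  apply: (choice_fun (P := fun (x : F) (G : {poly {poly F}}) => x \in xs -> [/\ G != 0,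
    forall k, coefs_in K G`_k & (map_poly (fun p => p.[z]) G).[x] = 0])) => x.
  have [f [f0 Cf fx]] := alg_frac (adj_subring z sK) (fullz x).
  have [c cP] : exists c : nat -> {poly F}, forall k, coefs_in K (c k) /\ f`_k = (c k).[z].
    apply: (choice_fun (P := fun (k : nat) (p : {poly F}) => coefs_in K p /\ f`_k = p.[z])) => k.
    by have [g Kg e] := Cf k; exists g.
  exists (\poly_(k < size f) c k) => _.
  have h0 : (fun p : {poly F} => p.[z]) 0 = 0 by rewrite horner0.
  have ef : map_poly (fun p => p.[z]) (\poly_(k < size f) c k) = f.
    apply/polyP => k; rewrite coef_map_id0 // coef_poly; case: ltnP => lt.
      by case: (cP k).
    by rewrite horner0 nth_default.
  split; last by rewrite ef.
  - by apply: contraNneq f0 => e; rewrite -ef e map_polyE polyseq0.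
  - move=> k; rewrite coef_poly; case: ifP => _; first by case: (cP k).
    by move=> j; rewrite coef0; apply: subring0.
(* Splitting this product splits every coefficient of every equation, at the price of an algebraic
   extension [L] to which all data are transported. *)
pose h := \prod_(x <- xs) \prod_(c <- polyseq (G x) | c != 0) c.
have h0 : h != 0.
  rewrite /h; elim: (xs) => [|x l IHl]; first by rewrite big_nil oner_neq0.
  rewrite big_cons mulf_neq0 //; elim/big_ind: _ => //; first exact: oner_neq0.
  by move=> a b a0 b0; rewrite mulf_neq0.
have [L [i [[c [rs eh]] algL]]] := splitting_field h0.
have dvd x k : x \in xs -> (G x)`_k != 0 -> (G x)`_k %| h.
  move=> xx nz; rewrite /h (big_rem x) //=; apply: dvdp_mulr.
  have lt : (k < size (G x))%N by rewrite ltnNge; apply: contraNN nz => /(nth_default 0) ->.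
  by rewrite (big_rem _ (mem_nth 0 lt)) nz; apply: dvdp_mulr.
have mh0 : map_poly i h != 0 by rewrite map_poly_eq0.
pose K' := alg (img i K); have fiK := img_subfield i fK.
have cK' : closed_field K' by split; [apply: alg_subfield|move=> v; apply: alg_idem].
have KK' x : K x -> K' (i x) by move=> Kx; apply: alg_base; [case: fiK|apply/img_mem].
have siA := img_subring i sA; have siB := img_subring i sB.
have [|||||||||||q [pq qP [w qw w0] qK]] := @prime_density L (img i A) (img i B) (img i P) K'
  [seq i x | x <- xs] (i z) siA siB _ (img_prime i sA pP).
- by move=> _ [b Bb ->]; apply/img_mem; apply: BA.
- by move=> _ /mapP [x xx ->]; apply/img_mem; apply: Axs.
- move=> R sR BR Rxs _ [a Aa ->].
  apply: (gen (fun x => R (i x))) a Aa.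
  + split; first by rewrite rmorph0; apply: subring0.
    split; first by rewrite rmorph1; apply: subring1.
    by split=> x x' Rx Rx'; rewrite ?rmorphB ?rmorphM; [apply: subringB|apply: subringM].
  + by move=> t Tt; apply: BR; apply/img_mem; apply: TB.
  + by move=> x xx; apply: Rxs; apply: map_f.
- move=> _ /mapP [x xx ->].
  have /(ralgP vW sB BW (AW _ (Axs _ xx))) [f [Bf nf mf]] := xsB x xx.
  exists (map_poly i f); split; first exact/img_coefs.
    by move/img_coefs => Pf; apply: nf => k; apply/MP => //; apply: BA.
  rewrite horner_map; apply/img_mem; apply/MP => //.
  by apply: coefs_horner_ring (Axs _ xx) _ => // k; apply: BA.
- exact: cK'.
- by move=> _ [b Bb ->]; apply/KK'/EK/BE.
- by move/img_alg => /(proj2 cK).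
- exact/img_mem.
- exists (i z1); rewrite fmorph_eq0; split=> //; first exact/img_mem.
  exact/KK'/EK/E0E.
- move=> _ /mapP [x xx ->]; have [Gx0 KG Gx] := GP x xx.
  exists (map_poly (map_poly i) (G x)).
    apply: contraNneq Gx0 => e; apply/eqP/polyP => k; rewrite coef0; apply/eqP.
    have /eqP := congr1 (fun p : {poly {poly L}} => p`_k) e.
    by rewrite coef_map coef0 /= map_poly_eq0.
  split.
  + by move=> k j; rewrite coef_map /= coef_map; apply/KK'/KG.
  + transitivity (i (map_poly (fun p => p.[z]) (G x)).[x]); last by rewrite Gx rmorph0.
    rewrite -horner_map; congr (_.[_]).
    have e0 (f : fieldType) (x' : f) : (0 : {poly f}).[x'] = 0 by rewrite horner0.
    apply/polyP => k; have e1 := coef_map (map_poly i) (G x) k.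
    by rewrite (coef_map_id0 _ _ (e0 L (i z))) e1 /= horner_map coef_map (coef_map_id0 _ _ (e0 F z)).
  move=> k; rewrite coef_map /= => nz.
  have nz' : (G x)`_k != 0 by apply: contraNneq nz => ->; rewrite rmorph0.
  by apply: (dvd_prod_XsubC mh0 _ eh); rewrite dvdp_map; apply: dvd.
- have cA' := acl_closed siA; have [fA' _] := cA'.
  have clA := acl_closed sA.
  have fullA : forall v, acl A v.
    by apply: full => // [t /TA At|x /Axs Ax]; apply: acl_base.
  move=> v; apply: alg_frac => //; apply: (proj2 cA').
  apply: alg_mono (algL v) => _ [x ->].
  have fimg : subset (img i (frac A)) (frac (img i A)).
    move=> _ [_ [a [b [Aa [Ab b0] ->]]] ->]; exists (i a), (i b).
    by rewrite fmorph_div fmorph_eq0; split=> //; [apply/img_mem|split=> //; apply/img_mem].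
  by apply: alg_mono fimg _; apply/img_alg; apply: fullA.
have [_ [_ [_ _]]] := pq.1.
exists (fun a => A a /\ q (i a)); split.
- have iq := pq.1; split.
    split; first by move=> a [].
    split; first by split; [apply: subring0|rewrite rmorph0; apply: (ideal0 iq)].
    split=> [a b [Aa qa] [Ab qb]|a b Aa [Ab qb]].
      by split; [apply: subringB|rewrite rmorphB; apply: (idealB iq)].
    by split; [apply: subringM|rewrite rmorphM; apply: (idealM iq) => //; apply/img_mem].
  split; first by case=> _; rewrite rmorph1; case: pq => _ [].
  move=> a b Aa Ab [_]; rewrite rmorphM => /(prime_mul pq _ _) [||qa|qb].
  + exact/img_mem.
  + exact/img_mem.
  + by left.
  + by right.
- by move=> a [_ /qP /img_mem].
- have [x Ax ew] := idealS pq.1 qw; exists x; first by split=> //; rewrite -ew.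
  by apply: contraNneq w0 => x0; rewrite ew x0 rmorph0.
exists z1 => // -[_ qz1]; have /eqP := qK _ qz1 (KK' _ (EK _ (E0E _ E0z1))).
by rewrite fmorph_eq0 (negPf z10).
Qed.

(** * Images and preimages under a homomorphism on a subring *)

Section Hom.
Variables (B C : comNzRingType) (S : set B) (phi : B -> C).
Hypotheses (sS : subring S) (hphi : hom_on S phi).

Lemma hom1 : phi 1 = 1. Proof. by case: hphi. Qed.
Lemma homB x y : S x -> S y -> phi (x - y) = phi x - phi y.
Proof. by case: hphi => _ h _; apply: h. Qed.
Lemma homM x y : S x -> S y -> phi (x * y) = phi x * phi y.
Proof. by case: hphi => _ _; apply. Qed.

Lemma hom0 : phi 0 = 0.
Proof.
by have := homB (subring0 sS) (subring0 sS); rewrite !subrr.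
Qed.

Lemma homN x : S x -> phi (- x) = - phi x.
Proof. by move=> Sx; rewrite -sub0r homB ?hom0 ?sub0r //; apply: subring0. Qed.

Lemma homD x y : S x -> S y -> phi (x + y) = phi x + phi y.
Proof.
by move=> Sx Sy; rewrite -{1}[y]opprK homB ?homN ?opprK //; apply: subringN.
Qed.

Lemma homX x n : S x -> phi (x ^+ n) = phi x ^+ n.
Proof.
move=> Sx; elim: n => [|n IHn]; first by rewrite !expr0 hom1.
by rewrite !exprS homM ?IHn //; apply: subringX.
Qed.

Lemma hom_sum n (E : nat -> B) : (forall i, (i < n)%N -> S (E i)) ->
  phi (\sum_(i < n) E i) = \sum_(i < n) phi (E i).
Proof.
elim: n => [|n IHn] SE; first by rewrite !big_ord0 hom0.
have SE' i : (i < n)%N -> S (E i) by move=> lt; apply: SE; apply: ltnW.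
rewrite !big_ord_recr /= homD; first by rewrite IHn.
  by apply: addgrp_sum => [|i _]; [apply: subring_addgrp|apply: SE'].
exact: SE.
Qed.

Definition image_set (X : set B) : set C := fun y => exists2 x, X x & y = phi x.

Lemma image_subring T : subring T -> subset T S -> subring (image_set T).
Proof.
move=> sT TS; split; first by exists 0; [apply: subring0|rewrite hom0].
split; first by exists 1; [apply: subring1|rewrite hom1].
split=> _ _ [x Tx ->] [y Ty ->].
  by exists (x - y); [apply: subringB|rewrite homB //; apply: TS].
by exists (x * y); [apply: subringM|rewrite homM //; apply: TS].
Qed.

Lemma image_mem P x : ideal_in S P -> (forall a, S a -> phi a = 0 -> P a) -> S x ->
  image_set P (phi x) -> P x.
Proof.
move=> iP kerP Sx [y Py e]; have Sy := idealS iP Py.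
rewrite -(subrK y x); apply: (idealD iP) => //; apply: kerP; first exact: subringB.
by rewrite homB // e subrr.
Qed.

Lemma image_prime P : prime_in S P -> (forall a, S a -> phi a = 0 -> P a) ->
  prime_in (image_set S) (image_set P).
Proof.
move=> pP kerP; have iP := pP.1; have PS := idealS iP; split.
  split; first by move=> _ [x Px ->]; exists x => //; apply: PS.
  split; first by exists 0; [apply: (ideal0 iP)|rewrite hom0].
  split=> [_ _ [x Px ->] [y Py ->]|_ _ [x Sx ->] [y Py ->]].
    by exists (x - y); [apply: (idealB iP)|rewrite homB //; apply: PS].
  by exists (x * y); [apply: (idealM iP)|rewrite homM //; apply: PS].
split.
  by rewrite -hom1 => /(image_mem iP kerP (subring1 sS)) P1; case: pP => _ [+ _]; apply.
move=> _ _ [x Sx ->] [y Sy ->]; rewrite -homM // => /(image_mem iP kerP (subringM sS Sx Sy)).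
by case/(prime_mul pP Sx Sy) => ?; [left|right]; [exists x|exists y].
Qed.

Lemma preimage_prime q : prime_in (image_set S) q -> prime_in S (fun x => S x /\ q (phi x)).
Proof.
move=> pq; have iq := pq.1; have mem x : S x -> image_set S (phi x) by exists x.
split.
  split; first by move=> x [].
  split; first by split; [apply: subring0|rewrite hom0; apply: (ideal0 iq)].
  split=> [x y [Sx qx] [Sy qy]|x y Sx [Sy qy]].
    by split; [apply: subringB|rewrite homB //; apply: (idealB iq)].
  by split; [apply: subringM|rewrite homM //; apply: (idealM iq) => //; apply: mem].
split; first by case=> _; rewrite hom1; case: pq => _ [].
move=> x y Sx Sy [_]; rewrite homM // => /(prime_mul pq (mem _ Sx) (mem _ Sy)).
by case=> ?; [left|right].
Qed.

End Hom.

Lemma hom_polyC (B C : comNzRingType) (S : set B) (phi : {poly B} -> C) : subring S ->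
  hom_on (coefs_in S) phi -> hom_on S (fun x => phi x%:P).
Proof.
move=> sS [h1 hB hM]; have CS x : S x -> coefs_in S x%:P.
  by apply: coefs_C; apply: subring0.
split=> [|x y Sx Sy|x y Sx Sy]; first exact: h1.
  by rewrite polyCB hB //; apply: CS.
by rewrite polyCM hM //; apply: CS.
Qed.

Lemma hom_poly (B C : comNzRingType) (S : set B) (phi : {poly B} -> C) p : subring S ->
  hom_on (coefs_in S) phi -> coefs_in S p ->
  phi p = (\poly_(i < size p) phi (p`_i)%:P).[phi 'X].
Proof.
move=> sS hphi Sp; have sSX := coefs_subring sS.
have CS x : S x -> coefs_in S x%:P by apply: coefs_C; apply: subring0.
have SX := coefs_X sS.
rewrite horner_poly -{1}(coefK p) poly_def.
rewrite (hom_sum sSX hphi (E := fun i => p`_i *: 'X^i)); last first.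
  by move=> i _; rewrite -mul_polyC; apply: (subringM sSX); [apply: CS|apply: (subringX _ sSX)].
apply: eq_bigr => i _; rewrite -mul_polyC (homM hphi); [|exact: CS|exact: (subringX _ sSX)].
by rewrite (homX sSX hphi).
Qed.

(** * Iterated polynomial rings and the strong S-property *)

Fixpoint mconst (B : comNzRingType) n : B -> mpoly B n :=
  match n with 0 => id | n'.+1 => fun x => (@mconst B n' x)%:P end.

Lemma mcoefs_subring (B : comNzRingType) (T : set B) n : subring T -> subring (@mcoefs B n T).
Proof. by move=> sT; elim: n => //= n; apply: coefs_subring. Qed.

Lemma mconst_mem (B : comNzRingType) (T : set B) n x : subring T -> T x ->
  @mcoefs B n T (mconst n x).
Proof.
move=> sT Tx; elim: n => //= n IHn; apply: coefs_C => //.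
by apply: subring0; apply: mcoefs_subring.
Qed.

Lemma mconst_hom (B : comNzRingType) (T : set B) n : hom_on T (@mconst B n).
Proof.
split; elim: n => //= n IHn.
- by rewrite IHn.
- by move=> x y Tx Ty; rewrite IHn // polyCB.
by move=> x y Tx Ty; rewrite IHn // polyCM.
Qed.

Lemma mcoefs_generators (B : comNzRingType) (C : fieldType) (T : set B) n
    (phi : mpoly B n -> C) : subring T -> hom_on (@mcoefs B n T) phi ->
  exists2 xs : seq C, forall x, x \in xs -> image_set phi (@mcoefs B n T) x &
    forall R : set C, subring R -> (forall t, T t -> R (phi (mconst n t))) ->
      (forall x, x \in xs -> R x) -> subset (image_set phi (@mcoefs B n T)) R.
Proof.
move=> sT; elim: n phi => [|n IHn] phi hphi.
  by exists [::] => // R sR TR _ _ [x Tx ->]; apply: TR.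
have sS := @mcoefs_subring B T n sT.
have [xs xsS gen] := IHn _ (hom_polyC sS hphi).
exists (phi 'X :: xs).
  move=> x; rewrite inE => /predU1P [->|/xsS [a Sa ->]].
    by exists 'X => //; apply: (coefs_X sS).
  by exists a%:P => //; apply: (coefs_C (subring0 sS) Sa).
move=> R sR TR Rxs _ [p Sp ->]; rewrite (hom_poly sS hphi Sp).
apply: coefs_horner_ring => //; first by apply: Rxs; apply: mem_head.
apply: coefs_poly => [|i _]; first exact: subring0.
apply: (gen R) => //; first by move=> x xx; apply: Rxs; rewrite inE xx orbT.
by exists p`_i.
Qed.

(** For a prime [P] of a ring [T] with quotient field [K], equivalent to every prime inside [P[X]]
    being extended from its contraction, by [prime_extended] and [alg_at_of_extended]. In this form
    the condition passes at once to smaller primes and to overrings. *)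
Definition alg_at (K : fieldType) (T P : set K) :=
  forall u, exists f : {poly K}, [/\ coefs_in T f, ~ coefs_in P f & f.[u] = 0].

(** The map [psi] respects the operations only on [T], where [a / b] may not lie; so the equation is
    multiplied by [b ^+ size f] before it is mapped. *)
Lemma map_root (K C : fieldType) (T : set K) (psi : K -> C) (f : {poly K}) a b :
  subring T -> hom_on T psi -> coefs_in T f -> T a -> T b -> psi b != 0 ->
  f.[a / b] = 0 -> (\poly_(i < size f) psi f`_i).[psi a / psi b] = 0.
Proof.
move=> sT hpsi Tf Ta Tb nb fab.
have b0 : b != 0 by apply: contra_neq nb => ->; apply: (hom0 sT hpsi).
have scale (C' : fieldType) (x y : C') (g : nat -> C') : y != 0 ->
    (\poly_(i < size f) g i).[x / y] * y ^+ size f =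
    \sum_(i < size f) g i * (x ^+ i * y ^+ (size f - i)).
  move=> y0; rewrite horner_poly mulr_suml; apply: eq_bigr => i _.
  have le : (i <= size f)%N by apply: ltnW.
  by rewrite exprMn -!mulrA; congr (_ * (_ * _)); apply: exprVM.
have bn0 : psi b ^+ size f != 0 by rewrite expf_neq0.
apply: (mulIf bn0); rewrite mul0r scale //.
have e : \sum_(i < size f) f`_i * (a ^+ i * b ^+ (size f - i)) = 0.
  by rewrite -scale // coefK fab mul0r.
transitivity (psi (\sum_(i < size f) f`_i * (a ^+ i * b ^+ (size f - i)))); last first.
  by rewrite e (hom0 sT hpsi).
rewrite (hom_sum sT hpsi (E := fun i => f`_i * (a ^+ i * b ^+ (size f - i)))).
  apply: eq_bigr => i _.
  by rewrite !(homM hpsi) ?(homX sT hpsi) //; do ?apply: subringM => //; apply: subringX.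
by move=> i _; do !apply: subringM => //; apply: subringX.
Qed.

Theorem strong_S_mcoefs (K : fieldType) (T : set K) n : subring T ->
  (forall P, prime_in T P -> alg_at T P) -> strong_S (@mcoefs K n T).
Proof.
move=> sT algT P1 P2 pP1 pP2 P12 adj12 [Q [pQ [[P1Q [f0 [Qf0 nf0]]] [QP2 [g0 [Pg0 ng0]]]]]].
set S := @mcoefs K n T in pP1 pP2 adj12 pQ.
have sS : subring S by apply: mcoefs_subring.
have sSX := coefs_subring sS; have iQ := pQ.1.
have iP1 := pP1.1; have iP2 := pP2.1; have [sub12 [p [P2p nP1p]]] := P12.
have CS x : S x -> coefs_in S x%:P by apply: coefs_C; apply: subring0.
have Q0 : prime_in S (fun a => S a /\ Q a%:P).
  split.
    split; first by move=> a [].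
    split; first by split; [apply: subring0|apply: (ideal0 iQ)].
    split=> [a b [Sa Qa] [Sb Qb]|a b Sa [Sb Qb]].
      by split; [apply: subringB|rewrite polyCB; apply: (idealB iQ)].
    by split; [apply: subringM|rewrite polyCM; apply: (idealM iQ) => //; apply: CS].
  split; first by case=> _; case: pQ => _ [].
  move=> a b Sa Sb [_]; rewrite polyCM => /(prime_mul pQ (CS _ Sa) (CS _ Sb)).
  by case=> ?; [left|right].
(* The contraction of [Q] lies between [P1] and [P2], so adjacency leaves only these two; [P2] would
   force [Q] to contain all of [P2[X]]. *)
have QP1 a : S a -> Q a%:P -> P1 a.
  move=> Sa Qa; apply: NNPP => nPa; apply: adj12.
  exists (fun a => S a /\ Q a%:P); split=> //; split; split.
  - move=> b Pb; split; first exact: (idealS iP1).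
    by apply: P1Q; apply: coefs_C => //; apply: (ideal0 iP1).
  - by exists a.
  - by move=> b [_ /QP2 /(_ 0%N)]; rewrite coefC.
  apply: NNPP => nex; apply: ng0.
  have P2Q b : P2 b -> Q b%:P.
    by move=> Pb; apply: NNPP => nQ; apply: nex; exists b; split=> // -[].
  rewrite -(coefK g0) poly_def; apply: addgrp_sum; first exact: ideal_addgrp iQ.
  move=> i _; rewrite -mul_polyC; apply: (idealMr iQ).
    exact/(subringX _ sSX)/(coefs_X sS).
  exact/P2Q/Pg0.
(* [F] is the residue field of [Q]. On [S] the kernel is [P1], and [y = phi 'X] generates [F] over
   the image of [S]; since [Q] lies in [P2[X]], equations of [y] have all coefficients in the image
   of [P2]. *)
have [F [phi [hphi kerphi fracphi]]] := residue_field_hom sSX pQ.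
have hpsi := hom_polyC sS hphi; pose psi x := phi x%:P.
have ker a : S a -> psi a = 0 -> P1 a.
  by move=> Sa /(kerphi _ (CS _ Sa)); apply: QP1.
have ker0 a : P1 a -> psi a = 0.
  move=> Pa; apply/kerphi; first exact/CS/(idealS iP1).
  by apply: P1Q; apply: coefs_C => //; apply: (ideal0 iP1).
have ker2 a : S a -> psi a = 0 -> P2 a by move=> Sa /(ker _ Sa) /sub12.
have [xs xsS gen] := mcoefs_generators sT hpsi.
pose T' := image_set (fun x => psi (mconst n x)) T.
pose A := image_set psi S; pose P := image_set psi P2.
have hpsiT : hom_on T (fun x => psi (mconst n x)).
  have [c1 cB cM] := mconst_hom T n; have mem t : T t -> S (mconst n t) by apply: mconst_mem.
  split=> [|x y Tx Ty|x y Tx Ty].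
  - by rewrite c1; apply: (hom1 hpsi).
  - by rewrite cB //; apply: (homB hpsi); apply: mem.
  - by rewrite cM //; apply: (homM hpsi); apply: mem.
have sA : subring A by apply: (image_subring sS hpsi).
have pP : prime_in A P by apply: (image_prime sS hpsi).
have phiX g : coefs_in S g -> phi g = (\poly_(i < size g) psi g`_i).[phi 'X].
  exact: hom_poly.
have lift f : coefs_in A f -> exists2 g, coefs_in S g & f = \poly_(i < size g) psi g`_i.
  move=> Af; have [c cP] : exists c : nat -> mpoly K n, forall i, S (c i) /\ f`_i = psi (c i).
    apply: (choice_fun (P := fun i x => S x /\ f`_i = psi x)) => i.
    by have [x Sx e] := Af i; exists x.
  exists (\poly_(i < size f) c i).
    by apply: coefs_poly => [|i _]; [apply: subring0|case: (cP i)].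
  apply/polyP => i; rewrite coef_poly coef_poly; case: (ltnP i (size f)) => [lt|le].
    have [_ ->] := cP i; case: ltnP => // le.
    have := coef_poly (size f) c i; rewrite lt => <-.
    by rewrite (nth_default _ le); apply: (hom0 sS hpsi).
  rewrite (nth_default _ le); case: ltnP => // _; symmetry; exact: (hom0 sS hpsi).
have coefE g i : coefs_in S g -> (\poly_(i < size g) psi g`_i)`_i = psi g`_i.
  move=> Sg; rewrite coef_poly; case: ltnP => // le.
  by rewrite (nth_default _ le); symmetry; apply: (hom0 sS hpsi).
have [||||||||||q [pq qP [w qw w0] [v Pv nqv]]] := @prime_below F T' A P xs (phi 'X) _ sA.
- by apply: (image_subring sT hpsiT).
- by move=> _ [t Tt ->]; exists (mconst n t) => //; apply: mconst_mem.
- exact: xsS.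
- by move=> R sR TR; apply: gen => // t Tt; apply: TR; exists t.
- exact: pP.
- exists (psi p); first by exists p.
  by apply/eqP => /(ker _ (idealS iP2 P2p)).
- move=> f /lift [g Sg ->] fy i; rewrite coefE //; exists g`_i => //.
  by apply: QP2; apply/kerphi => //; rewrite phiX.
- move=> v; have [a [b [Sa Sb ->]]] := fracphi v.
  have inA g : coefs_in S g -> adj A (phi 'X) (phi g).
    move=> Sg; rewrite (phiX _ Sg); exists (\poly_(i < size g) psi g`_i) => // i.
    by rewrite coefE //; exists g`_i.
  have [e|b0] := eqVneq (phi b) 0.
    rewrite e invr0 mulr0; case: (frac_subfield (adj_subring (phi 'X) sA)).
    by move=> /subring0.
  by exists (phi a), (phi b); split=> //; [apply: inA|split=> //; apply: inA].
(* As [f0] lies in [Q] but outside [P1[X]], its image is a nontrivial equation of [y]. *)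
- exists (\poly_(i < size f0) psi f0`_i).
  have Sf0 := idealS iQ Qf0; split.
  + apply/eqP => e; apply: nf0 => i; apply: ker => //.
    by rewrite -coefE // e coef0.
  + by move=> i; rewrite coefE //; exists f0`_i.
  by rewrite -phiX //; apply/kerphi.
- move=> _ [_ [_ [[a Ta ->] [[b Tb ->] nb] ->]]].
  have [f [Tf nf fu]] : exists f : {poly K}, [/\ coefs_in T f,
      ~ coefs_in (fun t => T t /\ P2 (mconst n t)) f & f.[a / b] = 0].
    apply: algT; have mem t : T t -> S (mconst n t) by apply: mconst_mem.
    have [c1 cB cM] := mconst_hom T n; split.
      split; first by move=> t [].
      split.
        split; first exact: subring0.
        rewrite -(subrr 1) cB ?subrr; [exact: (ideal0 iP2)|exact: subring1|exact: subring1].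
      split=> [x y [Tx Px] [Ty Py]|x y Tx [Ty Py]].
        by split; [apply: subringB|rewrite cB //; apply: (idealB iP2)].
      by split; [apply: subringM|rewrite cM //; apply: (idealM iP2) => //; apply: mem].
    split; first by case=> _; rewrite c1; case: pP2 => _ [].
    move=> x y Tx Ty [_]; rewrite cM // => /(prime_mul pP2 (mem _ Tx) (mem _ Ty)).
    by case=> ?; [left|right].
  exists (\poly_(i < size f) psi (mconst n f`_i)); split.
  + apply: coefs_poly => [|i _]; last by exists f`_i.
    by exists 0; [apply: subring0|symmetry; apply: (hom0 sT hpsiT)].
  + move=> Pf; apply: nf => i; split=> //.
    apply: (image_mem sS hpsi iP2 ker2); first exact: mconst_mem.
    have := Pf i; rewrite coef_poly; case: ltnP => // le.
    have z : psi (mconst n f`_i) = 0.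
      by rewrite (nth_default _ le); apply: (hom0 sT hpsiT).
    by rewrite -z.
  exact: (map_root sT hpsiT).
have pq' := preimage_prime sS hpsi pq.
apply: adj12; exists (fun x => S x /\ q (psi x)); split=> //; split; split.
- move=> a Pa; split; first exact: (idealS iP1).
  by rewrite ker0 //; apply: (ideal0 pq.1).
- have [a Sa ew] := idealS pq.1 qw; exists a; split; first by rewrite -ew.
  by move/ker0 => z; move: w0; rewrite ew z eqxx.
- by move=> a [Sa /qP] /(image_mem sS hpsi iP2 ker2 Sa).
have [a Pa ev] := Pv; exists a; split=> // -[_ qa].
by apply: nqv; rewrite ev.
Qed.

(** * Semistar operations, quasi-primes and linked overrings *)

Section Star.
Variables (K : fieldType) (D : set K) (st : set K -> set K).
Hypotheses (hD : domain_with_qf D) (hst : semistar D st).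
Implicit Types (E F I J M P T : set K) (s t : seq K).

Let sD : subring D. Proof. by case: hD. Qed.
Let D0 : D 0 := subring0 sD.
Let D1 : D 1 := subring1 sD.

Definition nonzero E := exists x, E x /\ x != 0.

Definition dmodule E := [/\ E 0, forall x y, E x -> E y -> E (x + y) &
  forall a x, D a -> E x -> E (a * x)].

Lemma Fbar_module E : Fbar D E <-> dmodule E /\ nonzero E.
Proof. by split=> [[E0 [ED [EM Enz]]]|[[E0 ED EM] Enz]]; split. Qed.

Lemma ideal_module I : ideal_in D I -> dmodule I.
Proof.
move=> iI; split; first exact: (ideal0 iI).
  by move=> x y; apply: (idealD iI).
by move=> a x; apply: (idealM iI).
Qed.

Lemma gen_sub E s : dmodule E -> (forall x, x \in s -> E x) -> subset (gen D s) E.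
Proof.
move=> [E0 ED EM] sE _ [c [sc [cD ->]]]; elim/big_ind: _ => // i _.
by apply: EM; [apply: cD; apply: mem_nth; rewrite sc|apply: sE; apply: mem_nth].
Qed.

Lemma gen_mem s x : x \in s -> gen D s x.
Proof.
move=> xs; exists [seq (if i == index x s then 1 else 0 : K) | i <- iota 0 (size s)].
split; first by rewrite size_map size_iota.
split; first by move=> _ /mapP [i _ ->]; case: eqP.
have lt : (index x s < size s)%N by rewrite index_mem.
rewrite (bigD1 (Ordinal lt)) //= (nth_map 0%N) ?size_iota // nth_iota // eqxx.
rewrite mul1r nth_index // big1 ?addr0 // => i ne.
rewrite (nth_map 0%N) ?size_iota // nth_iota // add0n.
case: eqP => [e|_]; last by rewrite mul0r.
by case/eqP: ne; apply: val_inj.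
Qed.

Lemma gen_module s : dmodule (gen D s).
Proof.
split.
- exists (nseq (size s) 0); rewrite size_nseq; split=> //; split.
    by move=> a; rewrite mem_nseq => /andP [_ /eqP ->].
  by rewrite big1 // => i _; rewrite nth_nseq ltn_ord mul0r.
- move=> _ _ [c [sc [cD ->]]] [d [sd [dD ->]]].
  exists [seq c`_i + d`_i | i <- iota 0 (size s)].
  rewrite size_map size_iota; split=> //; split.
    move=> _ /mapP [i + ->]; rewrite mem_iota => /andP [_ lt].
    by apply: subringD => //; [apply: cD|apply: dD]; apply: mem_nth; rewrite ?sc ?sd.
  rewrite -big_split /=; apply: eq_bigr => i _.
  by rewrite (nth_map 0%N) ?size_iota // nth_iota // mulrDl.
move=> a _ Da [c [sc [cD ->]]]; exists [seq a * x | x <- c].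
rewrite size_map; split=> //; split.
  by move=> _ /mapP [x xc ->]; apply: subringM => //; apply: cD.
rewrite mulr_sumr; apply: eq_bigr => i _; rewrite (nth_map 0) ?sc //.
by rewrite mulrA.
Qed.

Lemma Fbar_gen s : nonzero (gen D s) -> Fbar D (gen D s).
Proof. by move=> nz; apply/Fbar_module; split=> //; apply: gen_module. Qed.

Lemma Fbar_D : Fbar D D.
Proof.
apply/Fbar_module; split; first exact/ideal_module/ideal_self.
by exists 1; split=> //; apply: oner_neq0.
Qed.

Let stF E : Fbar D E -> Fbar D (st E). Proof. by case: hst => h _; apply: h. Qed.
Let st_mono E F : Fbar D E -> Fbar D F -> subset E F -> subset (st E) (st F).
Proof. by case: hst => _ [_ [h _]]; apply: h. Qed.
Let st_ext E : Fbar D E -> subset E (st E).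
Proof. by case: hst => _ [_ [_ h]] /h []. Qed.
Let st_idem E : Fbar D E -> subset (st (st E)) (st E).
Proof. by case: hst => _ [_ [_ h]] /h [_ []]. Qed.
Let st_scale x E : x != 0 -> Fbar D E -> subset (scale x (st E)) (st (scale x E)).
Proof. by case: hst => _ [h _] x0 FE; case: (h x E x0 FE). Qed.

Lemma st_trans E F : Fbar D E -> Fbar D F -> subset E (st F) -> subset (st E) (st F).
Proof.
by move=> FE FF EF x /(st_mono FE (stF FF) EF); apply: st_idem.
Qed.

Lemma star_fP E y : star_f D st E y <->
  exists s, [/\ nonzero (gen D s), forall x, x \in s -> E x, subset (gen D s) E & st (gen D s) y].
Proof.
split=> [[F [[s [[Fs sF] nz]] [FE Fy]]]|[s [nz sE gE sy]]]; last first.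
  by exists (gen D s); split; [exists s; split; [split=> x|]|split].
have nz' : nonzero (gen D s) by have [x [Fx x0]] := nz; exists x; split=> //; apply: Fs.
have FF : Fbar D F.
  have /Fbar_module [[g0 gD gM] _] := Fbar_gen nz'; apply/Fbar_module; split=> //; split.
  - exact: sF.
  - by move=> x z /Fs gx /Fs gz; apply/sF/gD.
  - by move=> a x Da /Fs gx; apply/sF/gM.
exists s; split=> //.
- by move=> x xs; apply/FE/sF/gen_mem.
- by move=> x /sF /FE.
by apply: st_mono Fy => //; apply: Fbar_gen.
Qed.

Lemma gen_cat s t : subset (gen D s) (gen D (s ++ t)) /\ subset (gen D t) (gen D (s ++ t)).
Proof.
by split; apply: gen_sub => [|x xs]; try exact: gen_module;
  apply: gen_mem; rewrite mem_cat xs ?orbT.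
Qed.

Lemma gen_cat_sub E s t : dmodule E -> (forall x, x \in s -> E x) ->
  (forall x, x \in t -> E x) -> forall x, x \in s ++ t -> E x.
Proof. by move=> mE sE tE x; rewrite mem_cat => /orP [/sE|/tE]. Qed.

Lemma nonzero_sub E F : subset E F -> nonzero E -> nonzero F.
Proof. by move=> EF [x [Ex x0]]; exists x; split=> //; apply: EF. Qed.

(** Finite character: finitely many elements of [star_f E] lie in the star of one finitely generated
    submodule. The idempotence of [star_closure] rests on it. *)
Lemma star_f_collect E s : dmodule E -> nonzero E -> (forall x, x \in s -> star_f D st E x) ->
  exists t, [/\ nonzero (gen D t), forall x, x \in t -> E x &
    forall x, x \in s -> st (gen D t) x].
Proof.
move=> mE [x0 [Ex0 nz0]]; elim: s => [_|x s IHs Hs].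
  exists [:: x0]; split=> //; last by move=> y; rewrite inE => /eqP ->.
  by exists x0; split=> //; apply: gen_mem; rewrite inE.
have [|t [nzt tE ts]] := IHs; first by move=> y ys; apply: Hs; rewrite inE ys orbT.
have /star_fP [u [nzu uE _ ux]] := Hs x (mem_head _ _).
have [gu gt] := gen_cat u t.
have nzut : nonzero (gen D (u ++ t)) by apply: nonzero_sub gu nzu.
exists (u ++ t); split=> //; first exact: gen_cat_sub.
move=> y; rewrite inE => /predU1P [->|/ts].
  by apply: st_mono ux => //; apply: Fbar_gen.
by apply: st_mono => //; apply: Fbar_gen.
Qed.

Definition star_closure J : set K := fun y => star_f D st J y /\ D y.

Lemma star_closure_sub J : ideal_in D J -> nonzero J -> subset J (star_closure J).
Proof.
move=> iJ [x0 [Jx0 nz0]] y Jy; split; last exact: (idealS iJ).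
have nz : nonzero (gen D [:: y; x0]).
  by exists x0; split=> //; apply: gen_mem; rewrite !inE eqxx orbT.
have sJ x : x \in [:: y; x0] -> J x by rewrite !inE => /orP [] /eqP ->.
apply/star_fP; exists [:: y; x0]; split=> //.
  by apply: gen_sub => //; apply: ideal_module.
by apply: st_ext; [apply: Fbar_gen|apply: gen_mem; rewrite inE eqxx].
Qed.

Lemma star_closure_ideal J : ideal_in D J -> nonzero J -> ideal_in D (star_closure J).
Proof.
move=> iJ nzJ; have mJ := ideal_module iJ.
split; first by move=> x [].
split; first by apply: star_closure_sub => //; apply: (ideal0 iJ).
have key s x : nonzero (gen D s) -> (forall z, z \in s -> J z) -> st (gen D s) x -> star_f D st J x.
  by move=> nz sJ sx; apply/star_fP; exists s; split=> //; apply: gen_sub.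
split=> [x y [Jx Dx] [Jy Dy]|a x Da [Jx Dx]].
  split; last exact: subringB.
  have [|t [nzt tJ tx]] := @star_f_collect J [:: x; y] mJ nzJ.
    by move=> z; rewrite !inE => /orP [] /eqP ->.
  apply: (key t) => //; have /stF/Fbar_module [[m0 mD mM] _] := Fbar_gen nzt.
  apply: mD; first by apply: tx; rewrite inE eqxx.
  rewrite -mulN1r; apply: mM; first exact: subringN.
  by apply: tx; rewrite !inE eqxx orbT.
split; last exact: subringM.
have /star_fP [s [nz sJ _ sx]] := Jx; apply: (key s) => //.
by have /stF/Fbar_module [[m0 mD mM] _] := Fbar_gen nz; apply: mM.
Qed.

Lemma star_closure_idem J : ideal_in D J -> nonzero J ->
  subset (star_closure (star_closure J)) (star_closure J).
Proof.
move=> iJ nzJ y [+ Dy]; have mJ := ideal_module iJ.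
case/star_fP => s [nz sJ _ sy]; split=> //.
have [|t [nzt tJ ts]] := @star_f_collect J s mJ nzJ; first by move=> x /sJ [].
apply/star_fP; exists t; split=> //; first exact: gen_sub.
have Ft := Fbar_gen nzt; apply: (st_trans (Fbar_gen nz) Ft _ sy).
by apply: gen_sub => //; have /Fbar_module [] := stF Ft.
Qed.

Lemma star_closure_quasi J : ideal_in D J -> nonzero J ->
  quasi_ideal D (star_f D st) (star_closure J).
Proof.
move=> iJ nzJ; have iC := star_closure_ideal iJ nzJ.
have nzC := nonzero_sub (star_closure_sub iJ nzJ) nzJ.
by split=> //; split=> //; split; [apply: star_closure_idem|apply: star_closure_sub].
Qed.

(** Let [a b] be in [M] and [a] outside. By maximality [1] lies in the star of a finitely generated
    part of [M + a D]; multiplied by [b], this puts [b] into the star of a finitely generated ideal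
    inside [M]. *)
Lemma qmax_prime M : qmax D (star_f D st) M -> prime_in D M.
Proof.
case=> -[iM [nzM [qM _]]] [nM1 Mmax]; split=> //; split=> // a b Da Db Mab.
apply: NNPP => /not_or_and [nMa nMb].
pose J := plus M (fun y => exists2 d, D d & y = a * d).
have iJ : ideal_in D J.
  split.
    move=> _ [m [_ [Mm [d Dd ->] ->]]]; apply: subringD => //; first exact: (idealS iM).
    exact: subringM.
  split; first by apply: plusl; [exists 0; rewrite ?mulr0|apply: (ideal0 iM)].
  split=> [_ _ [m [_ [Mm [d Dd ->] ->]]] [n [_ [Mn [e De ->] ->]]]|
           c _ Dc [m [_ [Mm [d Dd ->] ->]]]].
    exists (m - n), (a * (d - e)); split; [exact: (idealB iM)| |ring].
    by exists (d - e) => //; apply: subringB.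
  exists (c * m), (a * (c * d)); split; [exact: (idealM iM)| |ring].
  by exists (c * d) => //; apply: subringM.
have MJ : subset M J by move=> m Mm; apply: plusl => //; exists 0; rewrite ?mulr0.
have nzJ := nonzero_sub MJ nzM.
have [[/star_fP [s [nz sJ _ s1]] _]|n1] := classic (star_closure J 1); last first.
  apply: nMa; apply: (Mmax _ (star_closure_quasi iJ nzJ) n1).
    by move=> m /MJ; apply: star_closure_sub.
  apply: star_closure_sub => //; apply: plusr; first exact: (ideal0 iM).
  by exists 1; rewrite ?mulr1.
have b0 : b != 0 by apply/eqP => z; apply: nMb; rewrite z; apply: (ideal0 iM).
apply: nMb; apply: qM; split=> //.
have Fs := Fbar_gen nz; exists (scale b (gen D s)); split; last split.
- exists [seq b * x | x <- s]; split; last first.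
    have [x [gx x0]] := nz; exists (b * x); split; first by exists x.
    exact: mulf_neq0.
  split=> [_ [_ [[c [sc [cD ->]]] ->]]|_ [c [sc [cD ->]]]].
    exists c; rewrite size_map; split=> //; split=> //; rewrite mulr_sumr.
    by apply: eq_bigr => i _; rewrite (nth_map 0) // mulrCA.
  rewrite size_map in sc *; exists (\sum_(i < size s) c`_i * s`_i); split.
    by exists c.
  by rewrite mulr_sumr; apply: eq_bigr => i _; rewrite (nth_map 0) // mulrCA.
- move=> _ [e [ge ->]]; have [m [_ [Mm [d Dd ->] ->]]] := gen_sub (ideal_module iJ) sJ ge.
  rewrite mulrDr; apply: (idealD iM); first exact: (idealM iM).
  by rewrite mulrA [b * a]mulrC; apply: (idealMr iM).
by apply: st_scale => //; exists 1; rewrite mulr1.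
Qed.

(** Zorn's lemma applies by finite character: if [1] is in [star_f] of the union of a chain,
    finitely many elements witness it, and they lie in one member. *)
Lemma qmax_above J : ideal_in D J -> nonzero J -> ~ star_f D st J 1 ->
  exists M, qmax D (star_f D st) M /\ subset J M.
Proof.
move=> iJ nzJ nJ1; pose F I := [/\ ideal_in D I, subset J I & ~ star_f D st I 1].
have [||M [[iM JM nM1] _ Mmax]] := @zorn_above K F J; first by split.
  move=> C [X CX] CF Ctot; have [iX JX _] := CF X CX.
  have two x y : (exists2 X, C X & X x) -> (exists2 X, C X & X y) ->
      exists X, [/\ C X, X x & X y].
    case=> Y CY Yx [Z CZ Zy]; case: (Ctot _ _ CY CZ) => h.
      by exists Z; split=> //; apply: h.
    by exists Y; split=> //; apply: h.
  split.
  - split; first by move=> x [Y CY Yx]; have [iY _ _] := CF Y CY; apply: (idealS iY).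
    split; first by exists X => //; apply: (ideal0 iX).
    split=> [x y Ux Uy|a x Da [Y CY Yx]].
      have [Y [CY Yx Yy]] := two x y Ux Uy; exists Y => //.
      by have [iY _ _] := CF Y CY; apply: (idealB iY).
    by exists Y => //; have [iY _ _] := CF Y CY; apply: (idealM iY).
  - by move=> x Jx; exists X => //; apply: JX.
  case/star_fP => s [nz sU _ s1].
  have [Y CY sY] : exists2 Y, C Y & forall x, x \in s -> Y x.
    elim: s sU {nz s1} => [_|x s IHs sU]; first by exists X.
    have [|Y CY sY] := IHs; first by move=> y ys; apply: sU; rewrite inE ys orbT.
    have [Z CZ Zx] := sU x (mem_head _ _).
    case: (Ctot _ _ CY CZ) => h; [exists Z => //|exists Y => //] => y;
      rewrite inE => /predU1P [->|/sY Yy] //; exact: h.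
  have [iY _ nY1] := CF Y CY; apply: nY1; apply/star_fP; exists s; split=> //.
  exact: (gen_sub (ideal_module iY)).
have nzM := nonzero_sub JM nzJ.
exists M; split=> //; split; last split.
- split=> //; split=> //; split; last exact: star_closure_sub.
  apply: Mmax; last exact: star_closure_sub.
  split; first exact: star_closure_ideal.
    by move=> x /JM; apply: star_closure_sub.
  by move=> c1; apply: nM1; case: (star_closure_idem iM nzM (conj c1 D1)).
- by move=> M1; apply: nM1; case: (star_closure_sub iM nzM M1).
move=> I [iI [nzI [qI _]]] nI1 MI; apply: Mmax => //; split=> //.
  by move=> x /JM /MI.
by move=> I1; apply: nI1; apply: qI.
Qed.

Lemma qmax_no1 M s : qmax D (star_f D st) M -> nonzero (gen D s) ->
  subset (gen D s) M -> ~ st (gen D s) 1.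
Proof.
case=> -[iM [nzM [qM _]]] [nM1 _] nz sM s1; apply: nM1; apply: qM; split=> //.
by apply/star_fP; exists s; split=> // x xs; apply/sM/gen_mem.
Qed.

(** If [P] lies in no quasi-maximal [M], an [x] in [P] outside [M] gives [1 = x / x] in [P D_M] for
    each [M], so [1] is in [P]. Conversely, [P D_M] meets [D] in [P] when [P] lies in [M]. *)
Lemma qprime_tildeP P : qprime D (star_tilde D st) P <->
  [/\ prime_in D P, nonzero P & exists2 M, qmax D (star_f D st) M & subset P M].
Proof.
split=> [[[iP [nzP [qP _]]] pP]|[pP nzP [M qM PM]]].
  split=> //; apply: NNPP => nM; case: pP => _ [nP1 _]; apply: nP1; apply: qP.
  split=> // M qM; apply: NNPP => next; apply: nM; exists M => // x Px.
  apply: NNPP => nMx; apply: next; exists [:: (x, 1, x)]; split.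
    by move=> t; rewrite inE => /eqP -> /=; split=> //; split=> //; split=> //; apply: (idealS iP).
  rewrite big_seq1 /= mul1r mulfV //; apply/eqP => x0; apply: nMx; rewrite x0.
  exact: (ideal0 (qmax_prime qM).1).
have iP := pP.1; split=> //; split=> //; split=> //; split=> [y [ty Dy]|y Py].
  have [s [Hs ey]] := ty M qM; have pM := qmax_prime qM.
  have [d [Dd nMd dy]] : exists d, [/\ D d, ~ M d & P (d * y)].
    rewrite ey; elim: s Hs {ey} => [_|t s IHs Hs].
      exists 1; split=> //; first by case: pM => _ [].
      by rewrite big_nil mulr0; apply: (ideal0 iP).
    have [|d [Dd nMd dy]] := IHs; first by move=> u us; apply: Hs; rewrite inE us orbT.
    have [Pt [Dt [Dt' nMt]]] := Hs t (mem_head _ _).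
    have t0 : t.2 != 0 by apply/eqP => z; apply: nMt; rewrite z; apply: (ideal0 pM.1).
    exists (d * t.2); split; first exact: subringM.
      by case/(prime_mul pM Dd Dt').
    rewrite big_cons mulrDr (_ : d * t.2 * (t.1.1 * _) = d * t.1.2 * t.1.1); last by field.
    apply: (idealD iP); first by apply: (idealM iP) => //; apply: subringM.
    by rewrite mulrAC; apply: (idealMr iP).
  by case: (prime_mul pP Dd Dy dy) => // /PM.
split; last exact: (idealS iP).
move=> N qN; have pN := qmax_prime qN; exists [:: (y, 1, 1)]; split.
  by move=> t; rewrite inE => /eqP -> /=; split=> //; split=> //; split=> //; case: pN => _ [].
by rewrite big_seq1 /= divr1 mulr1.
Qed.

(** Were the contraction in no quasi-maximal ideal, it would contain a finitely generated ideal with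
    the star of [D]; linkedness then puts [1] into [N]. *)
Lemma linked_contract T N : overring D T -> linked D st T -> prime_in T N -> nonzero N ->
  qprime D (star_tilde D st) (fun x => D x /\ N x).
Proof.
move=> [sT DT] lT pN [x [Nx x0]]; have iN := pN.1.
have pC := prime_contract sD DT pN.
have nzC : nonzero (fun x => D x /\ N x).
  have [_ /(_ x) [a [b [Da [Db [b0 ex]]]]]] := hD; exists a; split.
    split=> //; rewrite (_ : a = b * x); last by rewrite ex mulrC divfK.
    by apply: (idealM iN) => //; apply: DT.
  by apply: contra_neq x0 => a0; rewrite ex a0 mul0r.
apply/qprime_tildeP; split=> //.
have [|M [qM CM]] := qmax_above pC.1 nzC; last by exists M.
case/star_fP => s [nz sC gC s1]; case: pN => _ [nN1 _]; apply: nN1.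
have Fs := Fbar_gen nz.
have e : set_eq (st (gen D s)) (st D).
  split; first by apply: st_mono => //; [apply: Fbar_D|move=> y /gC []].
  apply: st_trans => //; first exact: Fbar_D.
  move=> d Dd; have /Fbar_module [[_ _ mM] _] := stF Fs.
  by rewrite -[d]mulr1; apply: mM.
have [_ /(_ 1 (subring1 sT)) [l [Hl ->]]] := lT s (fun y gy => proj1 (gC y gy)) nz e.
apply: addgrp_sum_seq => [|t /Hl [gt Tt]]; first exact: ideal_addgrp iN.
by apply: (idealMr iN) => //; case: (gC _ gt).
Qed.

(** A finitely generated ideal with the star of [D] is not inside [M], hence not inside [P], so it
    contains a unit of [D_P]. *)
Lemma loc_linked P T : qprime D (star_tilde D st) P -> subring T ->
  subset (loc D (compl D P)) T -> overring D T /\ linked D st T.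
Proof.
move=> /qprime_tildeP [pP nzP [M qM PM]] sT lT.
have mP := compl_mult sD pP.
have DT : subset D T by move=> d Dd; apply/lT/(loc_base mP).
split=> // s sDs nz [_ se].
have s1 : st (gen D s) 1 by apply: se; apply: st_ext => //; apply: Fbar_D.
have [x gx nMx] : exists2 x, gen D s x & ~ M x.
  apply: NNPP => h; apply: (qmax_no1 qM nz _ s1) => x gx.
  by apply: NNPP => nMx; apply: h; exists x.
split=> [_ [l [Hl ->]]|t Tt].
  apply: addgrp_sum_seq => [|u /Hl [gu Tu]]; first exact: subring_addgrp.
  by apply: subringM => //; apply/DT/sDs.
have x0 : x != 0 by apply/eqP => z; apply: nMx; rewrite z; apply: (ideal0 (qmax_prime qM).1).
exists [:: (x, x^-1 * t)]; split; last by rewrite big_seq1 /= mulVKf.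
move=> u; rewrite inE => /eqP -> /=; split=> //; apply: subringM => //.
apply/lT/(loc_inv mP) => //; split; first exact: sDs.
by move/PM.
Qed.

End Star.

(** * The pullback of [D_P] along a valuation ring *)

Section Pullback.
Variable K : fieldType.
Implicit Types (A D I J N P R T V W : set K) (f g : {poly K}).

Lemma prime_restrict T R N : subring R -> subset R T -> subset N R ->
  prime_in T N -> prime_in R N.
Proof.
move=> sR RT NR pN; have iN := pN.1; split.
  split=> //; split; first exact: (ideal0 iN).
  split; first by move=> x y; apply: (idealB iN).
  by move=> a x Ra; apply: (idealM iN); apply: RT.
split; first by case: pN => _ [].
by move=> a b Ra Rb; apply: (prime_mul pN); apply: RT.
Qed.

(** Dropping from [f] its low part over [N] and cancelling a power of [u] gives [g(u)] in [N] with
    [g_0] outside [N]. As [u] is in [N'], so is [g_0]. *)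
Lemma incomparable T D N N' u f : subring T -> subset D T -> prime_in T N -> prime_in T N' ->
  subset N N' -> N' u -> ~ N u -> coefs_in D f -> ~ coefs_in N f -> f.[u] = 0 ->
  exists d, [/\ D d, N' d & ~ N d].
Proof.
move=> sT DT pN pN' NN' N'u nNu Df nf fu; have iN := pN.1; have iN' := pN'.1.
have Tu := idealS iN' N'u.
have [n [g [h [ef Nh ng gf]]]] := split_low (ideal0 iN) nf.
have Tg : coefs_in T g by move=> i; rewrite gf; apply: DT.
have Tgu : T g.[u] by apply: coefs_horner_ring.
have Ngu : N (g.[u] * u ^+ n).
  rewrite (_ : _ * _ = - h.[u]); last first.
    by apply/eqP; rewrite -addr_eq0 addrC -hornerXn -hornerM -hornerD -ef fu.
  by apply: (idealN iN); apply: (coefs_horner iN sT).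
have {}Ngu : N g.[u].
  case: (prime_mul pN Tgu (subringX n sT Tu) Ngu) => // /(prime_exp sT pN Tu) //.
exists g`_0; split=> //; first by rewrite gf.
rewrite (_ : g`_0 = g.[u] - (g.[u] - g`_0)); last by rewrite opprB addrC subrK.
by apply: (idealB iN'); [apply: NN'|apply: (horner_mod sT iN')].
Qed.

Lemma ideals_total V I J : val_ring V -> ideal_in V I -> ideal_in V J ->
  subset I J \/ subset J I.
Proof.
move=> [sV vV] iI iJ; have [IJ|nIJ] := classic (subset I J); [by left|right=> y Jy].
have [x [Ix nJx]] : exists x, I x /\ ~ J x.
  by apply: NNPP => n; apply: nIJ => x Ix; apply: NNPP => nJ; apply: n; exists x.
have x0 : x != 0 by apply/eqP => z; apply: nJx; rewrite z; apply: (ideal0 iJ).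
have [->|y0] := eqVneq y 0; first exact: (ideal0 iI).
have [Vxy|Vyx] : V (x / y) \/ V (y / x).
  by rewrite -[y / x]invf_div; apply: vV; rewrite mulf_neq0 ?invr_eq0.
  by case: nJx; rewrite -(divfK y0 x); apply: (idealM iJ).
by rewrite -(divfK x0 y); apply: (idealM iI).
Qed.

Lemma loc_prime A P : subring A -> prime_in A P ->
  prime_in (loc A (compl A P)) (loc P (compl A P)).
Proof.
move=> sA pP; have mS := compl_mult sA pP; have iP := pP.1; split; first exact: loc_ideal.
split.
  case=> p [s [Pp [As ns] e]]; apply: (ns); suff -> : s = p by [].
  by rewrite -[s]mul1r e divfK // (mult_neq0 mS (conj As ns)).
move=> _ _ [a [s [Aa Ss ->]]] [b [t [Ab St ->]]] [p [w [Pp Sw e]]].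
have s0 := mult_neq0 mS Ss; have t0 := mult_neq0 mS St; have w0 := mult_neq0 mS Sw.
have [As _] := Ss; have [At _] := St; have [Aw nw] := Sw.
have : P (w * (a * b)).
  rewrite (_ : _ * _ = (w * s * t) * (a / s * (b / t))); last by field; rewrite s0 t0.
  rewrite e (_ : _ * _ = (s * t) * p); last by field.
  by apply: (idealM iP) => //; apply: subringM.
case/(prime_mul pP Aw (subringM sA Aa Ab)) => // /(prime_mul pP Aa Ab) [Pa|Pb].
  by left; exists a, s.
by right; exists b, t.
Qed.

Variables (D P V : set K) (u : K).
Hypotheses (sD : subring D) (pP : prime_in D P) (vV : val_ring V).
Hypotheses (DV : subset D V) (Vu : V u).
Hypothesis uP : forall f, coefs_in D f -> maxid V f.[u] <-> coefs_in P f.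

Let S := compl D P.
Let DP := loc D S.
(** The preimage in [V] of the residue field of [P]: a local ring that shares its maximal ideal with
    [V], by [pullback_inv]. *)
Let R := plus DP (maxid V).
Let iM := maxid_ideal vV.
Let sV : subring V. Proof. by case: vV. Qed.
Let mS : mult_set D S. Proof. exact: compl_mult. Qed.
Let iP := pP.1.

Lemma maxid_contract d : D d -> maxid V d <-> P d.
Proof.
move=> Dd; have Dc : coefs_in D d%:P by apply: coefs_C => //; apply: subring0.
have := uP Dc; rewrite hornerC => ->; split=> [/(_ 0%N)|Pd]; first by rewrite coefC.
by apply: coefs_C => //; apply: (ideal0 iP).
Qed.

Lemma compl_unit s : S s -> ~ maxid V s.
Proof. by move=> [Ds ns] /(maxid_contract Ds). Qed.

Lemma loc_sub_val : subset DP V.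
Proof.
move=> _ [d [s [Dd Ss ->]]]; apply: subringM => //; first exact: DV.
by apply: not_maxid; apply: compl_unit.
Qed.

Lemma pullback_subring : subring R.
Proof. by apply: plus_subring iM => //; [apply: loc_subring|apply: loc_sub_val]. Qed.

Lemma pullback_sub : subset R V.
Proof.
move=> _ [d [m [Dd Mm ->]]]; apply: subringD => //; first exact: loc_sub_val.
exact: maxidS.
Qed.

Lemma pullback_loc : subset DP R.
Proof. by move=> x DPx; apply: plusl => //; apply: (ideal0 iM). Qed.

Lemma pullback_maxid : subset (maxid V) R.
Proof.
move=> x Mx; apply: plusr => //; exact: (subring0 (loc_subring sD mS)).
Qed.

Lemma pullback_inv r : R r -> ~ maxid V r -> R r^-1.
Proof.
move=> [_ [m [[d [s [Dd Ss ->]]] Mm ->]]] nm.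
have s0 := mult_neq0 mS Ss.
have nds : ~ maxid V (d / s).
  by move=> mds; apply: nm; apply: (idealD iM).
have Sd : S d.
  split=> // /(maxid_contract Dd) md; apply: nds.
  by apply: (idealMr iM) => //; apply: not_maxid; apply: compl_unit.
have d0 := mult_neq0 mS Sd; have r0 := not_maxid0 nm.
exists (s / d), (- (m * ((s / d) * (d / s + m)^-1))); split.
- by exists s, d; split=> //; case: Ss.
- apply: (idealN iM); apply: (idealMr iM) => //; apply: subringM => //.
    by apply: loc_sub_val; exists s, d; split=> //; case: Ss.
  exact: not_maxid.
apply: (mulIf r0); rewrite mulVf // mulrDl mulNr -!mulrA mulVf // mulr1.
by field; rewrite s0 d0.
Qed.

Lemma pullback_prime_sub N : prime_in R N -> subset N (maxid V).
Proof.
move=> pN x Nx; apply: NNPP => nm; case: (pN) => _ [nN1 _]; apply: nN1.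
rewrite -(mulfV (not_maxid0 nm)); apply: (idealMr pN.1) => //.
by apply: pullback_inv => //; apply: (idealS pN.1).
Qed.

(** For [x] in [N], [v] in [V] and [m] in [maxid V] outside [N], the product [(v m) x] is in [N]
    because [v m] lies in [R]; primality then gives [v x] in [N]. *)
Lemma pullback_prime N : prime_in R N -> prime_in V N.
Proof.
move=> pN; have NM := pullback_prime_sub pN; have iN := pN.1.
have [MN|nMN] := classic (subset (maxid V) N).
  have -> : N = maxid V.
    by apply: boolp.funext => x; apply: boolp.propext; split; [apply: NM|apply: MN].
  exact: maxid_prime.
have [m [Mm nNm]] : exists m, maxid V m /\ ~ N m.
  by apply: NNPP => n; apply: nMN => x Mx; apply: NNPP => nN; apply: n; exists x.
have Rm := pullback_maxid Mm.
have VN v x : V v -> N x -> N (v * x).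
  move=> Vv Nx; have Mvx : maxid V (v * x) by apply: (idealM iM) => //; apply: NM.
  case: (prime_mul pN (pullback_maxid Mvx) Rm) => //.
  rewrite mulrAC mulrC; apply: (idealMr iN) => //; apply: pullback_maxid.
  by apply: (idealM iM).
split; last split.
- split; first by move=> x /NM /(maxidS vV).
  split; first exact: (ideal0 iN).
  by split=> // x y; apply: (idealB iN).
- by case: pN => _ [].
move=> a b Va Vb Nab.
have [ma|na] := classic (maxid V a); last first.
  right; rewrite -(mulKf (not_maxid0 na) b); apply: VN => //; exact: not_maxid.
have [mb|nb] := classic (maxid V b); last first.
  left; rewrite -(mulfK (not_maxid0 nb) a) mulrC; apply: VN => //; exact: not_maxid.
by apply: (prime_mul pN) => //; apply: pullback_maxid.
Qed.

(** The residue field of [R] is the fraction field of [D / P], so the transcendence in [uP] carries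
    over after clearing denominators. *)
Lemma pullback_transc f : coefs_in R f -> maxid V f.[u] -> coefs_in (maxid V) f.
Proof.
move=> Rf mf; have DP0 : DP 0 by apply: (subring0 (loc_subring sD mS)).
have [g DPg Mg] := lift_coefs DP0 (ideal0 iM) Rf.
have [s Ss Dsg] := loc_common_denom sD mS (ideal_self sD) DPg.
have s0 := mult_neq0 mS Ss; have Vs : V s by apply: DV; case: Ss.
have mg : maxid V (s *: g).[u].
  rewrite hornerZ; apply: (idealM iM) => //.
  have -> : g.[u] = f.[u] - (f - g).[u] by rewrite hornerD hornerN; ring.
  by apply: (idealB iM) => //; apply: (coefs_horner iM sV).
have Pg := proj1 (uP Dsg) mg => i.
have -> : f`_i = (f - g)`_i + s^-1 * (s *: g)`_i by rewrite coefB coefZ mulKf // subrK.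
apply: (idealD iM) => //; apply: (idealM iM); first by apply: not_maxid; apply: compl_unit.
by apply/maxid_contract.
Qed.

(** Primes of [R] are primes of [V], hence of every valuation ring [W] inside [V]. As [u] is a unit
    of [V], it separates [maxid W] from all of them and lengthens any chain of [R]. *)
Lemma pullback_not_jaffard : ~ jaffard R.
Proof.
case=> n [[[c [cp cs]] _] [noW _]].
have sR := pullback_subring; have iMR : ideal_in R (maxid V).
  split; first exact: pullback_maxid.
  split; first exact: (ideal0 iM).
  split; first by move=> x y; apply: (idealB iM).
  by move=> a x /pullback_sub; apply: (idealM iM).
have nmu : ~ maxid V u.
  move=> mu; have DX := coefs_X sD; have := uP DX; rewrite hornerX => -[/(_ mu)/(_ 1%N)].
  by rewrite coefX => P1 _; case: pP => _ [nP1 _]; apply: nP1.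
have [|W [vW RW mWu VW _]] := chevalley_adj (t := u) sR iMR (mult_set1 sR).
  move=> F RF MF0 F1; have RF1 : coefs_in R (F - 1).
    by apply: (subringB (coefs_subring sR)) => //; apply: (subring1 (coefs_subring sR)).
  have := pullback_transc RF1; rewrite hornerD hornerN hornerC F1 subrr.
  move=> /(_ (or_introl erefl))/(_ 0%N); rewrite coefB coefC eqxx => m.
  by apply: (maxid1 sV); rewrite -(subKr F`_0 1); apply: (idealB iM).
have WV := maxid_anti vV vW VW; have [sW _] := vW.
apply: (noW W); first by split; [split|case: vW].
exists (fun i => if (i <= n)%N then c i else maxid W); split=> i.
  move=> _; case: leqP => [le|_]; last exact: maxid_prime.
  have pc := cp i le; apply: prime_restrict (pullback_prime pc) => //.
  by move=> x /(pullback_prime_sub pc) /VW; apply: maxidS.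
rewrite ltnS => le; rewrite le; case: ltnP => [lt|ge]; first exact: cs.
have cM := pullback_prime_sub (cp i le).
split; first by move=> x /cM /VW.
by exists u; split=> // /cM.
Qed.

(* The upper prime [f.[u] in N] separates the extensions of [N] and [maxid V]. *)
Lemma pullback_not_strong_S N : prime_in V N -> ssubset N (maxid V) ->
  (forall N', prime_in V N' -> ssubset N N' -> ~ ssubset N' (maxid V)) -> ~ strong_S R.
Proof.
move=> pN [NM [m [Mm nNm]]] adj strong.
have sR := pullback_subring; have sRX := coefs_subring sR; have iN := pN.1.
have NR : subset N R by move=> x /NM /pullback_maxid.
have pNR := prime_restrict sR pullback_sub NR pN.
have pMR := prime_restrict sR pullback_sub pullback_maxid (maxid_prime vV).
have Vf f : coefs_in R f -> V f.[u].
  by move=> Rf; apply: coefs_horner_ring => // i; apply: pullback_sub.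
apply: (strong N (maxid V) pNR pMR); first by split=> //; exists m.
  by case=> N' [pN' [NN' N'M]]; apply: (adj N') => //; apply: pullback_prime.
exists (fun f => coefs_in R f /\ N f.[u]); split; last split.
- split.
    split; first by move=> f [].
    split; first by split; [apply: (subring0 sRX)|rewrite horner0; apply: (ideal0 iN)].
    split=> [f g [Rf Nf] [Rg Ng]|f g Rf [Rg Ng]].
      by split; [apply: (subringB sRX)|rewrite hornerD hornerN; apply: (idealB iN)].
    by split; [apply: (subringM sRX)|rewrite hornerM; apply: (idealM iN) => //; apply: Vf].
  split; first by case=> _; rewrite hornerC; case: pN => _ [].
  move=> f g Rf Rg [_]; rewrite hornerM => /(prime_mul pN (Vf _ Rf) (Vf _ Rg)).
  by case=> ?; [left|right].
- split.
    move=> f Nf; split; first by move=> i; apply: NR.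
    exact: (coefs_horner iN sV).
  (* This polynomial vanishes at [u]; its coefficients lie in [maxid V], hence in [R] even where [u]
     does not, and [m] is outside [N]. *)
  exists (m *: 'X - (m * u)%:P); split; last first.
    move/(_ 1%N); rewrite coefB coefZ coefX coefC mulr1 subr0; exact: nNm.
  split; last by rewrite hornerD hornerN hornerZ hornerX hornerC subrr; apply: (ideal0 iN).
  apply: (subringB sRX).
    rewrite -mul_polyC; apply: (subringM sRX); last exact: coefs_X.
    by apply: coefs_C; [apply: subring0|apply: pullback_maxid].
  apply: coefs_C; first exact: subring0.
  by apply: pullback_maxid; apply: (idealMr iM).
split.
  by move=> f [Rf Nf]; apply: pullback_transc => //; apply: NM.
exists m%:P; split; last by case=> _; rewrite hornerC.
by apply: coefs_C => //; apply: (ideal0 iM).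
Qed.

End Pullback.

(** * Extended primes of a polynomial ring *)

Lemma poly_sum_coefs (B : comNzRingType) (S : set B) (Q : set {poly B}) (f : {poly B}) : subring S ->
  ideal_in (coefs_in S) Q -> (forall i, Q (f`_i)%:P) -> Q f.
Proof.
move=> sS iQ Qf; rewrite -(coefK f) poly_def; apply: addgrp_sum => [|i _].
  exact: ideal_addgrp iQ.
rewrite -mul_polyC; apply: (idealMr iQ) => //.
exact: (subringX _ (coefs_subring sS) (coefs_X sS)).
Qed.

(* Lift [Q <= P[X]] to valuation rings [W <= W1] of [K(X)]. Since [W] is residually
   algebraic over [D] on [K], while [X] is residually transcendental, dividing [f] in [Q]
   by its coefficient of least value gives a unit of [W]. *)
Lemma prime_extended (K : fieldType) (D P : set K) (Q : set {poly K}) :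
  subring D -> prime_in D P -> alg_at D P -> prime_in (coefs_in D) Q ->
  subset Q (coefs_in P) -> set_eq Q (coefs_in (fun a => Q a%:P)).
Proof.
move=> sD pP algP_ pQ QP; have iQ := pQ.1; have sDX := coefs_subring sD.
have iP := pP.1; have pPX := coefs_prime sD pP.
split; last by move=> f Qf; apply: (poly_sum_coefs sD).
have sT : subring (fun _ : {poly K} => True) by do !split.
have p0 : prime_in (fun _ : {poly K} => True) (fun f => f = 0).
  split; first by split=> //; split=> //; split=> [x y -> ->|a x _ ->]; rewrite ?subrr ?mulr0.
  split; first by move/eqP; rewrite oner_eq0.
  by move=> a b _ _ /eqP; rewrite mulf_eq0 => /orP [] /eqP; [left|right].
(* [L] is [K(X)], obtained as the residue field of [K[X]] at its zero prime. *)
have [L [phi [hphi0 ker _]]] := residue_field_hom sT p0.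
have [phi1 phiB phiM] := hphi0.
have [i ei] : exists i : {rmorphism K -> L}, forall x, i x = phi x%:P.
  apply: rmorphism_of; split=> [|x y _ _|x y _ _]; first exact: phi1.
    by rewrite -phiB // polyCB.
  by rewrite -phiM // polyCM.
have hphi : hom_on (coefs_in D) phi by split=> // x y _ _; [apply: phiB|apply: phiM].
have inj f g : phi f = phi g -> f = g.
  by move=> e; apply/eqP; rewrite -subr_eq0; apply/eqP/ker => //; rewrite phiB // e subrr.
pose t := phi 'X.
have ephi f : phi f = (map_poly i f).[t].
  rewrite (@hom_poly _ _ (fun _ => True)) //; last first.
    by split=> // x y _ _; [apply: phiB|apply: phiM].
  congr (_.[_]); apply/polyP => k; rewrite coef_poly coef_map /= ei.
  by case: ltnP => // le; rewrite (nth_default _ le) -ei rmorph0.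
pose A := image_set phi (coefs_in D).
have sA : subring A by apply: (image_subring sDX hphi).
have kerI I : I 0 -> forall f, coefs_in D f -> phi f = 0 -> I f.
  by move=> I0 f _ /ker; move=> /(_ Logic.I) ->.
have pQ' : prime_in A (image_set phi Q).
  by apply: (image_prime sDX hphi pQ); apply: kerI; apply: (ideal0 iQ).
have pP' : prime_in A (image_set phi (coefs_in P)).
  by apply: (image_prime sDX hphi pPX); apply: kerI; apply: (ideal0 pPX.1).
have mem (X : set {poly K}) f : image_set phi X (phi f) -> X f by case=> g Xg /inj ->.
have [|W1 [vW1 AW1 QW1 SW1]] := chevalley sA pQ'.1 (compl_mult sA pQ'); first by move=> s [].
have W1Q a : A a -> maxid W1 a -> image_set phi Q a.
  by move=> Aa ma; apply: NNPP => nQ; apply: (SW1 a).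
have [|W [vW AW W1W WP]] := chevalley_chain sA vW1 AW1 pP'.
  by move=> a Aa /(W1Q a Aa) [f /QP Pf ->]; exists f.
have WW1 := maxid_anti vW1 vW W1W; have [sW _] := vW; have iM1 := maxid_ideal vW1.
have CD d : D d -> coefs_in D d%:P by apply: coefs_C; apply: subring0.
have Ai d : D d -> A (i d) by move=> Dd; exists d%:P; rewrite ?ei //; apply: CD.
have At : A t by exists 'X => //; apply: coefs_X.
have sD' : subring (img i D) by apply: img_subring.
have D'W : subset (img i D) W by move=> _ [d Dd ->]; apply/AW/Ai.
have fK := range_subfield i; have sC := inter_subring vW fK.
have CW : subset (inter W (range i)) W by move=> x [].
have MP d : D d -> maxid W (i d) -> P d.
  move=> Dd /(WP _ (Ai d Dd)); rewrite ei => /mem /(_ 0%N).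
  by rewrite coefC.
have Cr : subset (inter W (range i)) (ralg W (img i D)).
  move=> _ [[k ->] Wk]; apply/ralgP => //.
  have [f [Df nf fk]] := algP_ k; exists (map_poly i f); split.
  - exact/img_coefs.
  - by move=> mf; apply: nf => j; apply: MP => //; have := mf j; rewrite coef_map.
  - by rewrite horner_map fk rmorph0; left.
have nrt : ~ ralg W (img i D) t.
  move/(ralgP vW sD' D'W (AW _ At)) => [h [Dh nh mh]].
  have [h0 Dh0 eh] := coefs_imgP Dh; apply: nh; rewrite eh in mh *.
  have Ah0 : A (phi h0) by exists h0.
  move: mh; rewrite -ephi => /(WP _ Ah0) /mem Ph k.
  rewrite coef_map /= ei; apply/WP; first by rewrite -ei; apply: Ai.
  by exists (h0`_k)%:P => //; apply: coefs_C => //; apply: (ideal0 iP).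
move=> f Qf j; have [->|f0] := eqVneq f 0.
  by rewrite coef0; apply: (ideal0 iQ).
have mf0 : map_poly i f != 0 by rewrite map_poly_eq0.
have [k [fk Wg]] := max_coef vW mf0; set g := _ *: _ in Wg.
have Cg : coefs_in (inter W (range i)) g.
  move=> l; split=> //; exists ((f`_k)^-1 * f`_l).
  by rewrite coefZ !coef_map rmorphM fmorphV.
have ng : ~ maxid W g.[t].
  move=> mg; apply: nrt; apply: (ralg_trans vW sD' D'W Cr).
  apply/ralgP => //; first exact: AW.
  exists g; split=> //; move/(_ k); rewrite coefZ mulVf //.
  exact: (maxid1 sW).
have Df := idealS iQ Qf.
have m1 : maxid W1 (map_poly i f)`_k.
  have -> : (map_poly i f)`_k = phi f * (g.[t])^-1.
    rewrite ephi /g hornerZ invfM invrK mulrCA mulfV ?mulr1 //.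
    by have := not_maxid0 ng; rewrite /g hornerZ mulf_eq0 negb_or => /andP [].
  by apply: (idealMr iM1); [apply: WW1; apply: not_maxid|apply: QW1; exists f].
have : maxid W1 (i f`_j).
  have -> : i f`_j = (map_poly i f)`_k * g`_j by rewrite coefZ mulVKf // coef_map.
  by apply: (idealMr iM1) => //; apply: WW1.
by move/(W1Q _ (Ai _ (Df j))); rewrite ei => /mem.
Qed.

(** * Chains of primes in overrings and valuation overrings *)

Lemma val_prime_sub (K : fieldType) (V N : set K) : val_ring V -> prime_in V N ->
  subset N (maxid V).
Proof.
move=> vV pN x Nx; apply: NNPP => nm; case: (pN) => _ [nN1 _]; apply: nN1.
by rewrite -(mulfV (not_maxid0 nm)); apply: (idealMr pN.1) => //; apply: not_maxid.
Qed.

(** Each step shrinks the valuation ring by [chevalley_chain]. The primes found so far remain primes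
    of the smaller ring, whose maximal ideal is put on top. *)
Lemma chain_lift (K : fieldType) (T : set K) c d : subring T -> chain_in T c d ->
  exists V c', [/\ val_ring V, subset T V, chain_in V c' d &
    forall a, T a -> maxid V a <-> c d a].
Proof.
move=> sT; elim: d => [|d IHd] [cp cs].
  have pc := cp 0%N isT.
  have [|V [vV TV cV SV]] := chevalley sT pc.1 (compl_mult sT pc); first by move=> s [].
  exists V, (fun _ => maxid V); split=> //.
    by split=> // i _; apply: maxid_prime.
  move=> a Ta; split=> [ma|/cV //]; apply: NNPP => na; exact: (SV a).
have [|V [c' [vV TV [c'p c's] Vc]]] := IHd.
  by split=> i le; [apply: cp; apply: leqW|apply: cs; apply: leqW].
have [cc [x [cx ncx]]] := cs d (ltnSn d).
have pc := cp d.+1 (leqnn _).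
have [|W [vW TW VW Wc]] := chevalley_chain sT vV TV pc.
  by move=> a Ta /(Vc a Ta) /cc.
have WV := maxid_anti vV vW VW; have [sW _] := vW.
exists W, (fun i => if (i <= d)%N then c' i else maxid W); split=> //.
split=> i.
  move=> _; case: leqP => [le|_]; last exact: maxid_prime.
  have pc' := c'p i le; apply: (prime_restrict sW WV _ pc').
  by move=> y /(val_prime_sub vV pc') /VW; apply: maxidS.
rewrite ltnS => le; rewrite le; case: ltnP => [lt|ge]; first exact: c's.
have e : i = d by apply/eqP; rewrite eqn_leq le.
have c'M := val_prime_sub vV (c'p i le).
split; first by move=> y /c'M /VW.
have Tx := idealS pc.1 cx.
by exists x; split; [apply/Wc|move/c'M/(Vc x Tx)].
Qed.

(** Only strictness is at stake: contracted primes might coincide, which [incomparable] prevents by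
    means of the equations outside [c i]. *)
Lemma chain_contract (K : fieldType) (A T : set K) c d : subring A -> subring T -> subset A T ->
  (forall i, (i < d)%N -> forall u, exists f : {poly K},
     [/\ coefs_in A f, ~ coefs_in (c i) f & f.[u] = 0]) ->
  chain_in T c d -> chain_in A (fun i x => A x /\ c i x) d.
Proof.
move=> sA sT AT alg_ [cp cs]; split=> i le.
  exact: (prime_contract sA AT (cp i le)).
have [cc [u [cu ncu]]] := cs i le.
have pc := cp i (ltnW le); have pc' := cp i.+1 le.
have [f [Af nf fu]] := alg_ i le u.
have [x [Ax cx ncx]] := incomparable sT AT pc pc' cc cu ncu Af nf fu.
split; first by move=> y [Ay cy]; split=> //; apply: cc.
by exists x; split=> // -[].
Qed.

Lemma chain_mono (B : comNzRingType) (T : set B) c d i j : chain_in T c d ->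
  (i <= j)%N -> (j <= d)%N -> subset (c i) (c j).
Proof.
move=> [_ cs]; elim: j => [|j IHj]; first by rewrite leqn0 => /eqP -> _ x.
rewrite leq_eqVlt => /predU1P [-> _ x //|ij] jd x cx.
by have [h _] := cs j jd; apply: h; exact: (IHj ij (ltnW jd) x cx).
Qed.

Lemma zero_prime (K : fieldType) (T : set K) : subring T -> prime_in T (@zeroS K).
Proof.
move=> sT; split; first exact: zero_ideal.
split; first by move/eqP; rewrite oner_eq0.
by move=> a b _ _ /eqP; rewrite mulf_eq0 => /orP [] /eqP; [left|right].
Qed.

Lemma alg_at_zero (K : fieldType) (D T P : set K) : domain_with_qf D -> overring D T ->
  (forall x, P x -> x = 0) -> alg_at T P.
Proof.
move=> [sD frD] [sT DT] P0 u; have [a [b [Da [Db [b0 ->]]]]] := frD u.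
exists (b *: 'X - a%:P); split.
- apply: (subringB (coefs_subring sT)).
    rewrite -mul_polyC; apply: (subringM (coefs_subring sT)); last exact: coefs_X.
    by apply: coefs_C; [apply: subring0|apply: DT].
  by apply: coefs_C; [apply: subring0|apply: DT].
- move/(_ 1%N)/P0; rewrite coefB coefZ coefX coefC mulr1 subr0; exact/eqP.
by rewrite hornerD hornerN hornerZ hornerX hornerC mulrC divfK // subrr.
Qed.

(* [Q] is the kernel of the evaluation at [u]; it contracts to [0] but is nonzero. *)
Lemma alg_at_of_extended (K : fieldType) (D T P : set K) : domain_with_qf D -> overring D T ->
  (forall Q, prime_in (coefs_in T) Q -> subset Q (coefs_in P) ->
     set_eq Q (coefs_in (fun a => Q a%:P))) -> alg_at T P.
Proof.
move=> hD oT ext u; apply: NNPP => bad; have [sD frD] := hD; have [sT DT] := oT.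
have sTX := coefs_subring sT.
pose Q : set {poly K} := fun f => coefs_in T f /\ f.[u] = 0.
have pQ : prime_in (coefs_in T) Q.
  split.
    split; first by move=> f [].
    split; first by split; [apply: (subring0 sTX)|rewrite horner0].
    split=> [f g [Tf fu] [Tg gu]|f g Tf [Tg gu]].
      by split; [apply: (subringB sTX)|rewrite hornerD hornerN fu gu subrr].
    by split; [apply: (subringM sTX)|rewrite hornerM gu mulr0].
  split; first by case=> _ /eqP; rewrite hornerC oner_eq0.
  move=> f g Tf Tg [_ /eqP]; rewrite hornerM mulf_eq0 => /orP [] /eqP ?; by [left|right].
have QP : subset Q (coefs_in P).
  by move=> f [Tf fu]; apply: NNPP => nf; apply: bad; exists f.
have [QE _] := ext Q pQ QP.
have [f [Tf nf fu]] := @alg_at_zero K D T (@zeroS K) hD oT (fun x e => e) u.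
apply: nf => i; have [_] := QE f (conj Tf fu) i.
by rewrite hornerC.
Qed.

(** * The algebraic condition and properties of linked overrings *)

Section Linked.
Variables (K : fieldType) (D : set K) (st : set K -> set K).
Hypotheses (hD : domain_with_qf D) (hst : semistar D st).

Local Notation tilde := (star_tilde D st).

Let sD : subring D. Proof. by case: hD. Qed.
Let oD : overring D D. Proof. by split=> // x. Qed.

Definition alg_at_qprimes := forall P, qprime D tilde P -> alg_at D P.

Lemma qprime_sub P p : qprime D tilde P -> prime_in D p -> subset p P -> nonzero p ->
  qprime D tilde p.
Proof.
move=> /(qprime_tildeP hD hst) [_ _ [M qM PM]] pp pP nz.
by apply/(qprime_tildeP hD hst); split=> //; exists M => // x /pP /PM.
Qed.

(** A nonzero [N] contracts to a quasi-prime of [D]; for the zero prime the linear equation of the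
    fraction [u] serves. *)
Lemma linked_alg T N : alg_at_qprimes -> overring D T -> linked D st T -> prime_in T N ->
  forall u, exists f : {poly K}, [/\ coefs_in D f, ~ coefs_in N f & f.[u] = 0].
Proof.
move=> algD oT lT pN u.
have [nz|z] := classic (nonzero N).
  have [f [Df nf fu]] := algD _ (linked_contract hD hst oT lT pN nz) u.
  by exists f; split=> // Nf; apply: nf => i.
have [f [Df nf fu]] := @alg_at_zero K D D (@zeroS K) hD oD (fun x e => e) u.
exists f; split=> // Nf; apply: nf => i; apply/eqP; apply: contraT => fi.
by case: z; exists f`_i.
Qed.

Lemma linked_alg_at T P : alg_at_qprimes -> overring D T -> linked D st T -> prime_in T P ->
  alg_at T P.
Proof.
move=> algD oT lT pP u; have [f [Df nf fu]] := linked_alg algD oT lT pP u.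
by exists f; split=> // i; apply: (proj2 oT).
Qed.

Lemma alg_at_qprimes_tilde_quasi_prufer : star_quasi_prufer D tilde <-> alg_at_qprimes.
Proof.
split=> [qpD P qP|algD Q P pQ qP QP]; last first.
  exact: (prime_extended sD (proj2 qP) (algD P qP) pQ QP).
by apply: (alg_at_of_extended hD oD) => Q pQ QP; apply: qpD qP QP.
Qed.

Lemma alg_at_qprimes_stably_strong_S T : alg_at_qprimes -> overring D T -> linked D st T ->
  stably_strong_S T.
Proof.
move=> algD oT lT n; apply: strong_S_mcoefs; first by case: oT.
by move=> P; apply: linked_alg_at.
Qed.

Lemma alg_at_qprimes_quasi_prufer T : alg_at_qprimes -> overring D T -> linked D st T -> quasi_prufer T.
Proof.
move=> algD oT lT Q P pQ [_ pP] QP.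
by apply: (prime_extended _ pP _ pQ QP); [case: oT|apply: linked_alg_at].
Qed.

Lemma alg_at_qprimes_jaffard T : tilde_dim_finite D st -> alg_at_qprimes -> overring D T ->
  linked D st T -> jaffard T.
Proof.
move=> [n dimD] algD oT lT; have [sT DT] := oT.
have bound : ~ exists c, chain_in T c n.+1.
  case=> c hc; have [cp cs] := hc.
  have cD := chain_contract sD sT DT (fun i le => linked_alg algD oT lT (cp i (ltnW le))) hc.
  have pN := cp n.+1 (leqnn _).
  have nz : nonzero (c n.+1).
    have [_ [x [cx ncx]]] := cs n (leqnn _); exists x; split=> //.
    apply/eqP => x0; apply: ncx; rewrite x0; exact: (ideal0 (cp n (leqnSn _)).1).
  apply: (dimD _ (linked_contract hD hst oT lT pN nz)).
  by exists (fun i x => D x /\ c i x); split=> //; split=> x [].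
(* [d] is the least bound for the lengths of chains, hence attained: the Krull dimension of [T]. *)
pose Q d := boolp.asbool (~ exists c, chain_in T c d.+1).
have ex : exists d, Q d by exists n; apply/boolp.asboolP.
have [d /boolp.asboolP nd min] := ex_minnP ex.
have [c hc] : exists c, chain_in T c d.
  case: d nd min => [|d] nd min; first by exists (fun _ => @zeroS K); split=> // i _; apply: zero_prime.
  apply: NNPP => nc; suff /min : Q d by rewrite ltnn.
  by apply/boolp.asboolP => -[c hc]; apply: nc; exists c.
exists d; split; last split.
- by split=> //; exists c.
- move=> V [[sV TV] vV] [c' hc']; apply: nd.
  have [cp' cs'] := hc'.
  exists (fun i x => T x /\ c' i x); apply: (chain_contract sT sV TV _ hc') => i le u.
  have pNT := prime_contract sT TV (cp' i (ltnW le)).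
  have [f [Tf nf fu]] := linked_alg_at algD oT lT pNT u.
  by exists f; split=> // Nf; apply: nf.
have [V [c' [vV TV hc' _]]] := chain_lift sT hc.
by exists V; split; [split; [split; case: vV|case: vV]|exists c'].
Qed.

Lemma bad_prime P : qprime D tilde P -> ~ alg_at D P -> exists u,
  forall f : {poly K}, coefs_in D f -> f.[u] = 0 -> coefs_in P f.
Proof.
move=> qP bad; apply: NNPP => n; apply: bad => u; apply: NNPP => nf; apply: n; exists u.
by move=> f Df fu; apply: NNPP => nPf; apply: nf; exists f.
Qed.

(** Condition (4) is applied only to the linked overring [D_P]; equations over it descend to [D] by
    clearing denominators outside [P]. *)
Lemma loc_quasi_prufer_alg_at P : qprime D tilde P ->
  quasi_prufer (loc D (compl D P)) -> alg_at D P.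
Proof.
move=> qP qpT; have [qiP pP] := qP; have mS := compl_mult sD pP; have iP := pP.1.
set T := loc _ _ in qpT; have sT : subring T by apply: loc_subring.
have DT : subset D T by move=> d Dd; apply: loc_base mS _.
have pT := loc_prime sD pP.
have qT : qprime T id (loc P (compl D P)).
  split=> //; split; first exact: pT.1.
  split; first by have [_ [[x [Px x0]] _]] := qiP; exists x; split=> //; apply: loc_base mS _.
  by split=> [x []|x Px] //; split=> //; apply: (idealS pT.1).
have oT : overring D T by [].
have algT : alg_at T (loc P (compl D P)).
  by apply: (alg_at_of_extended hD oT) => Q pQ QP; apply: qpT qT QP.
move=> u; have [f [Tf nf fu]] := algT u.
have [s Ss Dsf] := loc_common_denom sD mS (ideal_self sD) Tf.
have s0 := mult_neq0 mS Ss.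
exists (s *: f); split=> //; last by rewrite hornerZ fu mulr0.
move=> Psf; apply: nf => i; exists (s *: f)`_i, s; split=> //.
by rewrite coefZ mulrC mulKf.
Qed.

Lemma jaffard_alg_at_qprimes : (forall T, overring D T -> linked D st T -> jaffard T) -> alg_at_qprimes.
Proof.
move=> jT P qP; apply: NNPP => bad; have [u uP] := bad_prime qP bad.
have [_ pP] := qP; have [V [vV DV Vu VP]] := chevalley_gauss sD pP uP.
have [oR lR] := loc_linked hD hst qP (pullback_subring sD pP vV DV VP) (@pullback_loc K D P V vV).
exact: (pullback_not_jaffard sD pP vV DV Vu VP (jT _ oR lR)).
Qed.

(** If every bad prime contained a smaller one, chains of any length would end at [P]; finite
    dimension therefore yields a minimal bad prime. *)
Lemma minimal_bad_prime n P : qprime D tilde P -> ~ alg_at D P ->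
  (forall p, qprime D tilde p -> ~ alg_at D p -> exists p', [/\ qprime D tilde p',
     ~ alg_at D p' & ssubset p' p]) ->
  exists c, chain_in D c n /\ c n = P.
Proof.
move=> + + desc; elim: n P => [|n IHn] P qP bad.
  by exists (fun _ => P); split=> //; split=> // i _; case: qP.
have [p' [qp' bad' lt]] := desc P qP bad.
have [c [[cp cs] ec]] := IHn p' qp' bad'.
exists (fun i => if (i <= n)%N then c i else P); split; last by rewrite ltnn.
split=> i.
  by move=> _; case: leqP => [le|_]; [apply: cp|case: qP].
rewrite ltnS => le; rewrite le; case: ltnP => [lt'|ge]; first exact: cs.
have -> : i = n by apply/eqP; rewrite eqn_leq le.
by rewrite ec.
Qed.

(** For a minimal bad [P], primes of [V] not containing [P] contract strictly inside [P], where
    equations exist. So their chains contract strictly, and finite dimension gives a largest such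
    prime [N0]. Localizing at the least prime [N1] that contains [P] makes [N0] adjacent to the
    maximal ideal. *)
Lemma strong_S_alg_at_qprimes : tilde_dim_finite D st ->
  (forall T, overring D T -> linked D st T -> strong_S T) -> alg_at_qprimes.
Proof.
move=> [n dimD] ssT P0 qP0; apply: NNPP => bad0.
have [P [qP bad minP]] : exists P, [/\ qprime D tilde P, ~ alg_at D P &
    forall p, qprime D tilde p -> ssubset p P -> alg_at D p].
  apply: NNPP => nP.
  have [|c [hc ec]] := minimal_bad_prime n.+1 qP0 bad0.
    move=> p qp badp; apply: NNPP => np; apply: nP; exists p; split=> // p' qp' lt.
    by apply: NNPP => badp'; apply: np; exists p'.
  by apply: (dimD _ qP0); exists c; split=> //; rewrite ec; split.
have [u uP] := bad_prime qP bad; have [[iP [nzP _]] pP] := qP.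
have [V [vV DV Vu VP]] := chevalley_gauss sD pP uP; have [sV _] := vV.
have contr := maxid_contract sD pP VP.
have below N : prime_in V N -> ~ subset P N -> forall d, D d -> N d -> P d.
  by move=> pN _ d Dd /(val_prime_sub vV pN) /(contr d Dd).
have algN N : prime_in V N -> ~ subset P N -> forall v, exists f : {poly K},
    [/\ coefs_in D f, ~ coefs_in N f & f.[v] = 0].
  move=> pN nPN v.
  have NP : ssubset (fun x => D x /\ N x) P.
    split; first by move=> x [Dx Nx]; apply: (below N).
    apply: NNPP => nx; apply: nPN => x Px; apply: NNPP => nN; apply: nx.
    by exists x; split=> // -[].
  have [nz|z] := classic (nonzero (fun x => D x /\ N x)).
    have qp := qprime_sub qP (prime_contract sD DV pN) (proj1 NP) nz.
    have [f [Df nf fv]] := minP _ qp NP v.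
    by exists f; split=> // Nf; apply: nf => i.
  have [f [Df nf fv]] := @alg_at_zero K D D (@zeroS K) hD oD (fun x e => e) v.
  exists f; split=> // Nf; apply: nf => i; apply/eqP; apply: contraT => fi.
  by case: z; exists f`_i.
(* Otherwise the chain contracts to one of length [n] strictly inside [P], and [P] on top makes its
   length [n.+1]. *)
have bound c : chain_in V c n -> subset P (c n).
  move=> hc; apply: NNPP => nPc; have [cp cs] := hc.
  have nPi i : (i <= n)%N -> ~ subset P (c i).
    by move=> le Pi; apply: nPc => x /Pi; apply: (chain_mono hc le (leqnn n)).
  have alg_ i (le : (i < n)%N) := algN (c i) (cp i (ltnW le)) (nPi i (ltnW le)).
  have [cp' cs'] := chain_contract sD sV DV alg_ hc.
  apply: (dimD _ qP).
  exists (fun i => if (i <= n)%N then (fun x => D x /\ c i x) else P).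
  split; last by rewrite ltnn; split=> x.
  split=> i; first by move=> _; case: leqP => [le|_]; [apply: cp'|].
  rewrite ltnS => le; rewrite le; case: ltnP => [lt|ge]; first exact: cs'.
  split; first by move=> x [Dx cx]; apply: (below (c i)) => //; [apply: cp|apply: nPi].
  apply: NNPP => nx; apply: (nPi i le) => x Px; apply: NNPP => ncx; apply: nx.
  by exists x; split=> // -[].
have [N0 [pN0 nPN0 maxN0]] : exists N0, [/\ prime_in V N0, ~ subset P N0 &
    forall N, prime_in V N -> ssubset N0 N -> subset P N].
  apply: NNPP => nex.
  have step N : prime_in V N -> ~ subset P N -> exists N', [/\ prime_in V N',
      ~ subset P N' & ssubset N N'].
    move=> pN nPN; apply: NNPP => n'; apply: nex; exists N; split=> // N' pN' lt.
    by apply: NNPP => nPN'; apply: n'; exists N'.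
  have long k : exists2 c, chain_in V c k & ~ subset P (c k).
    elim: k => [|k [c [cp cs] nPc]].
      exists (fun _ => @zeroS K); first by split=> // i _; apply: zero_prime.
      by have [x [Px x0]] := nzP => /(_ x Px) /eqP; rewrite (negPf x0).
    have [N' [pN' nPN' lt]] := step _ (cp k (leqnn _)) nPc.
    exists (fun i => if (i <= k)%N then c i else N'); last by rewrite ltnn.
    split=> i; first by move=> _; case: leqP => [le|_]; [apply: cp|].
    rewrite ltnS => le; rewrite le; case: ltnP => [lt'|ge]; first exact: cs.
    by have -> : i = k by apply/eqP; rewrite eqn_leq le.
  by have [c hc nPc] := long n; apply: nPc; apply: bound.
(* This intersection is prime because the ideals of a valuation ring are totally ordered. *)
pose N1 : set K := fun x => forall N, prime_in V N -> subset P N -> N x.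
have PM : subset P (maxid V) by move=> x Px; apply/contr => //; apply: (idealS pP.1).
have N1M : subset N1 (maxid V) by move=> x; apply; [apply: maxid_prime|].
have pN1 : prime_in V N1.
  split.
    split; first by move=> x /N1M; apply: maxidS.
    split; first by move=> N pN _; apply: (ideal0 pN.1).
    split=> [x y N1x N1y N pN PN|a x Va N1x N pN PN].
      by apply: (idealB pN.1); [apply: N1x|apply: N1y].
    by apply: (idealM pN.1) => //; apply: N1x.
  split; first by move/N1M; apply: maxid1.
  move=> a b Va Vb N1ab; apply: NNPP => /not_or_and [na nb].
  have wit x : ~ N1 x -> exists N, [/\ prime_in V N, subset P N & ~ N x].
    move=> nx; apply: NNPP => n'; apply: nx => N pN PN; apply: NNPP => nN.
    by apply: n'; exists N.
  have [Na [pNa PNa nNa]] := wit a na; have [Nb [pNb PNb nNb]] := wit b nb.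
  case: (ideals_total vV pNa.1 pNb.1) => h.
    by case: (prime_mul pNa Va Vb (N1ab _ pNa PNa)) => // /h.
  by case: (prime_mul pNb Va Vb (N1ab _ pNb PNb)) => // /h.
have PN1 : subset P N1 by move=> x Px N pN PN; apply: PN.
(* [V'] is a valuation ring with maximal ideal [N1]; as [P] lies in [N1], the residue of [u] stays
   transcendental over [P]. *)
pose V' := loc V (compl V N1).
have mS := compl_mult sV pN1; have sV' : subring V' by apply: loc_subring.
have VV' : subset V V' by move=> x Vx; apply: loc_base mS _.
have vV' : val_ring V'.
  by split=> // x x0; case: (proj2 vV x x0) => /VV' ?; [left|right].
have maxV' x : maxid V' x <-> N1 x.
  split=> [mx|N1x].
    have [->|x0] := eqVneq x 0; first exact: (ideal0 pN1.1).
    have Vx : V x.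
      have [//|/VV' V'x] := proj2 vV x x0.
      by move/eqP: (maxidVN mx V'x); rewrite (negPf x0).
    apply: NNPP => nN1x; move/eqP: x0; apply; apply: (maxidVN mx).
    by apply: loc_inv mS sV _.
  have [->|x0] := eqVneq x 0; [by left|right=> -[a [s [Va [Vs ns] e]]]; apply: ns].
  have s0 : s != 0.
    by apply: contra_neq x0 => z; rewrite -[x]invrK e z invr0 mulr0 invr0.
  rewrite (_ : s = a * x); first exact: (idealM pN1.1).
  rewrite -[x]invrK e invf_div mulrC divfK //.
  by apply: contra_neq x0 => z; rewrite -[x]invrK e z mul0r invr0.
have DV' : subset D V' by move=> d /DV /VV'.
have V'P f : coefs_in D f -> maxid V' f.[u] <-> coefs_in P f.
  move=> Df; split=> [/maxV' /N1M /(VP f Df) //|Pf]; apply/maxV'.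
  by apply: (coefs_horner pN1.1 sV Vu) => i; apply: PN1.
have Vu' := VV' _ Vu.
have [oR lR] := loc_linked hD hst qP (pullback_subring sD pP vV' DV' V'P) (@pullback_loc K D P V' vV').
have N01 : subset N0 N1.
  by case: (ideals_total vV pN0.1 pN1.1) => // N10; case: nPN0 => x /PN1 /N10.
have unit0 s : V s -> ~ N1 s -> s != 0.
  by move=> _ ns; apply/eqP => z; apply: ns; rewrite z; apply: (ideal0 pN1.1).
have N0V' x y : V' x -> N0 y -> N0 (x * y).
  move=> [a [s [Va [Vs ns] ->]]] N0y; have s0 := unit0 s Vs ns.
  have N0ay : N0 (a * y) by apply: (idealM pN0.1).
  have mxs : maxid V' (a / s * y).
    have V'as : V' (a / s) by exists a, s.
    by apply: (idealM (maxid_ideal vV') V'as); apply/maxV'; apply: (N01 _ N0y).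
  have Vxs := idealS pN1.1 (proj1 (maxV' _) mxs).
  have : N0 (s * (a / s * y)) by rewrite mulrA mulrCA mulfV // mulr1.
  by case/(prime_mul pN0 Vs Vxs) => // /(N01 s).
have pN0' : prime_in V' N0.
  split.
    split; first by move=> x /(idealS pN0.1) /VV'.
    split; first exact: (ideal0 pN0.1).
    by split=> [x y|x y]; [exact: (idealB pN0.1)|exact: N0V'].
  split; first by case: pN0 => _ [].
  move=> _ _ [a [s [Va Ss ->]]] [b [t [Vb St ->]]] N0ab.
  have [[Vs ns] [Vt nt]] := (Ss, St); have s0 := unit0 s Vs ns; have t0 := unit0 t Vt nt.
  have : N0 (a * b).
    rewrite (_ : a * b = s * t * (a / s * (b / t))); last by field; rewrite s0 t0.
    by apply: (idealM pN0.1) => //; apply: (subringM sV).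
  case/(prime_mul pN0 Va Vb) => h; [left|right]; rewrite mulrC; apply: N0V' => //.
    by apply: loc_inv mS sV _.
  by apply: loc_inv mS sV _.
apply: (pullback_not_strong_S sD pP vV' DV' Vu' V'P pN0' _ _ (ssT _ oR lR)).
- split; first by move=> x N0x; apply/maxV'; apply: (N01 _ N0x).
  have [x [Px nN0x]] : exists x, P x /\ ~ N0 x.
    by apply: NNPP => n'; apply: nPN0 => x Px; apply: NNPP => nN; apply: n'; exists x.
  by exists x; split=> //; apply/maxV'; apply: (PN1 _ Px).
move=> N pN N0N [NM [x [/maxV' N1x nNx]]]; apply: nNx; apply: N1x.
  apply: (prime_restrict sV VV' _ pN) => y /NM /maxV'; exact: (idealS pN1.1).
apply: maxN0 N0N; apply: (prime_restrict sV VV' _ pN) => y /NM /maxV'.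
exact: (idealS pN1.1).
Qed.

End Linked.

Theorem theorem3p2 (K : fieldType) (D : set K) (st : set K -> set K) :
  domain_with_qf D -> semistar D st -> tilde_dim_finite D st ->
  [<-> (forall T, overring D T -> linked D st T -> stably_strong_S T);
       (forall T, overring D T -> linked D st T -> strong_S T);
       (forall T, overring D T -> linked D st T -> jaffard T);
       (forall T, overring D T -> linked D st T -> quasi_prufer T);
       star_quasi_prufer D (star_tilde D st)].
Proof.
move=> hD hst fin; have sD := hD.1; have tildeP := alg_at_qprimes_tilde_quasi_prufer st hD.
tfae=> [H T oT lT|H|H|H|/tildeP alg_ T].
- exact: (H T oT lT 0%N).
(* This implication and the next both pass through condition (5), in the form [alg_at_qprimes]. *)
- by move=> T; apply: alg_at_qprimes_jaffard => //; apply: strong_S_alg_at_qprimes.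
- by move=> T; apply: alg_at_qprimes_quasi_prufer => //; apply: jaffard_alg_at_qprimes.
- apply/tildeP => P qP; apply: (loc_quasi_prufer_alg_at hD qP); have pP := qP.2.
  have [oT lT] := loc_linked hD hst qP (loc_subring sD (compl_mult sD pP)) (fun x Tx => Tx).
  exact: H.
- exact: alg_at_qprimes_stably_strong_S.
Qed.
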